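(* Let $e_t=\sum_{j=-\infty}^{\infty}\psi_j\xi_{t-j}$, where $\{\xi_j\}$ are i.i.d. with $E[\xi_1]=0$, $E[\xi_1^2]=1$, $E[\xi_1^6]<\infty$, $\gamma(0)=\sum_j\psi_j^2<\infty$, and $\gamma(k)=E[e_te_{t+k}]=\sum_j\psi_j\psi_{j+k}\sim\eta|k|^{-\alpha}$ as $k\to\infty$, with $\lambda=(\alpha,\eta)$, $0<\alpha<1$, $0<\eta<\infty$. Let $\{X_t\}$ be i.i.d., independent of $\{e_s\}$, with bounded uniformly continuous density $f$. Assume there exist estimators $\widetilde\lambda$ with $\|\widetilde\lambda-\lambda\|=O_P(w_n^{-1})$ for positive $w_n$ with $w_n/\log n\to\infty$. Let $K$ be a bounded symmetric probability density on $\mathbb{R}$ such that, given $\tfrac12<\alpha<1$, there exists $0<\beta<\alpha-\tfrac12$ with $K(x)=O(1/(1+|x|^{1-\beta}))$. Let $a_n(x,y)=K\big(\frac{x-y}{h}\big)$. (i) If $n^{2(1-\alpha)}h\to0$ and $nh\to\infty$, then $\sum_{t=1}^n\sum_{s=1,s\ne t}^ne_sa_n(X_s,X_t)e_t/\sigma_{1n}(h)\to_D N(0,1)$, where $\sigma_{1n}^2(h)=n^2hA_{1\alpha}^2$ and $A_{1\alpha}^2=2\gamma^2(0)\int K^2(x)\,dx\int f^2(y)\,dy$. (ii) If $h\to0$ and $n^{2(1-\alpha)}h\to\infty$, then $\sum_{t=1}^n\sum_{s=1,s\ne t}^ne_sa_n(X_s,X_t)e_t/\sigma_{2n}(h)\to_D\chi^2(1)$,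 where $\sigma_{2n}(h)=n^{2-\alpha}hA_{2\alpha}$ and $A_{2\alpha}=\frac{2\eta}{(1-\alpha)(2-\alpha)}\int f^2(y)\,dy$.
   Context: $h=h_n>0$ is a bandwidth, limits are as $n\to\infty$, $a_n\sim b_n$ means $a_n/b_n\to1$, and $\chi^2(1)$ is the chi-squared distribution with one degree of freedom. *)

(* Defs.v *)
From HB Require Import structures.
From mathcomp Require Import all_boot all_order all_algebra.
From mathcomp Require Import all_classical all_reals all_analysis.
Set Implicit Arguments. Unset Strict Implicit. Unset Printing Implicit Defensive.
Import Order.TTheory GRing.Theory Num.Theory.
Import numFieldNormedType.Exports.
Local Open Scope classical_set_scope.
Local Open Scope ring_scope.

Section defs.
Context {d : measure_display} {T : measurableType d} {R : realType}.
Variable P : probability T R.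

Definition mutually_indep (I : eqType) (X : I -> T -> R) : Prop :=
  forall (s : seq I) (A : I -> set R), uniq s ->
    (forall i, measurable (A i)) ->
    P (\bigcap_(i in [set` s]) (X i @^-1` A i)) =
      (\prod_(i <- s) P (X i @^-1` A i))%E.

Definition ident_distr (I : Type) (X : I -> T -> R) : Prop :=
  forall i j (A : set R), measurable A -> P (X i @^-1` A) = P (X j @^-1` A).

(** independence of two families of random variables (of the sigma-algebras
    they generate): product rule for every finite-dimensional cylinder event *)
Definition indep_families (I J : eqType) (X : I -> T -> R) (Y : J -> T -> R)
  : Prop :=
  forall (s : seq I) (s' : seq J) (A : I -> set R) (B : J -> set R),
    (forall i, measurable (A i)) -> (forall j, measurable (B j)) ->
    P ((\bigcap_(i in [set` s]) (X i @^-1` A i)) `&`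
       (\bigcap_(j in [set` s']) (Y j @^-1` B j))) =
    (P (\bigcap_(i in [set` s]) (X i @^-1` A i)) *
     P (\bigcap_(j in [set` s']) (Y j @^-1` B j)))%E.

Definition is_density (X : T -> R) (f : R -> R) : Prop :=
  measurable_fun setT f /\ (forall x, 0 <= f x) /\
  forall A : set R, measurable A ->
    P (X @^-1` A) = (\int[lebesgue_measure]_(x in A) (f x)%:E)%E.

Definition cvg_in_distr (S : nat -> T -> R) (mu : set R -> \bar R) : Prop :=
  forall x : R, {for x, continuous (fun y => fine (mu [set z | z <= y]))} ->
    P [set w | S n w <= x] @[n --> \oo] --> mu [set z | z <= x].

End defs.

Definition ssum {R : realType} (u : int -> R) (N : nat) : R :=
  \sum_(i < (N.*2).+1) u (i%:Z - N%:Z).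

Definition zseries {R : realType} (u : int -> R) : R := lim (ssum u @ \oo).

Definition gam {R : realType} (psi : int -> R) (k : int) : R :=
  zseries (fun j => psi j * psi (j + k)).

Definition std_normal {R : realType} : set R -> \bar R := normal_prob 0 1.

Definition chi2_1 {R : realType} (A : set R) : \bar R :=
  normal_prob 0 1 [set z : R | z ^+ 2 \in A].

Definition lint {R : realType} (g : R -> R) : R :=
  fine (\int[lebesgue_measure]_(x in [set: R]) (g x)%:E)%E.

Definition qstat {T : Type} {R : realType} (e : int -> T -> R)
  (X : nat -> T -> R) (K : R -> R) (h : R) (n : nat) (w : T) : R :=
  \sum_(1 <= t < n.+1) \sum_(1 <= s < n.+1 | s != t)
     e s%:Z w * K ((X s w - X t w) / h) * e t%:Z w.

(* Main.v *)
Require Import Defs.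
From HB Require Import structures.
From mathcomp Require Import all_boot all_order all_algebra.
From mathcomp Require Import all_classical all_reals all_analysis.
From mathcomp Require Import measurable_realfun.
From mathcomp Require Import ring lra zify.
Set Implicit Arguments. Unset Strict Implicit. Unset Printing Implicit Defensive.
Import Order.TTheory GRing.Theory Num.Theory.
Import numFieldNormedType.Exports.
Local Open Scope classical_set_scope.
Local Open Scope ring_scope.

(** Given the errors, the Hoeffding decomposition of the kernel [K ((x - y) / h)]
    splits the quadratic form into a degenerate form [U] in the design points, a
    linear term [L], and [mu * ((sum e)^2 - sum e^2)] with [mu ~ h * int f^2].
    As [E (sum e)^2] grows like [n^(2 - alpha)], the first has order [n h^(1/2)] and
    the last has order [n^(2 - alpha) h], while [L] is negligible in [L^1]; the size
    of [n^(2 (1 - alpha)) h] decides which of them dominates.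

    In regime (i), [U] is for fixed errors a sum of martingale differences, and
    replacing these one at a time by Gaussian variables bounds its distance to the
    normal law.  The bound involves the errors only through [sum e^2] and [sum e^4],
    which are controlled by a law of large numbers and by fourth moments.

    In regime (ii), [sum e] is a weighted sum of the innovations in which no weight
    dominates, hence asymptotically normal by the same replacement argument; its
    square gives the chi-squared limit. *)

(** * Real-valued expectation *)

(** Conditional expectations never occur: a variable independent of the others is integrated over a
    second sample point, so that conditioning becomes an iterated expectation. The normal limits use
    test functions with a uniform third-order Taylor remainder, a class that Gaussian averaging
    preserves with the same constant. In regime (i) the conditional variance of [U] fluctuates with
    the design points. The fluctuation is governed by the iterated kernel [Gk], whose mean square is
    of order [h^3] while the squared variance of the kernel is of order [h^2]; the spare factor [h]
    makes the martingale argument close. In regime (ii) the errors are known only as almost sure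
    limits of series. Moments are bounded on finite windows with constants that do not see the
    window, and the window grows while the number of summands stays fixed. With
    [Y n = n^(1 - alpha)] the normalisations are [n h^(1/2)] and [n Y h] up to constants, the
    variance of [sum e] is of order [n Y], and the two regimes are told apart by [Y^2 h]. *)

Section expectation.
Context {d : measure_display} {T : measurableType d} {R : realType}.
Variable P : probability T R.
Implicit Types f g : T -> R.

Definition L1 f := P.-integrable setT (EFin \o f).
Definition Ex f : R := \int[P]_w f w.

Lemma eq_Ex f g : f =1 g -> Ex f = Ex g.
Proof. by move=> fg; congr Ex; exact/funext. Qed.

Lemma eq_L1 f g : f =1 g -> L1 f -> L1 g.
Proof. by move=> /funext ->. Qed.

Lemma L1_meas f : L1 f -> measurable_fun setT f.
Proof. by move=> /measurable_int /measurable_EFinP. Qed.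

Lemma L1D f g : L1 f -> L1 g -> L1 (fun w => f w + g w).
Proof. by move=> lf lg; exact: (integrableD measurableT lf lg). Qed.

Lemma L1Z c f : L1 f -> L1 (fun w => c * f w).
Proof. by move=> lf; exact: (integrableZl measurableT c lf). Qed.

Lemma L1N f : L1 f -> L1 (fun w => - f w).
Proof. by move=> lf; exact: (integrableN lf). Qed.

Lemma L1B f g : L1 f -> L1 g -> L1 (fun w => f w - g w).
Proof. by move=> lf lg; exact: (L1D lf (L1N lg)). Qed.

Lemma L1_abs f : L1 f -> L1 (fun w => `|f w|).
Proof. by move=> lf; exact: (integrable_norm lf). Qed.

Lemma L1_dom f g : measurable_fun setT f -> (forall w, `|f w| <= g w) -> L1 g -> L1 f.
Proof.
move=> mf fg lg; apply: (le_integrable measurableT _ _ lg).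
  exact/measurable_EFinP.
by move=> w _ /=; rewrite lee_fin (le_trans (fg w))// ler_norm.
Qed.

Lemma L1_cst c : L1 (fun=> c).
Proof. exact: finite_measure_integrable_cst. Qed.

Lemma L1_bnd f c : measurable_fun setT f -> (forall w, `|f w| <= c) -> L1 f.
Proof. by move=> mf fc; exact: (L1_dom mf fc (L1_cst c)). Qed.

Lemma L1_sum (I : Type) (s : seq I) (p : pred I) (F : I -> T -> R) :
  (forall i, p i -> L1 (F i)) -> L1 (fun w => \sum_(i <- s | p i) F i w).
Proof.
move=> lF; elim: s => [|i s IH].
  by apply: eq_L1 (L1_cst 0) => w; rewrite big_nil.
apply: (@eq_L1 (fun w => (if p i then F i w else 0) +
                          \sum_(j <- s | p j) F j w)).
  by move=> w; rewrite big_cons; case: ifP => // _; rewrite add0r.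
by apply: L1D IH; case: (boolP (p i)) => [/lF//|_]; exact: L1_cst.
Qed.

Lemma ExD f g : L1 f -> L1 g -> Ex (fun w => f w + g w) = Ex f + Ex g.
Proof. by move=> lf lg; rewrite /Ex RintegralD. Qed.

Lemma ExB f g : L1 f -> L1 g -> Ex (fun w => f w - g w) = Ex f - Ex g.
Proof. by move=> lf lg; rewrite /Ex RintegralB. Qed.

Lemma ExZ c f : L1 f -> Ex (fun w => c * f w) = c * Ex f.
Proof. by move=> lf; rewrite /Ex RintegralZl. Qed.

Lemma Ex_cst c : Ex (fun=> c) = c.
Proof. by rewrite /Ex Rintegral_cst// [X in fine X]probability_setT mulr1. Qed.

Lemma Ex_sum (I : Type) (s : seq I) (p : pred I) (F : I -> T -> R) :
  (forall i, p i -> L1 (F i)) ->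
  Ex (fun w => \sum_(i <- s | p i) F i w) = \sum_(i <- s | p i) Ex (F i).
Proof.
move=> lF; elim: s => [|i s IH].
  rewrite big_nil -[RHS](Ex_cst 0); apply: eq_Ex => w; by rewrite big_nil.
rewrite big_cons; case: ifPn => pi.
  rewrite -IH -ExD; [|exact: lF|exact: L1_sum].
  by apply: eq_Ex => w; rewrite big_cons pi.
by rewrite -IH; apply: eq_Ex => w; rewrite big_cons (negbTE pi).
Qed.

Lemma Ex_le f g : L1 f -> L1 g -> (forall w, f w <= g w) -> Ex f <= Ex g.
Proof. by move=> lf lg fg; apply: le_Rintegral. Qed.

Lemma Ex_ge0 f : (forall w, 0 <= f w) -> 0 <= Ex f.
Proof. by move=> f0; apply: Rintegral_ge0. Qed.

Lemma Ex_abs f : L1 f -> `|Ex f| <= Ex (fun w => `|f w|).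
Proof. by move=> lf; apply: le_normr_Rintegral. Qed.

Lemma Ex_le_cst f c : L1 f -> (forall w, f w <= c) -> Ex f <= c.
Proof. by move=> lf fc; rewrite -[leRHS]Ex_cst; apply: Ex_le => //; exact: L1_cst. Qed.

Lemma Ex_abs_le f g : L1 f -> L1 g -> (forall w, `|f w| <= g w) -> `|Ex f| <= Ex g.
Proof.
by move=> lf lg fg; apply: (le_trans (Ex_abs lf)); apply: Ex_le => //; exact: L1_abs.
Qed.

Lemma Ex_abs_le_cst f c : L1 f -> (forall w, `|f w| <= c) -> `|Ex f| <= c.
Proof.
by move=> lf fc; rewrite -[leRHS]Ex_cst; apply: Ex_abs_le => //; exact: L1_cst.
Qed.

Lemma Ex_fin f : L1 f -> (Ex f)%:E = (\int[P]_w (f w)%:E)%E.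
Proof. by move=> lf; rewrite /Ex /Rintegral fineK//; exact: integrable_fin_num lf. Qed.

Definition Pr (A : set T) : R := fine (P A).

Lemma PrE A : measurable A -> (Pr A)%:E = P A.
Proof. by move=> mA; rewrite fineK// fin_num_measure. Qed.

Lemma PrEx A : measurable A -> Pr A = Ex \1_A.
Proof. by move=> mA; rewrite /Pr /Ex /Rintegral integral_indic// setIT. Qed.

Lemma L1_indic A : measurable A -> L1 \1_A.
Proof. by move=> mA; exact: integrable_indic. Qed.

Lemma Pr_ge0 A : 0 <= Pr A. Proof. exact: fine_ge0. Qed.

Lemma Pr_leU A B C : measurable A -> measurable B -> measurable C ->
  A `<=` B `|` C -> Pr A <= Pr B + Pr C.
Proof.
move=> mA mB mC ABC; rewrite -lee_fin EFinD !PrE//.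
apply: (le_trans (le_measure _ _ _ ABC)); rewrite ?inE//; first exact: measurableU.
exact: measureU2.
Qed.

Lemma Pr_markov f c : L1 f -> (forall w, 0 <= f w) -> 0 < c ->
  Pr [set w | c <= f w] <= Ex f / c.
Proof.
move=> lf f0 c0.
have mA : measurable [set w | c <= f w].
  rewrite -[X in measurable X]setTI; apply: measurable_fun_le => //.
  exact: L1_meas.
rewrite PrEx// ler_pdivlMr// mulrC -ExZ; last exact: L1_indic.
apply: Ex_le => //; first exact/L1Z/L1_indic.
move=> w; rewrite indicE; case: (boolP (w \in _)) => [/set_mem/= h|_].
  by rewrite mulr1.
by rewrite mulr0.
Qed.

(* optimised over [c], this is Cauchy-Schwarz *)
Lemma Ex_abs_le_sq f c : 0 < c -> measurable_fun setT f -> L1 (fun w => f w ^+ 2) ->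
  Ex (fun w => `|f w|) <= (c + Ex (fun w => f w ^+ 2) / c) / 2.
Proof.
move=> c0 mf lf.
have key w : `|f w| <= (c + f w ^+ 2 / c) / 2.
  rewrite ler_pdivlMr// -(ler_pM2r c0) mulrDl divfK ?gt_eqF//.
  rewrite -(real_normK (num_real (f w))); have := sqr_ge0 (`|f w| - c); nra.
have l2 : L1 (fun w => (c + f w ^+ 2 / c) / 2).
  apply: (@eq_L1 (fun w => c / 2 + c^-1 / 2 * f w ^+ 2)) => [w|].
    by field; rewrite gt_eqF.
  exact: L1D (L1_cst _) (L1Z _ lf).
have l1 : L1 f by exact: (L1_dom mf key l2).
apply: (le_trans (Ex_le (L1_abs l1) l2 key)).
rewrite (@eq_Ex _ (fun w => c / 2 + c^-1 / 2 * f w ^+ 2)); last first.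
  by move=> w; field; rewrite gt_eqF.
rewrite ExD; [|exact: L1_cst|exact: L1Z].
rewrite Ex_cst ExZ//.
by rewrite le_eqVlt; apply/orP; left; apply/eqP; field; rewrite gt_eqF.
Qed.

Lemma Ex_abs_sqrt f : measurable_fun setT f -> L1 (fun w => f w ^+ 2) ->
  Ex (fun w => `|f w|) <= Num.sqrt (Ex (fun w => f w ^+ 2)).
Proof.
move=> mf lf; have q0 : 0 <= Ex (fun w => f w ^+ 2) by apply: Ex_ge0 => w; exact: sqr_ge0.
have [s0|s0] := eqVneq (Num.sqrt (Ex (fun w => f w ^+ 2))) 0.
  (* A vanishing second moment leaves [c] free in the previous bound, which is then [eps / 2]. *)
  rewrite s0; apply/ler_addgt0Pr => eps e0; rewrite add0r.
  apply: (le_trans (Ex_abs_le_sq e0 mf lf)).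
  by move/eqP: s0; rewrite sqrtr_eq0 => h; rewrite (le_anti (andb_true_intro (conj h q0)));
     rewrite mul0r addr0; lra.
have s1 : 0 < Num.sqrt (Ex (fun w => f w ^+ 2)) by rewrite lt_neqAle eq_sym s0 sqrtr_ge0.
apply: (le_trans (Ex_abs_le_sq s1 mf lf)).
rewrite -{2}(sqr_sqrtr q0) expr2 mulfK//; lra.
Qed.

End expectation.

(** * Independence, and iterated expectation in place of conditioning *)

Section independence.
Context {d : measure_display} {T : measurableType d} {R : realType}.
Variable P : probability T R.

(** The law of the pair is the product of the two laws, so Fubini applies. The inner expectation, in
    which [V] reads a fresh sample point while [U] keeps the old one, plays the part of the
    conditional expectation given [U]. *)
Lemma diag_expectation d1 d2 (A : measurableType d1) (B : measurableType d2)
    (U : {RV P >-> A}) (V : {RV P >-> B}) (F : A -> B -> R) :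
  (forall C D, measurable C -> measurable D ->
     P (U @^-1` C `&` V @^-1` D) = P (U @^-1` C) * P (V @^-1` D))%E ->
  measurable_fun setT (fun z : A * B => F z.1 z.2) ->
  L1 P (fun w => F (U w) (V w)) ->
  (forall w, L1 P (fun w' => F (U w) (V w'))) ->
  L1 P (fun w => Ex P (fun w' => F (U w) (V w'))) /\
  Ex P (fun w => F (U w) (V w)) = Ex P (fun w => Ex P (fun w' => F (U w) (V w'))).
Proof.
move=> UV mF lF lF2.
have mUV : measurable_fun setT (fun w => (U w, V w)) by exact: measurable_fun_pair.
pose UVm : {mfun T >-> (A * B)%type} := HB.pack (fun w => (U w, V w))
  (isMeasurableFun.Build _ _ _ _ _ mUV).
pose mu1 := distribution P U; pose mu2 := distribution P V.
pose FE := EFin \o (fun z : A * B => F z.1 z.2).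
have mFE : measurable_fun setT FE by exact/measurable_EFinP.
have E1 X : measurable X -> (mu1 \x mu2)%E X = distribution P UVm X.
  apply: product_measure_unique => C D mC mD.
  by rewrite /= /pushforward -UV.
have iF : (mu1 \x mu2)%E.-integrable setT FE.
  apply/integrableP; split => //.
  rewrite (eq_measure_integral (distribution P UVm)); last by move=> X mX _; exact: E1.
  rewrite ge0_integral_distribution//; last exact: measurableT_comp.
  by case/integrableP : lF.
have eF : (\int[mu1 \x mu2]_z FE z = \int[P]_w (F (U w) (V w))%:E)%E.
  rewrite (eq_measure_integral (distribution P UVm)); last by move=> X mX _; exact: E1.
  rewrite integral_distribution//.
have F2 w : (\int[mu2]_y FE (U w, y) = (Ex P (fun w' => F (U w) (V w')))%:E)%E.
  rewrite integral_distribution//.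
  - by rewrite Ex_fin.
  - exact: measurable_fun_pair2.
  - exact: lF2.
have := integrable_fubini_F iF; have := integral12_prod_meas1 iF.
rewrite /fubini_F eF => e1 iH.
have t2 : L1 P (fun w => Ex P (fun w' => F (U w) (V w'))).
  have h : (EFin \o (fun w => Ex P (fun w' => F (U w) (V w')))) =
      (fun x => \int[mu2]_y FE (x, y))%E \o U by apply/funext => w /=; rewrite F2.
  rewrite /L1 h; apply/integrableP; split.
    apply: measurableT_comp => //; exact: measurable_int iH.
  have/integrableP[mm] := iH; rewrite ge0_integral_distribution//.
  exact: measurableT_comp.
split => //.
apply/EFin_inj; rewrite !Ex_fin// -e1 integral_distribution//.
- by apply: eq_integral => w _; rewrite -F2.
- exact: measurable_int iH.
- by apply: eq_integrable t2 => // w _ /=; rewrite -F2.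
Qed.

(** With [B] fixed, both sides are finite measures in [A] that agree on a class stable under
    intersection; uniqueness of measures extends the identity. [half] does this for one argument and
    is applied twice. *)
Lemma indep_generated (G1 G2 : set (set T)) :
  setI_closed G1 -> setI_closed G2 -> G1 setT -> G2 setT ->
  G1 `<=` measurable -> G2 `<=` measurable ->
  (forall A B, G1 A -> G2 B -> P (A `&` B) = P A * P B)%E ->
  forall A B, <<s G1 >> A -> <<s G2 >> B -> (P (A `&` B) = P A * P B)%E.
Proof.
have half (G H : set (set T)) : setI_closed G -> G setT -> G `<=` measurable ->
    H `<=` measurable ->
    (forall A B, G A -> H B -> P (A `&` B) = P A * P B)%E ->
    forall A B, <<s G >> A -> H B -> (P (A `&` B) = P A * P B)%E.
  move=> GI GT mG mH GH A B sA HB.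
  have pB0 : (0 <= fine (P B))%R by exact: fine_ge0.
  have mB := mH _ HB.
  have key : mrestr P mB A = mscale (NngNum pB0) P A.
    apply: (@g_sigma_algebra_measure_unique _ _ _ G _ (fun=> setT)) => //.
    - by rewrite bigcup_const.
    - move=> C GC /=; rewrite /mrestr /mscale /= GH//.
      by rewrite fineK ?fin_num_measure// muleC.
    - by move=> _ /=; rewrite /mrestr setTI (le_lt_trans (probability_le1 P mB))// ltry.
  move: key; rewrite /mrestr /mscale /= => ->.
  by rewrite fineK ?fin_num_measure// muleC.
move=> G1I G2I G1T G2T mG1 mG2 G12 A B sA sB.
have sub (G : set (set T)) : G `<=` measurable -> <<s G >> `<=` measurable.
  move=> mG; apply: smallest_sub => //; exact: sigma_algebra_measurable.
rewrite setIC muleC; apply: (half G2 <<s G1 >>%classic) => // {A B sA sB}; first exact: sub.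
by move=> A B G2A sB; rewrite setIC muleC; apply: (half G1 G2).
Qed.

(* the sigma-algebra of a subfamily is carried by a copy of the sample space *)
Definition cylinders (I : eqType) (X : I -> T -> R) (J : pred I) : set (set T) :=
  [set C | exists s : seq I, exists A : I -> set R,
     [/\ all J s, (forall i, measurable (A i)) &
         C = \bigcap_(i in [set` s]) (X i @^-1` A i)]].

Notation sigmaX X J := (g_sigma_algebraType (cylinders X J)).

Lemma cylindersI (I : eqType) (X : I -> T -> R) J : setI_closed (cylinders X J).
Proof.
move=> _ _ [s [A [Js mA ->]]] [s' [A' [Js' mA' ->]]].
exists (s ++ s'), (fun i => (if i \in s then A i else setT) `&`
                            (if i \in s' then A' i else setT)); split.
- by rewrite all_cat Js.
- by move=> i; apply: measurableI; case: ifP.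
- apply/seteqP; split => [w [h h'] i /= _|w h].
    split; first by case: ifP => // si; exact: h.
    by case: ifP => // si; exact: h'.
  split => i /= si.
    have /h[] : [set` s ++ s'] i by rewrite /= mem_cat si.
    by rewrite si.
  have /h[_] : [set` s ++ s'] i by rewrite /= mem_cat si orbT.
  by rewrite si.
Qed.

Lemma cylindersT (I : eqType) (X : I -> T -> R) J : cylinders X J setT.
Proof. by exists [::], (fun=> setT); split => //; apply/seteqP; split. Qed.

Lemma cylinders1 (I : eqType) (X : I -> T -> R) (J : pred I) i A : J i -> measurable A ->
  cylinders X J (X i @^-1` A).
Proof.
move=> Ji mA; exists [:: i], (fun=> A); split => //=; first by rewrite Ji.
apply/seteqP; split => [w h j /=|w]; first by rewrite inE => /eqP ->.
by apply; rewrite /= inE.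
Qed.

Lemma cylinders_measurable (I : eqType) (X : I -> {RV P >-> R}) J :
  cylinders (fun i => X i : T -> R) J `<=` measurable.
Proof.
move=> _ [s [A [_ mA ->]]]; apply: fin_bigcap_measurable => // i _.
by rewrite -[X in measurable X]setTI; exact: measurable_funP.
Qed.

Lemma sigmaX_id_measurable (I : eqType) (X : I -> {RV P >-> R}) J :
  measurable_fun setT (idfun : T -> sigmaX (fun i => X i : T -> R) J).
Proof.
move=> _ C mC; rewrite setTI; suff : <<s cylinders (fun i => X i : T -> R) J >> `<=` measurable by exact.
by apply: smallest_sub; [exact: sigma_algebra_measurable|exact: cylinders_measurable].
Qed.

Lemma sigmaX_measurable (I : eqType) (X : I -> T -> R) (J : pred I) i : J i ->
  measurable_fun setT (X i : sigmaX X J -> R).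
Proof.
by move=> Ji _ A mA; rewrite setTI; apply: sub_sigma_algebra; exact: cylinders1.
Qed.

(** Two cylinders over disjoint index sets are merged into one, with [B] taking its sets from the
    first list or from the second. Duplicates are dropped beforehand because mutual independence is
    stated for duplicate-free lists. *)
Lemma indep_disjoint (I : eqType) (X : I -> {RV P >-> R}) (J1 J2 : pred I) :
  mutually_indep P (fun i => X i : T -> R) -> (forall i, J1 i -> ~~ J2 i) ->
  forall A B, <<s cylinders (fun i => X i : T -> R) J1 >> A ->
    <<s cylinders (fun i => X i : T -> R) J2 >> B -> (P (A `&` B) = P A * P B)%E.
Proof.
move=> iX J12; apply: indep_generated; try exact: cylindersI; try exact: cylindersT;
  try exact: cylinders_measurable.
move=> _ _ [s [A [Js mA ->]]] [s' [A' [Js' mA' ->]]].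
have seq_undup (u : seq I) : [set` u] = [set` undup u].
  by apply/seteqP; split => i /=; rewrite mem_undup.
rewrite (seq_undup s) (seq_undup s'); set u := undup s; set u' := undup s'.
have us i : i \in u -> J1 i by rewrite mem_undup => /(allP Js).
have us' i : i \in u' -> J2 i by rewrite mem_undup => /(allP Js').
pose B i := if i \in u then A i else A' i.
have uu' : uniq (u ++ u').
  rewrite cat_uniq !undup_uniq /= andbT; apply/hasPn => i /us' Ji.
  by apply/negP => /us /J12; rewrite Ji.
have nB i : i \in u' -> (i \in u) = false.
  by move=> /us' Ji; apply/negP => /us /J12; rewrite Ji.
have e1 : \bigcap_(i in [set` u]) (X i @^-1` A i) = \bigcap_(i in [set` u]) (X i @^-1` B i).
  by apply: eq_bigcapr => i /= ui; rewrite /B ui.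
have e2 : \bigcap_(i in [set` u']) (X i @^-1` A' i) = \bigcap_(i in [set` u']) (X i @^-1` B i).
  by apply: eq_bigcapr => i /= ui; rewrite /B nB.
have mB i : measurable (B i) by rewrite /B; case: ifP.
rewrite e1 e2 -bigcap_setU.
have -> : [set` u] `|` [set` u'] = [set` u ++ u'].
  apply/seteqP; split => i /=; rewrite mem_cat; first by case=> ->; rewrite ?orbT.
  by move=> /orP.
by rewrite !(iX _ B)// ?undup_uniq// big_cat.
Qed.

End independence.
Notation sigmaX X J := (g_sigma_algebraType (cylinders X J)).

(** * Gaussian averages *)

Section lebesgue_changes.
Context {R : realType}.
Local Notation mu := (@lebesgue_measure R).
Local Open Scope ereal_scope.

(** The push-forward under the affine map, multiplied by [c], gives every interval its length, and
    this characterises Lebesgue measure. *)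
Lemma lebesgue_measure_affine (c b : R) (A : set (measurableTypeR R)) : (0 < c)%R -> measurable A ->
  mu A = c%:E * mu ((fun x => c * x + b)%R @^-1` A).
Proof.
move=> c0 mA.
have mf : measurable_fun setT (fun x : measurableTypeR R => (c * x + b)%R : measurableTypeR R).
  by apply: measurable_funD => //; exact: measurable_funM.
pose phi : {mfun measurableTypeR R >-> measurableTypeR R} :=
  HB.pack (fun x : measurableTypeR R => (c * x + b)%R : measurableTypeR R)
    (isMeasurableFun.Build _ _ _ _ _ mf).
have c0' : (0 <= c)%R by exact: ltW.
have := @lebesgue_measure_unique R (mscale (NngNum c0') (pushforward mu phi)).
move=> /(_ mf _ A mA); rewrite /mscale /= => -> // _ [[u v] _ <-] /=.
rewrite /pushforward /=.
have E : `]((u - b) / c)%R, ((v - b) / c)%R]%classic = (fun x => (c * x + b)%R) @^-1` `]u, v]%classic.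
  apply/seteqP; split => x /=; rewrite !in_itv /= ltr_pdivrMr// ler_pdivlMr// [(x * c)%R]mulrC;
  by rewrite ltrBlDr lerBrDr.
transitivity (c%:E * mu `]((u - b) / c)%R, ((v - b) / c)%R]%classic); last by rewrite E.
rewrite !lebesgue_measure_itv /= !lte_fin ltr_pM2r ?invr_gt0// ltrD2r.
case: ifP => _; last by rewrite mule0.
by rewrite -!EFinD -EFinM; congr EFin; field; rewrite gt_eqF.
Qed.

Lemma ge0_integral_affine (c b : R) (g : measurableTypeR R -> \bar R) : (0 < c)%R ->
  measurable_fun setT g -> (forall x, 0 <= g x) ->
  \int[mu]_x g x = c%:E * \int[mu]_x g (c * x + b)%R.
Proof.
move=> c0 mg g0.
have mf : measurable_fun setT (fun x : measurableTypeR R => (c * x + b)%R : measurableTypeR R).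
  by apply: measurable_funD => //; exact: measurable_funM.
pose phi : {mfun measurableTypeR R >-> measurableTypeR R} :=
  HB.pack (fun x : measurableTypeR R => (c * x + b)%R : measurableTypeR R)
    (isMeasurableFun.Build _ _ _ _ _ mf).
have c0' : (0 <= c)%R by exact: ltW.
rewrite (eq_measure_integral (mscale (NngNum c0') (pushforward mu phi))); last first.
  by move=> A mA _; first [exact: (lebesgue_measure_affine b c0 mA)|exact/esym/(lebesgue_measure_affine b c0 mA)].
rewrite ge0_integral_mscale//; congr (_ * _).
by rewrite ge0_integral_pushforward.
Qed.

End lebesgue_changes.

Section density.
Context {d : measure_display} {T : measurableType d} {R : realType}.
Local Open Scope ereal_scope.

Import HBNNSimple.

(** Both sides commute with increasing limits of simple functions, and for an indicator the identity
    is the hypothesis on [nu]. *)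
Lemma ge0_integral_density (mu nu : {measure set T -> \bar R}) (f : T -> R) (g : T -> \bar R) :
  measurable_fun setT f -> (forall x, 0 <= f x)%R ->
  (forall A, measurable A -> nu A = \int[mu]_(x in A) (f x)%:E) ->
  measurable_fun setT g -> (forall x, 0 <= g x) ->
  \int[nu]_x g x = \int[mu]_x (g x * (f x)%:E).
Proof.
move=> mf f0 nuE mg g0.
pose h := nnsfun_approx measurableT mg.
have -> : \int[nu]_x g x = lim (\int[nu]_x (EFin \o h n) x @[n --> \oo]).
  have gE x : g x = lim ((EFin \o h n) x @[n --> \oo]).
    by apply/esym/cvg_lim => //; exact: cvg_nnsfun_approx.
  under eq_integral do rewrite gE.
  apply: monotone_convergence => //.
  - by move=> n; exact/measurable_EFinP.
  - by move=> n x _ //=; rewrite lee_fin.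
  - by move=> x _ a b ab; rewrite lee_fin; exact/lefP/nd_nnsfun_approx.
have -> : \int[mu]_x (g x * (f x)%:E) =
    lim (\int[mu]_x ((EFin \o h n) \* (EFin \o f)) x @[n --> \oo]).
  have gf x : g x * (f x)%:E = lim (((EFin \o h n) \* (EFin \o f)) x @[n --> \oo]).
    by apply/esym/cvg_lim => //; apply: cvgeZr => //; exact: cvg_nnsfun_approx.
  under eq_integral do rewrite gf.
  apply: monotone_convergence => [//| | |].
  - by move=> n; apply/emeasurable_funM; exact/measurable_EFinP.
  - by move=> n x _ /=; rewrite mule_ge0 ?lee_fin.
  - by move=> x _ a b ab/=; rewrite lee_wpmul2r ?lee_fin//; exact/lefP/nd_nnsfun_approx.
suff suf n : \int[mu]_x ((EFin \o h n) x * (f x)%:E) = \int[nu]_x (EFin \o h n) x.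
  by under [in RHS]eq_fun do rewrite suf.
transitivity (\int[nu]_x (\sum_(y \in range (h n)) (y * \1_(h n @^-1` [set y]) x)%:E)); last first.
  by apply: eq_integral => t tE; rewrite /= fimfunE -fsumEFin.
have indich m r : measurable_fun setT (fun x => (r * \1_(h m @^-1` [set r]) x)%:E).
  by apply: (measurable_comp measurableT) => //; exact: measurable_funM.
rewrite ge0_integral_fsum//; last by move=> m y Ey; exact: nnfun_muleindic_ge0.
transitivity (\int[mu]_x (\sum_(y \in range (h n))
    (y * \1_(h n @^-1` [set y]) x)%:E * (f x)%:E)).
  under [RHS]eq_integral => x xE.
    rewrite -ge0_mule_fsuml => [|y]; last exact: nnfun_muleindic_ge0.
    rewrite fsumEFin // -(fimfunE _ x); over.
  by [].
rewrite ge0_integral_fsum//; last 2 first.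
  - by move=> y; apply: emeasurable_funM => //; exact/measurable_EFinP.
  - by move=> m y Ey; apply: mule_ge0; [exact: nnfun_muleindic_ge0|rewrite lee_fin].
apply: eq_fsbigr => r rhn.
under [RHS]eq_integral do rewrite EFinM.
rewrite integralZl_indic_nnsfun => //.
under eq_integral do rewrite EFinM -muleA.
have [x _ <-] := set_mem rhn.
rewrite ge0_integralZl//; last 3 first.
- by apply: emeasurable_funM; exact/measurable_EFinP.
- by move=> y _; rewrite mule_ge0 ?lee_fin.
- by rewrite lee_fin.
congr (_ * _); rewrite integral_indic// setIT nuE; last exact: measurable_funPTI.
rewrite [RHS]integral_mkcond; apply: eq_integral => y _.
by rewrite epatch_indic muleC.
Qed.

End density.

Section gaussian.
Context {R : realType}.
Local Notation mu := (@lebesgue_measure R).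
Local Notation Rm := (measurableTypeR R).

Definition gauss : probability Rm R := normal_prob 0 1.
Local Notation p := (normal_pdf (0:R) 1).

Lemma gauss_pdfE (m s x : R) : 0 < s ->
  normal_pdf m s x = (Num.sqrt (s ^+ 2 * pi *+ 2))^-1 * expR (- (x - m) ^+ 2 / (s ^+ 2 *+ 2)).
Proof. by move=> s0; rewrite normal_pdfE ?gt_eqF. Qed.

Lemma integral_gauss (g : Rm -> \bar R) : measurable_fun setT g -> (forall x, 0 <= g x)%E ->
  (\int[gauss]_x g x = \int[mu]_x (g x * (p x)%:E))%E.
Proof.
move=> mg g0; apply: ge0_integral_density => //; first exact: measurable_normal_pdf.
by move=> x; exact: normal_pdf_ge0.
Qed.

(** Gaussian moments are read off by completing the square: if [g] times the standard density is a
    multiple of another normal density, the total mass 1 of the latter gives the value and the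
    integrability at once. *)
Lemma gauss_moment (g : Rm -> R) (c : R) (m s : R) : 0 < s -> 0 <= c ->
  measurable_fun setT g -> (forall x, 0 <= g x) ->
  (forall x, g x * p x = c * normal_pdf m s x) -> L1 gauss g /\ Ex gauss g = c.
Proof.
move=> s0 c0 mg g0 gp.
have e : (\int[gauss]_x (g x)%:E = c%:E)%E.
  rewrite integral_gauss//; last exact/measurable_EFinP.
  under eq_integral do rewrite -EFinM gp EFinM.
  rewrite ge0_integralZl//.
  - by rewrite integral_normal_pdf mule1.
  - by apply/measurable_EFinP; exact: measurable_normal_pdf.
  - by move=> x _; rewrite lee_fin normal_pdf_ge0.
split; last by rewrite /Ex /Rintegral e.
apply/integrableP; split; first exact/measurable_EFinP.
under eq_integral do rewrite /= ger0_norm//.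
by rewrite e ltry.
Qed.

(** At [s = sqrt 2] the exponent is [z^2 / 4], which yields integrability of [z^4]; letting [s] vary
    around 1 identifies the variance. *)
Lemma gauss_exp_sqr (s : R) : 0 < s ->
  L1 gauss (fun z => expR ((1 - s ^- 2) / 2 * z ^+ 2)) /\
  Ex gauss (fun z => expR ((1 - s ^- 2) / 2 * z ^+ 2)) = s.
Proof.
move=> s0; apply: (@gauss_moment _ s 0 s) => //; first exact: ltW.
- by apply: measurableT_comp => //; apply: measurable_funM => //; exact: measurable_funX.
move=> x; rewrite !gauss_pdfE// expr1n mul1r.
rewrite -[s ^+ 2 * pi *+ 2]mulrnAr sqrtrM ?sqr_ge0// sqrtr_sqr gtr0_norm// [(s * Num.sqrt _)^-1]invfM.
rewrite mulrCA -expRD -[s^-1 * _ * _]mulrA mulVKf ?gt_eqF//; congr (_ * expR _).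
by field; rewrite gt_eqF.
Qed.

Lemma gauss_exp (m : R) :
  L1 gauss (fun z => expR (m * z)) /\ Ex gauss (fun z => expR (m * z)) = expR (m ^+ 2 / 2).
Proof.
apply: (@gauss_moment _ _ m 1) => //.
- apply: measurableT_comp => //; exact: measurable_funM.
move=> x; rewrite !gauss_pdfE// mulrCA [RHS]mulrCA -!expRD; congr (_ * expR _).
by field.
Qed.

Lemma gauss_L1_pow4 : L1 gauss (fun z => z ^+ 4).
Proof.
have s2 : 0 < Num.sqrt 2 :> R by rewrite sqrtr_gt0.
have [l _] := gauss_exp_sqr s2.
apply: (L1_dom _ _ (L1Z 64 l)); first exact: measurable_funX.
move=> z; rewrite ger0_norm ?exprn_even_ge0//.
have -> : (1 - Num.sqrt 2 ^- 2) / 2 * z ^+ 2 = z ^+ 2 / 8 + z ^+ 2 / 8 :> R.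
  by rewrite sqr_sqrtr//; field.
rewrite expRD; have h := expR_ge1Dx (z ^+ 2 / 8); have z0 := sqr_ge0 z.
have -> : z ^+ 4 = z ^+ 2 * z ^+ 2 by rewrite -exprD.
nra.
Qed.

Lemma gauss_L1_sqr : L1 gauss (fun z => z ^+ 2).
Proof.
apply: (L1_dom _ _ (L1D (L1_cst _ 1) gauss_L1_pow4)); first exact: measurable_funX.
move=> z; rewrite ger0_norm ?sqr_ge0//.
have -> : z ^+ 4 = z ^+ 2 * z ^+ 2 by rewrite -exprD.
have := sqr_ge0 (z ^+ 2 - 1); nra.
Qed.

Lemma gauss_L1_id : L1 gauss (fun z => z).
Proof.
apply: (L1_dom _ _ (L1D (L1_cst _ 1) gauss_L1_sqr)) => // z.
rewrite -(real_normK (num_real z)); have := sqr_ge0 (`|z| - 1); nra.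
Qed.

Lemma gauss_L1_abs3 : L1 gauss (fun z => `|z| ^+ 3).
Proof.
apply: (L1_dom _ _ (L1D (L1_cst _ 1) gauss_L1_pow4)).
  by apply: measurable_funX; exact: normr_measurable.
move=> z; rewrite ger0_norm ?exprn_ge0//.
have -> : z ^+ 4 = `|z| ^+ 4.
  by rewrite -[LHS]ger0_norm ?exprn_even_ge0// normrX.
have := normr_ge0 z; move: (`|z|) => y y0.
have -> : y ^+ 4 = y ^+ 3 * y by rewrite exprSr.
have := exprn_ge0 3 y0; have : y ^+ 3 <= 1 \/ 1 <= y.
  have [y1|y1] := leP y 1; last by right; exact: ltW.
  by left; rewrite exprn_ile1.
by case=> ? ?; nra.
Qed.

(** Differentiation of the exponential moment is avoided: [1 + m z <= exp (m z)] gives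
    [m E z <= exp (m^2 / 2) - 1 <= m^2] for [|m| <= 1], and small [m] of both signs force the mean
    to vanish. *)
Lemma gauss_mean : Ex gauss (fun z => z) = 0.
Proof.
set e := Ex _ _.
have key (m : R) : `|m| <= 1 -> m * e <= m ^+ 2.
  move=> m1; have [l E] := gauss_exp m.
  have : Ex gauss (fun z => 1 + m * z) <= expR (m ^+ 2 / 2).
    rewrite -E; apply: Ex_le => //; last by move=> z; exact: expR_ge1Dx.
    exact: L1D (L1_cst _ _) (L1Z _ gauss_L1_id).
  rewrite ExD ?Ex_cst ?ExZ//; [|exact: gauss_L1_id|exact: L1_cst|exact: L1Z _ gauss_L1_id].
  rewrite -/e => h.
  have m2 : m ^+ 2 <= 1 by rewrite -(real_normK (num_real m)) exprn_ile1.
  have h2 := expR_ge1Dx (- (m ^+ 2 / 2)).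
  have h3 : expR (m ^+ 2 / 2) * expR (- (m ^+ 2 / 2)) = 1 by rewrite -expRD subrr expR0.
  have h4 := expR_gt0 (m ^+ 2 / 2); have m0 := sqr_ge0 m.
  nra.
apply/eqP; rewrite -normr_le0; apply/ler_addgt0Pr => eps e0; rewrite add0r.
pose m := Num.min eps 1.
have m0 : 0 < m by rewrite lt_min e0 ltr01.
have m1 : m <= 1 by rewrite ge_min lexx orbT.
have me : m <= eps by rewrite ge_min lexx.
have := key m; have := key (- m); rewrite normrN gtr0_norm// sqrrN => /(_ m1) h1 /(_ m1) h2.
rewrite (le_trans _ me)// ler_norml; apply/andP; split; nra.
Qed.

(** The same device with the family of [gauss_exp_sqr]: values of [s] slightly above and below 1
    squeeze the second moment from the two sides. *)
Lemma gauss_var : Ex gauss (fun z => z ^+ 2) = 1.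
Proof.
set q := Ex _ _.
have key (s : R) : 0 < s -> q * (s ^+ 2 - 1) <= 2 * s ^+ 2 * (s - 1).
  move=> s0; have [l E] := gauss_exp_sqr s0.
  have : Ex gauss (fun z => 1 + (1 - s ^- 2) / 2 * z ^+ 2) <= s.
    rewrite -[leRHS]E; apply: Ex_le => //; last by move=> z; exact: expR_ge1Dx.
    exact: L1D (L1_cst _ _) (L1Z _ gauss_L1_sqr).
  rewrite ExD ?Ex_cst ?ExZ//; [|exact: gauss_L1_sqr|exact: L1_cst|exact: L1Z _ gauss_L1_sqr].
  rewrite -/q => h.
  have s2 : 0 < 2 * s ^+ 2 by rewrite mulr_gt0// exprn_gt0.
  have := ler_wpM2l (ltW s2) h; rewrite -subr_ge0 => h'; rewrite -subr_ge0.
  by apply: (le_trans h'); rewrite le_eqVlt; apply/orP; left; apply/eqP; field; rewrite gt_eqF.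
apply/eqP; rewrite -subr_eq0 -normr_le0; apply/ler_addgt0Pr => eps e0; rewrite add0r.
pose m := Num.min (eps / 3) (1/2).
have m0 : 0 < m by rewrite lt_min divr_gt0//=; lra.
have m1 : m <= 1/2 by rewrite ge_min lexx orbT.
have me : m <= eps / 3 by rewrite ge_min lexx.
have h1 : q * (2 + m) <= 2 * (1 + m) ^+ 2.
  have s0 : 0 < 1 + m by lra.
  have k := key _ s0; rewrite -(ler_pM2r m0); lra.
have h2 : 2 * (1 - m) ^+ 2 <= q * (2 - m).
  have s0 : 0 < 1 - m by lra.
  have k := key _ s0; rewrite -(ler_pM2r m0); lra.
rewrite ler_norml; apply/andP; split; nra.
Qed.

End gaussian.

Section gauss_semigroup.
Context {R : realType}.
Local Notation mu := (@lebesgue_measure R).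
Local Notation Rm := (measurableTypeR R).
Local Notation p := (normal_pdf (0:R) 1).

(** The left side is the joint density of [z] and [t = (a z + b y) / c] for independent standard
    normal [z] and [y]. The right side disintegrates it the other way: [t] is standard, and given
    [t] the variable [z] is normal with mean [a t / c] and deviation [b / c]. *)
Lemma gauss_pdf_rotation (a b c z t : R) : 0 < a -> 0 < b -> 0 < c -> c ^+ 2 = a ^+ 2 + b ^+ 2 ->
  c / b * p (c / b * t - a * z / b) * p z = p t * normal_pdf (a / c * t) (b / c) z.
Proof.
move=> a0 b0 c0 abc; rewrite !gauss_pdfE ?divr_gt0// expr1n mul1r.
rewrite -[(b / c) ^+ 2 * pi *+ 2]mulrnAr sqrtrM ?sqr_ge0// sqrtr_sqr gtr0_norm ?divr_gt0//.
rewrite [(b / c * Num.sqrt _)^-1]invfM invf_div.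
set k := (Num.sqrt (pi *+ 2))^-1.
transitivity (c / b * k * k * (expR (- (c / b * t - a * z / b - 0) ^+ 2 / 2) * expR (- (z - 0) ^+ 2 / 2))).
  by ring.
transitivity (c / b * k * k * (expR (- (t - 0) ^+ 2 / 2) *
   expR (- (z - a / c * t) ^+ 2 / ((b / c) ^+ 2 *+ 2)))); last by ring.
congr (_ * _); rewrite -!expRD; congr expR.
have e : a ^+ 2 = c ^+ 2 - b ^+ 2 by rewrite abc; ring.
have b0' : b != 0 by rewrite gt_eqF.
have c0' : c != 0 by rewrite gt_eqF.
apply: (mulfI (_ : 2 * b ^+ 2 != 0)); first by rewrite mulf_neq0// expf_neq0.
transitivity (- (c * t - a * z) ^+ 2 - b ^+ 2 * z ^+ 2); first by field.
transitivity (- b ^+ 2 * t ^+ 2 - (c * z - a * t) ^+ 2); last by field; rewrite c0' b0'.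
by rewrite !sqrrB !exprMn e; ring.
Qed.

Local Open Scope ereal_scope.

(** Substituting [t] for [y] in the inner integral brings in the joint density of
    [gauss_pdf_rotation]; Tonelli then integrates [z] out. *)
Lemma gauss_convolution (a b c : R) (phi : Rm -> \bar R) :
  (0 < a)%R -> (0 < b)%R -> (0 < c)%R -> (c ^+ 2 = a ^+ 2 + b ^+ 2)%R ->
  measurable_fun setT phi -> (forall x, 0 <= phi x) ->
  \int[gauss]_z \int[gauss]_y phi (a * z + b * y)%R = \int[gauss]_t phi (c * t)%R.
Proof.
move=> a0 b0 c0 abc mphi phi0.
have pp x : 0 <= (p x)%:E by rewrite lee_fin normal_pdf_ge0.
have mp : measurable_fun setT (p : Rm -> R) by exact: measurable_normal_pdf.
have mlin (u v : R) : measurable_fun setT (fun z : Rm * Rm => (u * z.1 + v * z.2)%R : Rm).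
  by apply: measurable_funD; apply: measurable_funM.
have mlin1 (u v : R) : measurable_fun setT (fun y : Rm => (u + v * y)%R : Rm).
  by apply: measurable_funD => //; exact: measurable_funM.
have mF : measurable_fun setT (fun z : Rm * Rm => phi (a * z.1 + b * z.2)%R).
  exact: (measurableT_comp mphi (mlin a b)).
have mphic : measurable_fun setT (fun t : Rm => phi (c * t)%R).
  by apply: measurableT_comp => //; exact: measurable_funM.
rewrite integral_gauss; last 2 first.
- exact: (measurable_fun_fubini_tonelli_F (m2 := gauss) _ mF (fun x => phi0 _)).
- by move=> z; exact: integral_ge0.
transitivity (\int[mu]_z \int[mu]_t (phi (c * t)%R * (p t * normal_pdf (a / c * t) (b / c) z)%:E)).
  apply: eq_integral => z _.
  rewrite integral_gauss//; last first.
    exact: (measurableT_comp mphi (mlin1 _ _)).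
  have mphiz : measurable_fun setT (fun y : Rm => phi (a * z + b * y)%R * (p y)%:E).
    apply: emeasurable_funM; last exact/measurable_EFinP.
    exact: (measurableT_comp mphi (mlin1 _ _)).
  have cb0 : (0 < c / b)%R by rewrite divr_gt0.
  have E := @ge0_integral_affine R (c / b) (- (a * z / b)) _ cb0 mphiz
    (fun y => mule_ge0 (phi0 _) (pp y)).
  rewrite [X in X * _](_ : _ = (c / b)%:E *
      \int[mu]_t (phi (c * t)%R * (p (c / b * t - a * z / b))%:E)); last first.
    apply: (etrans E); congr (_ * _); apply: eq_integral => t _.
    by congr (phi _ * _); field; rewrite gt_eqF.
  rewrite muleC muleA -ge0_integralZl//; last 3 first.
  - apply: emeasurable_funM => //; apply/measurable_EFinP.
    apply: (measurableT_comp mp); apply: (eq_measurable_fun (fun t : Rm => (- (a * z / b) + c / b * t)%R : Rm)).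
      by move=> t _; rewrite addrC.
    exact: mlin1.
  - by move=> t _; exact: mule_ge0.
  - by rewrite -EFinM lee_fin mulr_ge0 ?normal_pdf_ge0// divr_ge0// ltW.
  apply: eq_integral => t _.
  rewrite muleCA -!EFinM; congr (_ * _%:E).
  by rewrite -(gauss_pdf_rotation z t a0 b0 c0 abc); ring.
pose H := fun u : Rm * Rm => phi (c * u.2)%R * (p u.2 * normal_pdf (a / c * u.2) (b / c) u.1)%:E.
have mH : measurable_fun setT H.
  apply: emeasurable_funM; first by apply: (measurableT_comp mphic); exact: measurable_snd.
  apply/measurable_EFinP.
  apply: (eq_measurable_fun (fun u : Rm * Rm => c / b * p (c / b * u.2 - a * u.1 / b) * p u.1)%R).
    by move=> u _; rewrite (gauss_pdf_rotation u.1 u.2 a0 b0 c0 abc).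
  apply: measurable_funM; last by apply: (measurableT_comp mp); exact: measurable_fst.
  apply: measurable_funM => //; apply: (measurableT_comp mp).
  apply: (eq_measurable_fun (fun u : Rm * Rm => - (a / b) * u.1 + c / b * u.2)%R); last exact: mlin.
  by move=> u _; ring.
have H0 u : 0 <= H u by rewrite mule_ge0// lee_fin mulr_ge0 ?normal_pdf_ge0.
rewrite (fubini_tonelli (m1 := mu) (m2 := mu) _ mH H0).
rewrite integral_gauss//; apply: eq_integral => t _.
rewrite /H /=.
under eq_integral do rewrite EFinM muleA.
rewrite ge0_integralZl//.
- by rewrite integral_normal_pdf mule1.
- by apply/measurable_EFinP; exact: measurable_normal_pdf.
- by move=> z _; rewrite lee_fin normal_pdf_ge0.
- exact: mule_ge0.
Qed.

End gauss_semigroup.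

Section gauss_average.
Context {R : realType}.
Local Notation Rm := (measurableTypeR R).
Implicit Types (phi : R -> R) (v w B x : R).

(** The heat semigroup: averaging over a centred normal shift of variance [v]. *)
Definition Gs (v : R) (phi : R -> R) (x : R) : R :=
  Ex (@gauss R) (fun z => phi (x + Num.sqrt v * z)).

Lemma Gs_L1 v phi B x : measurable_fun setT phi -> (forall x, `|phi x| <= B) ->
  L1 (@gauss R) (fun z => phi (x + Num.sqrt v * z)).
Proof.
move=> mphi bphi; apply: (@L1_bnd _ _ _ _ _ B) => // .
by apply: (measurableT_comp mphi); apply: measurable_funD => //; exact: measurable_funM.
Qed.

Lemma Gs0 phi x : Gs 0 phi x = phi x.
Proof.
by rewrite /Gs sqrtr0 -[RHS](Ex_cst (@gauss R)); apply: eq_Ex => z; rewrite mul0r addr0.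
Qed.

Lemma Gs_bnd v phi B x : measurable_fun setT phi -> (forall x, `|phi x| <= B) ->
  `|Gs v phi x| <= B.
Proof. by move=> mphi bphi; apply: Ex_abs_le_cst => //; exact: Gs_L1. Qed.

Lemma Gs_measurable v phi B : measurable_fun setT phi -> (forall x, `|phi x| <= B) ->
  measurable_fun setT (Gs v phi).
Proof.
move=> mphi bphi.
(* Adding [B] makes the integrand nonnegative, as Tonelli measurability requires; it is subtracted
   again afterwards. *)
pose F (u : Rm * Rm) := (phi (u.1 + Num.sqrt v * u.2) + B)%:E.
have mF : measurable_fun setT F.
  apply/measurable_EFinP; apply: measurable_funD => //; apply: (measurableT_comp mphi).
  by apply: measurable_funD => //; exact: measurable_funM.
have F0 u : (0 <= F u)%E.
  rewrite lee_fin; have := bphi (u.1 + Num.sqrt v * u.2).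
  by rewrite ler_norml => /andP[h _]; rewrite -lerBlDr sub0r.
have mG := measurable_fun_fubini_tonelli_F (m2 := (@gauss R)) _ mF F0.
have E : Gs v phi = (fun x => fine (fubini_F (@gauss R) F x) - B).
  apply/funext => x; apply/esym; rewrite -[fine _]/(Ex (@gauss R) (fun z => phi (x + Num.sqrt v * z) + B)).
  by rewrite ExD ?Ex_cst ?addrK//; [exact: Gs_L1 mphi bphi|exact: L1_cst].
rewrite E; apply: measurable_funB => //.
exact: (measurableT_comp (@fine_measurable R setT measurableT) mG).
Qed.

Lemma Gs_semigroup v w phi x : 0 <= v -> 0 <= w -> measurable_fun setT phi ->
  (forall x, 0 <= phi x <= 1) -> Gs v (Gs w phi) x = Gs (v + w) phi x.
Proof.
move=> v0 w0 mphi bphi.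
have bphi' y : `|phi y| <= 1 by have /andP[h1 h2] := bphi y; rewrite ger0_norm.
move: v0; rewrite le_eqVlt => /predU1P[<-|v0]; first by rewrite Gs0 add0r.
move: w0; rewrite le_eqVlt => /predU1P[<-|w0].
  by rewrite addr0; congr Gs; apply/funext => y; rewrite Gs0.
apply: EFin_inj; rewrite !Ex_fin; last 2 first.
- exact: Gs_L1 mphi bphi'.
- apply: (@Gs_L1 _ _ 1); first exact: Gs_measurable mphi bphi'.
  by move=> y; exact: Gs_bnd.
under eq_integral => z _.
  rewrite Ex_fin; last exact: Gs_L1 mphi bphi'.
  under eq_integral do rewrite -addrA.
  over.
have mx : measurable_fun setT (fun u : Rm => (phi (x + u))%:E).
  by apply/measurable_EFinP; apply: (measurableT_comp mphi); exact: measurable_funD.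
have := @gauss_convolution R (Num.sqrt v) (Num.sqrt w) (Num.sqrt (v + w)) (fun u => (phi (x + u))%:E).
apply => //; rewrite ?sqrtr_gt0 ?addr_gt0// ?sqr_sqrtr// ?addr_ge0// ?ltW//.
by move=> u; rewrite lee_fin; have /andP[] := bphi (x + u).
Qed.

(** [phi1] and [phi2] stand for two derivatives but enter only through bounds and a Taylor
    inequality, so nothing is ever differentiated. Every clause survives averaging over shifts with
    the same [B], which is what the replacement argument needs. *)
Record smooth3 (B : R) (phi phi1 phi2 : R -> R) : Prop := Smooth3 {
  sm_m : measurable_fun setT phi;
  sm_m1 : measurable_fun setT phi1;
  sm_m2 : measurable_fun setT phi2;
  sm_01 : forall x, 0 <= phi x <= 1;
  sm_b1 : forall x, `|phi1 x| <= B;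
  sm_b2 : forall x, `|phi2 x| <= B;
  sm_taylor : forall x y, `|phi (x + y) - phi x - y * phi1 x - y ^+ 2 / 2 * phi2 x| <= B * `|y| ^+ 3 }.

Lemma sm_bnd B phi phi1 phi2 x : smooth3 B phi phi1 phi2 -> `|phi x| <= 1.
Proof. by move=> s; have /andP[h1 h2] := sm_01 s x; rewrite ger0_norm. Qed.

Lemma smooth3_Gs v B phi phi1 phi2 : smooth3 B phi phi1 phi2 ->
  smooth3 B (Gs v phi) (Gs v phi1) (Gs v phi2).
Proof.
move=> s.
have b0 x : `|phi x| <= 1 by exact: sm_bnd s.
have l0 x := @Gs_L1 v phi 1 x (sm_m s) b0.
have l1 x := @Gs_L1 v phi1 B x (sm_m1 s) (sm_b1 s).
have l2 x := @Gs_L1 v phi2 B x (sm_m2 s) (sm_b2 s).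
split.
- exact: Gs_measurable (sm_m s) b0.
- exact: Gs_measurable (sm_m1 s) (sm_b1 s).
- exact: Gs_measurable (sm_m2 s) (sm_b2 s).
- move=> x; apply/andP; split.
    by apply: Ex_ge0 => z; have /andP[] := sm_01 s (x + Num.sqrt v * z).
  by apply: Ex_le_cst => // z; have /andP[] := sm_01 s (x + Num.sqrt v * z).
- by move=> x; exact: Gs_bnd (sm_m1 s) (sm_b1 s).
- by move=> x; exact: Gs_bnd (sm_m2 s) (sm_b2 s).
- move=> x y; rewrite /Gs -(ExZ _ (l1 x)) -(ExZ _ (l2 x)) -ExB//.
  rewrite -ExB; [|exact: L1B|exact: L1Z].
  rewrite -ExB; [|apply: L1B; [exact: L1B|exact: L1Z]|exact: L1Z].
  apply: Ex_abs_le_cst => [|z]; last by rewrite (addrAC x y); exact: sm_taylor.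
  apply: L1B; last exact: L1Z.
  by apply: L1B; [exact: L1B|exact: L1Z].
Qed.

Definition gauss3 : R := Ex (@gauss R) (fun z => `|z| ^+ 3).

Lemma gauss3_ge0 : 0 <= gauss3.
Proof. by apply: Ex_ge0 => z; exact: exprn_ge0. Qed.

(** The linear term averages to zero and the quadratic one to [v / 2 * phi2 x], since the standard
    normal law has mean 0 and variance 1; the remainder costs a third absolute moment. *)
Lemma Gs_taylor v B phi phi1 phi2 x : 0 <= v -> smooth3 B phi phi1 phi2 ->
  `|Gs v phi x - phi x - v / 2 * phi2 x| <= B * (gauss3 * Num.sqrt v ^+ 3).
Proof.
move=> v0 s; set c := Num.sqrt v.
have b0 y : `|phi y| <= 1 by exact: sm_bnd s.
have l0 := @Gs_L1 v phi 1 x (sm_m s) b0.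
have lz := L1Z (c * phi1 x) (@gauss_L1_id R).
have lz2 := L1Z (v / 2 * phi2 x) (@gauss_L1_sqr R).
have -> : Gs v phi x - phi x - v / 2 * phi2 x = Ex (@gauss R) (fun z =>
    phi (x + c * z) - phi x - c * phi1 x * z - v / 2 * phi2 x * z ^+ 2).
  rewrite ExB//; last by apply: L1B => //; apply: L1B => //; exact: L1_cst.
  rewrite ExB//; last by apply: L1B => //; exact: L1_cst.
  rewrite ExB//; last exact: L1_cst.
  rewrite Ex_cst (ExZ _ (@gauss_L1_id R)) (ExZ _ (@gauss_L1_sqr R)).
  by rewrite gauss_mean gauss_var mulr0 subr0 mulr1.
have l3 := L1Z (B * c ^+ 3) (@gauss_L1_abs3 R).
rewrite [leRHS](_ : _ = Ex (@gauss R) (fun z => B * c ^+ 3 * `|z| ^+ 3)); last first.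
  by rewrite ExZ; [rewrite -/gauss3; ring|exact: gauss_L1_abs3].
apply: Ex_abs_le => //.
  by apply: L1B => //; apply: L1B => //; apply: L1B => //; exact: L1_cst.
move=> z; have cc : v = c ^+ 2 by rewrite sqr_sqrtr.
have -> : phi (x + c * z) - phi x - c * phi1 x * z - v / 2 * phi2 x * z ^+ 2 =
    phi (x + c * z) - phi x - c * z * phi1 x - (c * z) ^+ 2 / 2 * phi2 x.
  by rewrite cc; ring.
have -> : B * c ^+ 3 * `|z| ^+ 3 = B * `|c * z| ^+ 3.
  by rewrite normrM [`|c|]ger0_norm ?sqrtr_ge0//; ring.
exact: sm_taylor.
Qed.

End gauss_average.

(** * The replacement argument of Lindeberg for dependent summands *)

Section lindeberg.
Context {d : measure_display} {T : measurableType d} {R : realType}.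
Variable P : probability T R.

Lemma L1_abs3_sqr (D : T -> R) : measurable_fun setT D -> L1 P (fun w => `|D w| ^+ 3) ->
  L1 P D /\ L1 P (fun w => D w ^+ 2).
Proof.
move=> mD l3; have l := L1D (L1_cst P 1) l3; split.
  apply: (L1_dom mD _ l) => w; have := normr_ge0 (D w); move: (`|D w|) => y y0.
  have [y1|/ltW y1] := leP y 1.
    by rewrite (le_trans y1)// lerDl exprn_ge0.
  rewrite (le_trans _ (_ : y ^+ 3 <= _))//; last by rewrite lerDr.
  by rewrite ler_eXnr.
apply: (L1_dom (measurable_funX _ mD) _ l) => w.
rewrite normrX; have := normr_ge0 (D w); move: (`|D w|) => y y0.
have [y1|/ltW y1] := leP y 1.
  by rewrite (le_trans (_ : _ <= 1))// ?exprn_ile1// lerDl exprn_ge0.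
rewrite (le_trans _ (_ : y ^+ 3 <= _))//; last by rewrite lerDr.
by rewrite ler_weXn2l.
Qed.

(** Both expectations are expanded around [W]. The linear term vanishes by orthogonality, the
    quadratic ones agree up to [delta], and two cubic remainders are left. The martingale properties
    are asked for only when tested against [u1 (W)] and [u2 (W)]. *)
Lemma lindeberg_swap B (u u1 u2 : R -> R) (W D : T -> R) (v delta : R) :
  smooth3 B u u1 u2 -> measurable_fun setT W -> measurable_fun setT D -> 0 <= v ->
  L1 P (fun w => `|D w| ^+ 3) ->
  Ex P (fun w => u1 (W w) * D w) = 0 ->
  `|Ex P (fun w => u2 (W w) * (D w ^+ 2 - v))| <= B * delta ->
  `|Ex P (fun w => u (W w + D w)) - Ex P (fun w => Gs v u (W w))| <=
    B * (delta / 2 + Ex P (fun w => `|D w| ^+ 3) + gauss3 * Num.sqrt v ^+ 3).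
Proof.
move=> s mW mD v0 l3 E1 E2.
have b0 x : `|u x| <= 1 by exact: sm_bnd s.
have [lD lD2] := L1_abs3_sqr mD l3.
have B0 : 0 <= B by exact: le_trans (normr_ge0 _) (sm_b1 s 0).
have mu1 : measurable_fun setT (fun w => u1 (W w)) by exact: measurableT_comp (sm_m1 s) mW.
have mu2 : measurable_fun setT (fun w => u2 (W w)) by exact: measurableT_comp (sm_m2 s) mW.
have lu : L1 P (fun w => u (W w)).
  by apply: (@L1_bnd _ _ _ _ _ 1) => //; exact: measurableT_comp (sm_m s) mW.
have luD : L1 P (fun w => u (W w + D w)).
  apply: (@L1_bnd _ _ _ _ _ 1) => //; apply: (measurableT_comp (sm_m s)).
  exact: measurable_funD.
have lG : L1 P (fun w => Gs v u (W w)).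
  apply: (@L1_bnd _ _ _ _ _ 1); last by move=> w; exact: Gs_bnd (sm_m s) b0.
  exact: measurableT_comp (Gs_measurable v (sm_m s) b0) mW.
have l1 : L1 P (fun w => u1 (W w) * D w).
  apply: (@L1_dom _ _ _ _ _ (fun w => B * `|D w|)).
  - exact: measurable_funM.
  - by move=> w; rewrite normrM ler_wpM2r// (sm_b1 s).
  - exact/L1Z/L1_abs.
have lu2 : L1 P (fun w => u2 (W w)).
  by apply: (@L1_bnd _ _ _ _ _ B) => // w; exact: sm_b2 s _.
have l2' : L1 P (fun w => u2 (W w) * D w ^+ 2).
  apply: (@L1_dom _ _ _ _ _ (fun w => B * D w ^+ 2)).
  - by apply: measurable_funM => //; exact: measurable_funX.
  - move=> w; rewrite normrM [`|D w ^+ 2|]ger0_norm ?sqr_ge0//.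
    by rewrite ler_wpM2r ?sqr_ge0// (sm_b2 s).
  - exact/L1Z.
have l2 : L1 P (fun w => u2 (W w) * (D w ^+ 2 - v)).
  apply: (eq_L1 _ (L1B l2' (L1Z v lu2))) => w; by rewrite mulrBr [v * _]mulrC.
pose r w := u (W w + D w) - u (W w) - D w * u1 (W w) - D w ^+ 2 / 2 * u2 (W w).
pose r' w := Gs v u (W w) - u (W w) - v / 2 * u2 (W w).
have lr : L1 P r.
  apply: L1B; last by apply: (eq_L1 _ (L1Z (2^-1) l2')) => w; ring.
  apply: L1B; first exact: L1B.
  by apply: (eq_L1 _ l1) => w; rewrite mulrC.
have lr' : L1 P r' by apply: L1B; [exact: L1B|exact: L1Z].
have -> : Ex P (fun w => u (W w + D w)) - Ex P (fun w => Gs v u (W w)) =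
    2^-1 * Ex P (fun w => u2 (W w) * (D w ^+ 2 - v)) + Ex P r - Ex P r'.
  rewrite -(addr0 (2^-1 * _)) -{1}E1 -ExZ// -ExB// -ExD//; last exact: L1Z.
  rewrite -ExD//; last by apply: L1D => //; exact: L1Z.
  rewrite -ExB//; last by apply: L1D => //; apply: L1D => //; exact: L1Z.
  by apply: eq_Ex => w; rewrite /r /r'; field.
apply: (le_trans (ler_normB _ _)); apply: (le_trans (lerD (ler_normD _ _) (lexx _))).
rewrite normrM ger0_norm ?invr_ge0// !mulrDr; apply: lerD; first apply: lerD.
- by rewrite (_ : B * (delta / 2) = 2^-1 * (B * delta)); [rewrite ler_pM2l ?invr_gt0|ring].
- rewrite -ExZ//; apply: Ex_abs_le => //; first exact: L1Z.
  by move=> w; exact: sm_taylor s _ _.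
- by apply: Ex_abs_le_cst => // w; exact: (Gs_taylor _ v0 s).
Qed.

(** [delta k] measures in mean how far the conditional variance of [D k] is from the constant [v k].
    The last summand is replaced first: this turns [phi] into [Gs (v n) phi], which has the same
    [B], so the induction hypothesis applies to the new test function; hence [phi] is quantified
    after [n]. *)
Theorem lindeberg (D : nat -> T -> R) (v delta : nat -> R) :
  (forall k, measurable_fun setT (D k)) -> (forall k, 0 <= v k) ->
  (forall k, L1 P (fun w => `|D k w| ^+ 3)) ->
  (forall k (g : R -> R) B, measurable_fun setT g -> (forall x, `|g x| <= B) ->
     Ex P (fun w => g (\sum_(i < k) D i w) * D k w) = 0) ->
  (forall k (g : R -> R) B, measurable_fun setT g -> (forall x, `|g x| <= B) ->
     `|Ex P (fun w => g (\sum_(i < k) D i w) * (D k w ^+ 2 - v k))| <= B * delta k) ->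
  forall n B phi phi1 phi2, smooth3 B phi phi1 phi2 ->
  `|Ex P (fun w => phi (\sum_(i < n) D i w)) - Gs (\sum_(i < n) v i) phi 0| <=
  B * \sum_(i < n) (delta i / 2 + Ex P (fun w => `|D i w| ^+ 3) + gauss3 * Num.sqrt (v i) ^+ 3).
Proof.
move=> mD v0 l3 h1 h2; elim=> [|n IH] B phi phi1 phi2 s.
  rewrite !big_ord0 mulr0 Gs0 (_ : Ex P _ = phi 0) ?subrr ?normr0//.
  by rewrite -[RHS](Ex_cst P); apply: eq_Ex => w; rewrite big_ord0.
have mS : measurable_fun setT (fun w => \sum_(i < n) D i w).
  by apply: measurable_sum => i.
have := lindeberg_swap s mS (mD n) (v0 n) (l3 n) (h1 n _ _ (sm_m1 s) (sm_b1 s)) (h2 n _ _ (sm_m2 s) (sm_b2 s)).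
have := IH _ _ _ _ (smooth3_Gs (v n) s).
rewrite Gs_semigroup//; [|exact: sumr_ge0|exact: sm_m s|exact: sm_01 s].
move=> a1 a2; rewrite !big_ord_recr /= [leRHS]mulrDr.
rewrite (@eq_Ex _ _ _ _ _ (fun w => phi (\sum_(i < n) D i w + D n w))); last first.
  by move=> w; rewrite big_ord_recr.
rewrite [leRHS]addrC; apply: le_trans (lerD a2 a1); rewrite -[X in `|X|](subrKA (Ex P (fun w => Gs (v n) phi (\sum_(i < n) D i w)))).
exact: ler_normD.
Qed.

End lindeberg.

(** * A smooth step function made of truncated cubes *)

Section smooth_step.
Context {R : realType}.
Implicit Types (x y a delta : R).

Let pc x := Num.max x 0.

Lemma pc_le x : x <= 0 -> pc x = 0. Proof. by move=> h; rewrite /pc max_r. Qed.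
Lemma pc_ge x : 0 <= x -> pc x = x. Proof. by move=> h; rewrite /pc max_l. Qed.

Lemma pc_taylor x y :
  `|pc (x + y) ^+ 3 - pc x ^+ 3 - 3 * pc x ^+ 2 * y - 3 * pc x * y ^+ 2| <= `|y| ^+ 3.
Proof.
have [x0|x0] := leP x 0; have [s0|s0] := leP (x + y) 0.
- by rewrite !pc_le// (_ : _ - _ = 0) ?normr0 ?exprn_ge0//; ring.
- rewrite (pc_le x0) (pc_ge (ltW s0)) (_ : _ - _ = (x + y) ^+ 3); last by ring.
  rewrite normrX lerXn2r ?nnegrE//; rewrite !ger0_norm; lra.
- rewrite (pc_ge (ltW x0)) (pc_le s0).
  have y0 : y <= 0 by lra.
  rewrite [`|y|]ler0_norm// ler_norml; apply/andP; split.
    rewrite -subr_ge0 (_ : _ - _ = - (x + y) ^+ 3); last by ring.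
    by rewrite oppr_ge0 exprn_odd_le0.
  have e1 : 0 <= x * ((x + 3 / 2 * y) ^+ 2 + 3 / 4 * y ^+ 2).
    apply: mulr_ge0; first exact: ltW.
    by apply: addr_ge0; [exact: sqr_ge0|apply: mulr_ge0; [lra|exact: sqr_ge0]].
  have e2 : y ^+ 3 <= 0 by rewrite exprn_odd_le0.
  rewrite -subr_ge0 (_ : _ - _ = x * ((x + 3 / 2 * y) ^+ 2 + 3 / 4 * y ^+ 2) - y ^+ 3); last by field.
  by rewrite subr_ge0 (le_trans _ e1).
- rewrite (pc_ge (ltW x0)) (pc_ge (ltW s0)) -normrX.
  by rewrite (_ : _ - _ = y ^+ 3)//; ring.
Qed.

(** The distribution function of a sum of three independent uniform variables on [[0, 1]], that is,
    a third difference of truncated cubes; [ramp1] and [ramp2] are its first two derivatives. *)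
Definition ramp x := (pc x ^+ 3 - 3 * pc (x - 1) ^+ 3 + 3 * pc (x - 2) ^+ 3 - pc (x - 3) ^+ 3) / 6.
Definition ramp1 x := (pc x ^+ 2 - 3 * pc (x - 1) ^+ 2 + 3 * pc (x - 2) ^+ 2 - pc (x - 3) ^+ 2) / 2.
Definition ramp2 x := pc x - 3 * pc (x - 1) + 3 * pc (x - 2) - pc (x - 3).

(** The remainders of the four truncated cubes carry the weights 1, 3, 3, 1 over 6, which makes
    [4 / 3], rounded up to 2. *)
Lemma ramp_taylor x y : `|ramp (x + y) - ramp x - y * ramp1 x - y ^+ 2 / 2 * ramp2 x| <= 2 * `|y| ^+ 3.
Proof.
rewrite /ramp /ramp1 /ramp2 -![x + y - _]addrAC.
have := pc_taylor x y; have := pc_taylor (x - 1) y.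
have := pc_taylor (x - 2) y; have := pc_taylor (x - 3) y.
rewrite !ler_norml => /andP[? ?] /andP[? ?] /andP[? ?] /andP[? ?].
by apply/andP; split; lra.
Qed.

Lemma ramp_regions (Q : R -> Prop) :
  (forall x, x <= 0 -> Q x) -> (forall x, 0 <= x <= 1 -> Q x) -> (forall x, 1 <= x <= 2 -> Q x) ->
  (forall x, 2 <= x <= 3 -> Q x) -> (forall x, 3 <= x -> Q x) -> forall x, Q x.
Proof.
move=> q0 q1 q2 q3 q4 x.
have [|h0] := leP x 0; first exact: q0.
have [|h1] := leP x 1; first by move=> h; apply: q1; rewrite (ltW h0).
have [|h2] := leP x 2; first by move=> h; apply: q2; rewrite (ltW h1).
have [|h3] := leP x 3; first by move=> h; apply: q3; rewrite (ltW h2).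
exact/q4/ltW.
Qed.

Lemma ramp_bounds x : [/\ 0 <= ramp x <= 1, `|ramp1 x| <= 1, `|ramp2 x| <= 1,
  x <= 0 -> ramp x = 0 & 3 <= x -> ramp x = 1].
Proof.
elim/ramp_regions : x => x; rewrite /ramp /ramp1 /ramp2.
- move=> x0; rewrite !pc_le; try lra.
  rewrite !expr0n /= !mulr0 !subr0 !addr0 !mul0r normr0; split => //; first by rewrite lexx ler01.
  by move=> h; exfalso; lra.
- move=> /andP[x0 x1]; rewrite (pc_ge x0) !pc_le; try lra.
  rewrite !expr0n /= !mulr0 !subr0 !addr0.
  have x20 := exprn_ge0 2 x0; have x21 := exprn_ile1 2 x0 x1.
  have x30 := exprn_ge0 3 x0; have x31 := exprn_ile1 3 x0 x1.
  split; try (rewrite ?ler_norml; apply/andP; split; lra).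
    move=> h; have -> : x = 0 by lra.
    by rewrite expr0n mul0r.
  by move=> h; exfalso; lra.
- move=> /andP[x0 x1]; rewrite (@pc_ge x) ?(@pc_ge (x - 1)) ?(@pc_le (x - 2)) ?(@pc_le (x - 3)); try lra.
  rewrite !expr0n /= !mulr0 !subr0 !addr0.
  have y0 : 0 <= x - 1 by lra.
  have y1 : x - 1 <= 1 by lra.
  have y20 := exprn_ge0 2 y0; have y21 := exprn_ile1 2 y0 y1.
  have y30 := exprn_ge0 3 y0; have y31 := exprn_ile1 3 y0 y1.
  have h : 0 <= (1 - (x - 1)) ^+ 2 * (1 + 2 * (x - 1)) by apply: mulr_ge0; [exact: sqr_ge0|lra].
  have h' : (x - 1) ^+ 3 <= (x - 1) ^+ 2 by rewrite exprS; rewrite ler_piMl.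
  split; try (rewrite ?ler_norml; apply/andP; split; nra); by move=> ?; exfalso; lra.
- move=> /andP[x0 x1]; rewrite (@pc_ge x) ?(@pc_ge (x - 1)) ?(@pc_ge (x - 2)) ?(@pc_le (x - 3)); try lra.
  have -> : (x ^+ 3 - 3 * (x - 1) ^+ 3 + 3 * (x - 2) ^+ 3 - 0 ^+ 3) / 6 = 1 - (3 - x) ^+ 3 / 6 by field.
  have -> : (x ^+ 2 - 3 * (x - 1) ^+ 2 + 3 * (x - 2) ^+ 2 - 0 ^+ 2) / 2 = (3 - x) ^+ 2 / 2 by field.
  have y0 : 0 <= 3 - x by lra.
  have y1 : 3 - x <= 1 by lra.
  have y20 := exprn_ge0 2 y0; have y21 := exprn_ile1 2 y0 y1.
  have y30 := exprn_ge0 3 y0; have y31 := exprn_ile1 3 y0 y1.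
  split; try (rewrite ?ler_norml; apply/andP; split; lra); first by move=> ?; exfalso; lra.
  move=> h; have -> : x = 3 by lra.
  by rewrite subrr expr0n /= mul0r subr0.
- move=> x3; rewrite !pc_ge; try lra.
  have -> : (x ^+ 3 - 3 * (x - 1) ^+ 3 + 3 * (x - 2) ^+ 3 - (x - 3) ^+ 3) / 6 = 1 by field.
  have -> : (x ^+ 2 - 3 * (x - 1) ^+ 2 + 3 * (x - 2) ^+ 2 - (x - 3) ^+ 2) / 2 = 0 by field.
  have -> : x - 3 * (x - 1) + 3 * (x - 2) - (x - 3) = 0 by ring.
  rewrite normr0; split => //; first by rewrite lexx ler01.
  by move=> h; exfalso; lra.
Qed.

Lemma pc_measurable : measurable_fun setT pc.
Proof. by apply: measurable_maxr. Qed.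

(** A smoothed indicator of []-oo, a]]: the factor [3 / delta] spreads the climb of [ramp] over
    [[a, a + delta]]. *)
Definition sstep a delta x := 1 - ramp (3 / delta * (x - a)).

(** With [c = 3 / delta], the constant [2 (1 + c)^3] bounds at once [c], [c^2] and [2 c^3], which
    the change of scale produces. *)
Lemma sstep_smooth a delta : 0 < delta ->
  smooth3 (2 * (1 + 3 / delta) ^+ 3) (sstep a delta)
    (fun x => - (3 / delta * ramp1 (3 / delta * (x - a))))
    (fun x => - ((3 / delta) ^+ 2 * ramp2 (3 / delta * (x - a)))).
Proof.
move=> d0; rewrite /sstep; set c := 3 / delta.
have c0 : 0 < c by rewrite divr_gt0.
have c3 : c <= 2 * (1 + c) ^+ 3 /\ c ^+ 2 <= 2 * (1 + c) ^+ 3.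
  clearbody c; have c3 : 0 < c ^+ 3 by exact: exprn_gt0.
  have c2 : 0 < c ^+ 2 by exact: exprn_gt0.
  have -> : 2 * (1 + c) ^+ 3 = 2 + 6 * c + 6 * c ^+ 2 + 2 * c ^+ 3 by ring.
  by split; lra.
have mlin b : measurable_fun setT (fun x : R => pc (c * (x - a) - b)).
  apply: (measurableT_comp pc_measurable); apply: measurable_funB => //.
  by apply: measurable_funM => //; exact: measurable_funB.
have mlin0 : measurable_fun setT (fun x : R => pc (c * (x - a))).
  apply: (measurableT_comp pc_measurable).
  by apply: measurable_funM => //; exact: measurable_funB.
split.
- apply: measurable_funB => //; apply: measurable_funM => //.
  apply: measurable_funB; last exact: measurable_funX.
  apply: measurable_funD; last by apply: measurable_funM => //; exact: measurable_funX.
  apply: measurable_funB; first exact: measurable_funX.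
  by apply: measurable_funM => //; exact: measurable_funX.
- apply: measurableT_comp => //; apply: measurable_funM => //; apply: measurable_funM => //.
  apply: measurable_funB; last exact: measurable_funX.
  apply: measurable_funD; last by apply: measurable_funM => //; exact: measurable_funX.
  apply: measurable_funB; first exact: measurable_funX.
  by apply: measurable_funM => //; exact: measurable_funX.
- apply: measurableT_comp => //; apply: measurable_funM => //.
  apply: measurable_funB => //; apply: measurable_funD; last exact: measurable_funM.
  by apply: measurable_funB => //; exact: measurable_funM.
- move=> x; have [/andP[h1 h2] _ _ _ _] := ramp_bounds (c * (x - a)).
  by apply/andP; split; lra.
- move=> x; have [_ h _ _ _] := ramp_bounds (c * (x - a)).
  rewrite normrN normrM gtr0_norm//; apply: le_trans c3.1.
  by rewrite ler_piMr// ltW.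
- move=> x; have [_ _ h _ _] := ramp_bounds (c * (x - a)).
  rewrite normrN normrM normrX gtr0_norm//; apply: le_trans c3.2.
  by rewrite ler_piMr// exprn_ge0// ltW.
- move=> x y; have := ramp_taylor (c * (x - a)) (c * y).
  rewrite -[c * (x - a) + c * y]mulrDr [x - a + y]addrAC => h.
  rewrite [X in `|X| <= _](_ : _ = - (ramp (c * (x + y - a)) - ramp (c * (x - a)) -
    c * y * ramp1 (c * (x - a)) - (c * y) ^+ 2 / 2 * ramp2 (c * (x - a)))); last by ring.
  rewrite normrN (le_trans h)// normrM [`|c|]gtr0_norm// exprMn mulrA ler_wpM2r ?exprn_ge0//.
  by rewrite ler_pM2l// lerXn2r ?nnegrE ?addr_ge0 ?ltW// ltrDr.
Qed.

Lemma sstep1 a delta x : 0 < delta -> x <= a -> sstep a delta x = 1.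
Proof.
move=> d0 xa; have [_ _ _ h _] := ramp_bounds (3 / delta * (x - a)).
by rewrite /sstep h ?subr0// mulr_ge0_le0 ?subr_le0// divr_ge0// ltW.
Qed.

Lemma sstep0 a delta x : 0 < delta -> a + delta <= x -> sstep a delta x = 0.
Proof.
move=> d0 xa; have [_ _ _ _ h] := ramp_bounds (3 / delta * (x - a)).
rewrite /sstep h ?subrr// mulrAC ler_pdivlMr// ler_pM2l// lerBrDr addrC//.
Qed.

(** For increments of at least 1 the range [[0, 1]] is enough; below 1 each of the three Taylor
    terms is at most [B |x - y|]. *)
Lemma smooth3_lip B (phi phi1 phi2 : R -> R) x y : smooth3 B phi phi1 phi2 ->
  `|phi x - phi y| <= (3 * B + 1) * `|x - y|.
Proof.
move=> s; have B0 : 0 <= B by exact: le_trans (normr_ge0 _) (sm_b1 s 0).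
have := sm_taylor s y (x - y); rewrite subrKC.
have := sm_b1 s y; have := sm_b2 s y.
have /andP[a0 a1] := sm_01 s x; have /andP[b0 b1] := sm_01 s y.
have [h|h] := leP 1 `|x - y|.
  move=> _ _ _; apply: (@le_trans _ _ 1); first by rewrite ler_norml; apply/andP; split; lra.
  nra.
move=> h2 h1 t; set z := x - y in t h *.
have z0 := normr_ge0 z.
have e2 : `|z ^+ 2 / 2 * phi2 y| <= B * `|z|.
  rewrite normrM ger0_norm ?divr_ge0 ?sqr_ge0// -(real_normK (num_real z)).
  rewrite mulrC; apply: ler_pM => //.
  have z2 : `|z| ^+ 2 <= `|z| by rewrite -[leRHS]expr1 ler_wiXn2l// ltW.
  lra.
have e1 : `|z * phi1 y| <= B * `|z| by rewrite normrM mulrC ler_wpM2r.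
have e3 : B * `|z| ^+ 3 <= B * `|z|.
  by rewrite ler_wpM2l// -[leRHS]expr1 ler_wiXn2l// ltW.
have -> : phi x - phi y = (phi x - phi y - z * phi1 y - z ^+ 2 / 2 * phi2 y) +
   (z * phi1 y + z ^+ 2 / 2 * phi2 y) by ring.
apply: (le_trans (ler_normD _ _)); apply: (le_trans (lerD t (ler_normD _ _))); nra.
Qed.

(** The inequality [|sqrt v - 1| <= |v - 1|] turns the Lipschitz bound of the test function into one
    in the variance, and [|z|] is at most [(1 + z^2) / 2], of mean 1. *)
Lemma Gs_near1 B (phi phi1 phi2 : R -> R) (v : R) : smooth3 B phi phi1 phi2 -> 0 <= v ->
  `|Gs v phi 0 - Gs 1 phi 0| <= (3 * B + 1) * `|v - 1|.
Proof.
move=> s v0; have b0 x : `|phi x| <= 1 by exact: sm_bnd s.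
have B0 : 0 <= B by exact: le_trans (normr_ge0 _) (sm_b1 s 0).
have l w := @Gs_L1 _ w phi 1 0 (sm_m s) b0.
rewrite /Gs -ExB//.
have lz : L1 (@gauss R) (fun z => (3 * B + 1) * `|v - 1| * ((1 + z ^+ 2) / 2)).
  apply: L1Z; apply: (eq_L1 _ (L1Z 2^-1 (L1D (L1_cst _ 1) (@gauss_L1_sqr R)))) => z.
  by rewrite mulrC.
have q : `|Num.sqrt v - Num.sqrt 1| <= `|v - 1|.
  rewrite sqrtr1 -{2}(sqr_sqrtr v0) -[X in _ <= `|_ - X|](expr1n _ 2) subr_sqr normrM ler_peMr//.
  by rewrite ger0_norm ?addr_ge0 ?sqrtr_ge0// lerDr sqrtr_ge0.
apply: (le_trans (Ex_abs_le _ lz _)).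
- exact: L1B.
- move=> z; apply: (le_trans (smooth3_lip _ _ s)); rewrite -mulrA ler_wpM2l//.
    by rewrite addr_ge0// mulr_ge0.
  rewrite !add0r -mulrBl normrM ler_pM// -(real_normK (num_real z)).
  have := sqr_ge0 (`|z| - 1); nra.
- rewrite ExZ; last by apply: (eq_L1 _ (L1Z 2^-1 (L1D (L1_cst _ 1) (@gauss_L1_sqr R)))) => z; rewrite mulrC.
  rewrite ler_piMr// ?mulr_ge0// ?addr_ge0// ?mulr_ge0//.
  rewrite (@eq_Ex _ _ _ (@gauss R) _ (fun z : R => 2^-1 * (1 + z ^+ 2))); last by move=> z; rewrite mulrC.
  have l2 := L1D (L1_cst (@gauss R) 1) (@gauss_L1_sqr R).
  rewrite (ExZ _ l2) (ExD (L1_cst _ _) (@gauss_L1_sqr R)) Ex_cst gauss_var; lra.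
Qed.

End smooth_step.

(** * Convergence of distribution functions *)

Section step_cdf.
Context {d : measure_display} {T : measurableType d} {R : realType}.
Variable P : probability T R.

Lemma measurable_le_set (f : T -> R) x : measurable_fun setT f -> measurable [set w | f w <= x].
Proof. by move=> mf; rewrite -[X in measurable X]setTI; exact: measurable_fun_le. Qed.

Lemma measurable_ge_set (f : T -> R) x : measurable_fun setT f -> measurable [set w | x <= f w].
Proof. by move=> mf; rewrite -[X in measurable X]setTI; exact: measurable_fun_le. Qed.

Lemma sstep_ge_cdf (f : T -> R) x delta : 0 < delta -> measurable_fun setT f ->
  Pr P [set w | f w <= x] <= Ex P (fun w => sstep x delta (f w)) <= Pr P [set w | f w <= x + delta].
Proof.
move=> d0 mf; have s := sstep_smooth x d0.
have ls : L1 P (fun w => sstep x delta (f w)).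
  apply: (@L1_bnd _ _ _ _ _ 1); first exact: measurableT_comp (sm_m s) mf.
  by move=> w; exact: sm_bnd s.
rewrite !PrEx; try exact: measurable_le_set.
apply/andP; split; apply: Ex_le => //; try exact/L1_indic/measurable_le_set.
- move=> w; rewrite indicE; case: (boolP (w \in _)) => [/set_mem/= h|_].
    by rewrite sstep1.
  by have /andP[] := sm_01 s (f w).
- move=> w; rewrite indicE; case: (boolP (w \in _)) => [/set_mem/= h|/negP h].
    by have /andP[] := sm_01 s (f w).
  rewrite sstep0// leNgt; apply/negP => h'; apply: h; apply/mem_set => /=; exact: ltW.
Qed.

End step_cdf.

Section weak_cdf.
Context {d : measure_display} {T : measurableType d} {R : realType}.
Variable P : probability T R.
Implicit Types (S : nat -> T -> R) (G : R -> R).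

(* convergence of distribution functions up to a shift of the argument: it is
   stable under perturbations that vanish in probability, and at a continuity
   point of [G] it gives back the convergence of the values *)
Definition wcdf S G := forall x delta eps : R, 0 < delta -> 0 < eps ->
  \forall n \near \oo,
    G (x - delta) - eps <= Pr P [set w | S n w <= x] <= G (x + delta) + eps.

Definition cdfg (x : R) : R := Pr (@gauss R) [set z | z <= x].

Lemma wcdf_normal S : (forall n, measurable_fun setT (S n)) ->
  (forall B phi phi1 phi2, smooth3 B phi phi1 phi2 ->
     Ex P (fun w => phi (S n w)) @[n --> \oo] --> Gs 1 phi 0) -> wcdf S cdfg.
Proof.
move=> mS h x delta eps d0 e0.
have G1 a : Gs 1 (sstep a delta) 0 = Ex (@gauss R) (fun z => sstep a delta z).
  by apply: eq_Ex => z; rewrite sqrtr1 mul1r add0r.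
have c1 := h _ _ _ _ (sstep_smooth x d0).
have c2 := h _ _ _ _ (sstep_smooth (x - delta) d0).
have mid : measurable_fun setT (fun z : measurableTypeR R => z : R) by [].
have /andP[_ g1] := sstep_ge_cdf (@gauss R) x d0 mid.
have /andP[g2 _] := sstep_ge_cdf (@gauss R) (x - delta) d0 mid.
move/cvgrPdist_le : c1 => /(_ _ e0) c1; move/cvgrPdist_le : c2 => /(_ _ e0) c2.
near=> n.
have /andP[a1 _] := sstep_ge_cdf P x d0 (mS n).
have /andP[_ a2] := sstep_ge_cdf P (x - delta) d0 (mS n); rewrite subrK in a2.
have b1 : `|Gs 1 (sstep x delta) 0 - Ex P (fun w => sstep x delta (S n w))| <= eps by near: n.
have b2 : `|Gs 1 (sstep (x - delta) delta) 0 - Ex P (fun w => sstep (x - delta) delta (S n w))| <= eps.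
  by near: n.
move: b1 b2; rewrite !G1 !ler_norml => /andP[? ?] /andP[? ?]; rewrite /cdfg.
by apply/andP; split; lra.
Unshelve. all: by end_near. Qed.

Lemma wcdf_slutsky S S' G : (forall n, measurable_fun setT (S n)) ->
  (forall n, measurable_fun setT (S' n)) -> wcdf S G ->
  (forall delta eps, 0 < delta -> 0 < eps ->
    \forall n \near \oo, Pr P [set w | delta <= `|S n w - S' n w|] <= eps) -> wcdf S' G.
Proof.
move=> mS mS' wS h x delta eps d0 e0.
have d2 : 0 < delta / 2 by rewrite divr_gt0.
have e2 : 0 < eps / 2 by rewrite divr_gt0.
have w1 := wS (x - delta / 2) (delta / 2) (eps / 2) d2 e2.
have w2 := wS (x + delta / 2) (delta / 2) (eps / 2) d2 e2.
have hn := h (delta / 2) (eps / 2) d2 e2.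
near=> n.
have mD : measurable [set w | delta / 2 <= `|S n w - S' n w|].
  by apply: measurable_ge_set; apply: measurableT_comp => //; exact: measurable_funB.
have q : Pr P [set w | delta / 2 <= `|S n w - S' n w|] <= eps / 2 by near: n.
have /andP[l1 _] : G (x - delta / 2 - delta / 2) - eps / 2 <= Pr P [set w | S n w <= x - delta / 2] <= 
   G (x - delta / 2 + delta / 2) + eps / 2 by near: n.
have /andP[_ l2] : G (x + delta / 2 - delta / 2) - eps / 2 <= Pr P [set w | S n w <= x + delta / 2] <= 
   G (x + delta / 2 + delta / 2) + eps / 2 by near: n.
have -> : x - delta = x - delta / 2 - delta / 2 by field.
have -> : x + delta = x + delta / 2 + delta / 2 by field.
have u1 : Pr P [set w | S' n w <= x] <= Pr P [set w | S n w <= x + delta / 2] +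
    Pr P [set w | delta / 2 <= `|S n w - S' n w|].
  apply: Pr_leU => //; try exact: measurable_le_set.
  move=> w /= hw; have [hd|hd] := leP (delta / 2) `|S n w - S' n w|; [by right|left].
  by move: hd; rewrite ltr_norml => /andP[? ?]; lra.
have u2 : Pr P [set w | S n w <= x - delta / 2] <= Pr P [set w | S' n w <= x] +
    Pr P [set w | delta / 2 <= `|S n w - S' n w|].
  apply: Pr_leU => //; try exact: measurable_le_set.
  move=> w /= hw; have [hd|hd] := leP (delta / 2) `|S n w - S' n w|; [by right|left].
  by move: hd; rewrite ltr_norml => /andP[? ?]; lra.
by apply/andP; split; lra.
Unshelve. all: by end_near. Qed.

Definition cdfg2 (x : R) : R := Pr (@gauss R) [set z | z ^+ 2 <= x].

(** For [x = r^2] the event [S^2 <= x] is [S <= r] without [S < - r]. The latter is a strict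
    inequality, so it is bracketed by distribution functions at [- r - k] and [- r]. *)
Lemma wcdf_sqr S : (forall n, measurable_fun setT (S n)) -> wcdf S cdfg ->
  wcdf (fun n w => S n w ^+ 2) cdfg2.
Proof.
move=> mS wS x delta eps d0 e0.
have mg (a : R) : measurable [set z : measurableTypeR R | z <= a] by exact: measurable_le_set.
have mg2 (a : R) : measurable [set z : measurableTypeR R | z ^+ 2 <= a].
  by apply: measurable_le_set; exact: measurable_funX.
have [x0|x0] := ltP x 0.
  near=> n; have -> : [set w | S n w ^+ 2 <= x] = set0.
    by apply/seteqP; split => w //= h; have := sqr_ge0 (S n w); lra.
  rewrite /Pr measure0 /=.
  have := Pr_ge0 (@gauss R) [set z | z ^+ 2 <= x + delta].
  have -> : cdfg2 (x - delta) = 0.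
    rewrite /cdfg2 (_ : [set z | _] = set0) ?/Pr ?measure0//.
    by apply/seteqP; split => z //= h; have := sqr_ge0 z; lra.
  by rewrite /cdfg2 => h; apply/andP; split; lra.
set r := Num.sqrt x; have r0 : 0 <= r by exact: sqrtr_ge0.
have rx : r ^+ 2 = x by exact: sqr_sqrtr.
(* Chosen so that [(r + 2 k)^2 <= x + delta] and [x - delta <= (r - 2 k)^2]. *)
pose k := Num.min 1 (delta / (4 * (r + 1))).
have k0 : 0 < k by rewrite lt_min ltr01 divr_gt0// mulr_gt0// ltr_wpDl.
have k1 : k <= 1 by rewrite ge_min lexx.
have k2 : k * (4 * (r + 1)) <= delta.
  by rewrite -ler_pdivlMr ?mulr_gt0 ?ltr_wpDl// ge_min lexx orbT.
have e2 : 0 < eps / 2 by rewrite divr_gt0.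
have w1 := wS r k (eps / 2) k0 e2.
have w2 := wS (- r) k (eps / 2) k0 e2.
have w3 := wS (- r - k) k (eps / 2) k0 e2.
near=> n.
have /andP[a1 a2] : cdfg (r - k) - eps / 2 <= Pr P [set w | S n w <= r] <= cdfg (r + k) + eps / 2 by near: n.
have /andP[a3 a4] : cdfg (- r - k) - eps / 2 <= Pr P [set w | S n w <= - r] <= cdfg (- r + k) + eps / 2 by near: n.
have /andP[a5 a6] : cdfg (- r - k - k) - eps / 2 <= Pr P [set w | S n w <= - r - k] <= cdfg (- r - k + k) + eps / 2 by near: n.
have mS2 : measurable [set w | S n w ^+ 2 <= x].
  by apply: measurable_le_set; exact: measurable_funX.
have sq w : (S n w ^+ 2 <= x) = (- r <= S n w <= r).
  by rewrite -rx -ler_norml -(real_normK (num_real (S n w))) ler_pXn2r ?nnegrE.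
have sqz (z t : R) : 0 <= t -> (z ^+ 2 <= t ^+ 2) = (- t <= z <= t).
  by move=> t0; rewrite -ler_norml -(real_normK (num_real z)) ler_pXn2r ?nnegrE.
apply/andP; split.
- have : Pr P [set w | S n w <= r] <= Pr P [set w | S n w ^+ 2 <= x] + Pr P [set w | S n w <= - r].
    apply: Pr_leU => //; try exact: measurable_le_set.
    move=> w /= h; have [h'|h'] := leP (S n w) (- r); [by right|left].
    by rewrite sq (ltW h').
  have [xd|xd] := ltP (x - delta) 0.
    have -> : cdfg2 (x - delta) = 0.
      rewrite /cdfg2 (_ : [set z | _] = set0) ?/Pr ?measure0//.
      by apply/seteqP; split => z //= h; have := sqr_ge0 z; lra.
    by have := Pr_ge0 P [set w | S n w ^+ 2 <= x]; lra.
  (* Otherwise [x = r^2 <= 2 k r < delta], against the case at hand. *)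
  have rk : 2 * k < r.
    rewrite ltNge; apply/negP => rk.
    have : r ^+ 2 <= 2 * k * r by rewrite expr2 ler_wpM2r.
    by rewrite rx => ?; nra.
  have : cdfg2 (x - delta) + cdfg (- r + k) <= cdfg (r - k).
    have mT : measurable ([set z : measurableTypeR R | z ^+ 2 <= x - delta] `|` [set z | z <= - r + k]).
      exact: measurableU.
    rewrite /cdfg2 /cdfg -lee_fin EFinD !PrE// -measureU//.
      apply: le_measure; rewrite ?inE// => z /= [hz|hz]; last by lra.
      have : z ^+ 2 <= (r - 2 * k) ^+ 2 by apply: (le_trans hz); nra.
      by rewrite sqz; [move=> /andP[? ?]; lra|lra].
    apply/seteqP; split => z //= [hz hz'].
    have : z ^+ 2 <= (r - 2 * k) ^+ 2 by apply: (le_trans hz); nra.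
    by rewrite sqz; [move=> /andP[? ?]; lra|lra].
  lra.
- have : Pr P [set w | S n w ^+ 2 <= x] + Pr P [set w | S n w <= - r - k] <= Pr P [set w | S n w <= r].
    have mT : measurable ([set w | S n w ^+ 2 <= x] `|` [set w | S n w <= - r - k]).
      by apply: measurableU => //; exact: measurable_le_set.
    rewrite -lee_fin EFinD !PrE//; try exact: measurable_le_set.
    rewrite -measureU//; last 2 first.
    + exact: measurable_le_set.
    + by apply/seteqP; split => w //= []; rewrite sq => /andP[? ?] ?; lra.
    apply: le_measure; rewrite ?inE//; first exact: measurable_le_set.
    by move=> w /= []; [rewrite sq => /andP[]|lra].
  have : cdfg (r + k) <= cdfg2 (x + delta) + cdfg (- r - k - k).
    apply: Pr_leU => // z /= hz; have [h|h] := leP z (- r - k - k); [by right|left].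
    apply: (@le_trans _ _ ((r + 2 * k) ^+ 2)); last by nra.
    by rewrite sqz; [apply/andP; split; lra|lra].
  lra.
Unshelve. all: by end_near. Qed.

Lemma wcdf_cvg_in_distr S (mu : set R -> \bar R) G :
  (forall n, measurable_fun setT (S n)) -> (forall x, mu [set z | z <= x] = (G x)%:E) ->
  wcdf S G -> cvg_in_distr P S mu.
Proof.
move=> mS muG wS x cx; rewrite muG.
have {}cx : {for x, continuous G}.
  by move: cx; rewrite (_ : (fun y => _) = G)//; apply/funext => y; rewrite muG.
have -> : (fun n => P [set w | S n w <= x]) = EFin \o (fun n => Pr P [set w | S n w <= x]).
  by apply/funext => n /=; rewrite PrE//; exact: measurable_le_set.
apply: cvg_EFin; first by near=> n.
apply/cvgrPdist_le => eps e0 /=.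
have e2 : 0 < eps / 2 by rewrite divr_gt0.
move/cvgrPdist_le : cx => /(_ _ e2) [delta /= d0 cd].
have d2 : 0 < delta / 2 by rewrite divr_gt0.
have w1 := wS x (delta / 2) (eps / 2) d2 e2.
near=> n.
have /andP[a1 a2] : G (x - delta / 2) - eps / 2 <= Pr P [set w | S n w <= x] <= G (x + delta / 2) + eps / 2 by near: n.
have b1 : `|G x - G (x - delta / 2)| <= eps / 2.
  by apply: cd; rewrite /= opprB addrC subrK gtr0_norm//; lra.
have b2 : `|G x - G (x + delta / 2)| <= eps / 2.
  by apply: cd; rewrite /= opprD addNKr normrN gtr0_norm//; lra.
move: b1 b2; rewrite !ler_norml => /andP[? ?] /andP[? ?].
by apply/andP; split; lra.
Unshelve. all: by end_near. Qed.


End weak_cdf.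

(** * Product rules for functions of disjoint groups of variables *)

Section independent_products.
Context {d : measure_display} {T : measurableType d} {R : realType}.
Variable P : probability T R.

(** Tonelli counterpart of [diag_expectation]: as no integrability is asked for, it can serve to
    establish it. *)
Lemma diag_integral_ge0 d1 d2 (A : measurableType d1) (B : measurableType d2)
    (U : {RV P >-> A}) (V : {RV P >-> B}) (F : A * B -> \bar R) :
  (forall C D, measurable C -> measurable D ->
     P (U @^-1` C `&` V @^-1` D) = P (U @^-1` C) * P (V @^-1` D))%E ->
  measurable_fun setT F -> (forall z, 0 <= F z)%E ->
  (\int[P]_w F (U w, V w) = \int[P]_w \int[P]_w' F (U w, V w'))%E.
Proof.
move=> UV mF F0.
have mUV : measurable_fun setT (fun w => (U w, V w)) by exact: measurable_fun_pair.
pose UVm : {mfun T >-> (A * B)%type} := HB.pack (fun w => (U w, V w))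
  (isMeasurableFun.Build _ _ _ _ _ mUV).
pose mu1 := distribution P U; pose mu2 := distribution P V.
have E1 X : measurable X -> (mu1 \x mu2)%E X = distribution P UVm X.
  apply: product_measure_unique => C D mC mD.
  by rewrite /= /pushforward -UV.
transitivity (\int[mu1 \x mu2]_z F z)%E.
  rewrite (eq_measure_integral (distribution P UVm)); last by move=> X mX _; exact: E1.
  by rewrite ge0_integral_distribution.
rewrite fubini_tonelli1// ge0_integral_distribution//; last 2 first.
- exact: measurable_fun_fubini_tonelli_F.
- by move=> x; exact: integral_ge0.
apply: eq_integral => w _ /=; rewrite /fubini_F ge0_integral_distribution//.
exact: measurable_fun_pair2.
Qed.

Variables (I : eqType) (X : I -> {RV P >-> R}).
Hypothesis iX : mutually_indep P (fun i => X i : T -> R).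

Definition sgX (J : pred I) := sigmaX (fun i => X i : T -> R) J.

Definition adapted (J : pred I) (f : T -> R) := measurable_fun setT (f : sgX J -> R).

Let idJ J : {RV P >-> sgX J} :=
  HB.pack (idfun : T -> sgX J) (isMeasurableFun.Build _ _ _ _ _ (@sigmaX_id_measurable _ _ _ P I X J)).

Lemma adapted_meas J f : adapted J f -> measurable_fun setT f.
Proof. by move=> mf; exact: (measurableT_comp mf (@sigmaX_id_measurable _ _ _ P I X J)). Qed.

Lemma adapted_comp (J : pred I) i (g : R -> R) : J i -> measurable_fun setT g ->
  adapted J (fun w => g (X i w)).
Proof.
move=> Ji mg.
exact: (measurableT_comp mg (@sigmaX_measurable _ _ _ I (fun i => X i : T -> R) J i Ji)).
Qed.

Lemma Ex_indep (J1 J2 : pred I) f g : (forall i, J1 i -> ~~ J2 i) ->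
  adapted J1 f -> adapted J2 g -> L1 P f -> L1 P g ->
  L1 P (fun w => f w * g w) /\ Ex P (fun w => f w * g w) = Ex P f * Ex P g.
Proof.
move=> J12 mf mg lf lg.
have UV C D : measurable C -> measurable D -> (P (idJ J1 @^-1` C `&` idJ J2 @^-1` D) =
    P (idJ J1 @^-1` C) * P (idJ J2 @^-1` D))%E.
  by move=> mC mD; apply: (indep_disjoint iX J12).
have mfg : measurable_fun setT (fun z : sgX J1 * sgX J2 => f z.1 * g z.2).
  apply: measurable_funM.
  - exact: (measurableT_comp mf (@measurable_fst _ _ (sgX J1) (sgX J2))).
  - exact: (measurableT_comp mg (@measurable_snd _ _ (sgX J1) (sgX J2))).
have lfg : L1 P (fun w => f w * g w).
  apply/integrableP; split.
    apply/measurable_EFinP; apply: measurable_funM; [exact: adapted_meas mf|exact: adapted_meas mg].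
  have := @diag_integral_ge0 _ _ _ _ (idJ J1) (idJ J2) (fun z => `|f z.1 * g z.2|%:E) UV.
  move=> /(_ _ _)/= ->; last 2 first.
  - by apply/measurable_EFinP; exact: measurableT_comp.
  - by move=> z; rewrite lee_fin.
  have -> : (\int[P]_w \int[P]_w' `|f w * g w'|%:E =
     \int[P]_w (`|f w|%:E * (Ex P (fun w => `|g w|))%:E))%E.
    apply: eq_integral => w _; under eq_integral do rewrite normrM EFinM.
    rewrite ge0_integralZl//; first by rewrite Ex_fin//; exact: L1_abs.
    by apply/measurable_EFinP; apply: measurableT_comp => //; exact: L1_meas lg.
  rewrite ge0_integralZr//; last 2 first.
  - by apply/measurable_EFinP; apply: measurableT_comp => //; exact: L1_meas lf.
  - by rewrite lee_fin Ex_ge0.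
  by rewrite -(Ex_fin (L1_abs lf)) -EFinM ltry.
split => //.
have [|_ ->] := @diag_expectation _ _ _ P _ _ _ _ (idJ J1) (idJ J2) (fun a b => f a * g b) UV mfg lfg.
  by move=> w; exact: L1Z.
rewrite (@eq_Ex _ _ _ _ _ (fun w => Ex P g * f w)); first by rewrite ExZ// mulrC.
by move=> w; rewrite ExZ// mulrC.
Qed.

(** [F] may read all the variables in [J] through its first argument; since [X t] is not among them,
    it can be averaged over a fresh sample point. *)
Lemma Ex_freeze (J : pred I) t (F : T -> R -> R) B : ~~ J t ->
  measurable_fun setT (fun z : sgX J * R => F z.1 z.2) -> (forall w x, `|F w x| <= B) ->
  measurable_fun setT (fun w => Ex P (fun w' => F w (X t w'))) /\
  Ex P (fun w => F w (X t w)) = Ex P (fun w => Ex P (fun w' => F w (X t w'))).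
Proof.
move=> Jt mF bF.
have UV C D : measurable C -> measurable D -> (P (idJ J @^-1` C `&` X t @^-1` D) =
    P (idJ J @^-1` C) * P (X t @^-1` D))%E.
  move=> mC mD; apply: (@indep_disjoint _ _ _ _ _ _ J (pred1 t) iX) => //.
    by move=> i Ji; apply: contraNneq Jt => <-.
  by apply: sub_sigma_algebra; apply: (@cylinders1 _ _ _ _ (fun i => X i : T -> R)) => /=.
have mid : measurable_fun setT (fun w => (idJ J w, X t w)).
  exact: measurable_fun_pair.
have l1 : L1 P (fun w => F w (X t w)).
  by apply: (@L1_bnd _ _ _ _ _ B) => //; exact: (measurableT_comp mF mid).
have [|l e] := @diag_expectation _ _ _ P _ _ _ _ (idJ J) (X t) F UV mF l1.
  move=> w; apply: (@L1_bnd _ _ _ _ _ B) => //.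
  have h := @measurable_fun_pair2 _ _ _ (sgX J) _ _ _ w mF.
  exact: (measurableT_comp h).
by split => //; exact: L1_meas l.
Qed.

End independent_products.

(** * Second and fourth moments of sums of independent centred variables *)

Section moments.
Context {d : measure_display} {T : measurableType d} {R : realType}.
Variable P : probability T R.

Lemma abs_pow_le4 (y : R) k : (k <= 4)%N -> `|y ^+ k| <= 1 + y ^+ 4.
Proof.
move=> k4; have -> : y ^+ 4 = `|y| ^+ 4 by rewrite -[LHS]ger0_norm ?exprn_even_ge0// normrX.
rewrite normrX; have := normr_ge0 y; move: (`|y|) => z z0.
have [z1|/ltW z1] := leP z 1.
  by rewrite (le_trans (exprn_ile1 _ _ _))// lerDl exprn_ge0.
by rewrite (le_trans (ler_weXn2l z1 k4))// lerDr.
Qed.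

Lemma L4_pow (f : T -> R) k : (k <= 4)%N -> measurable_fun setT f -> L1 P (fun w => f w ^+ 4) ->
  L1 P (fun w => f w ^+ k).
Proof.
move=> k4 mf l; apply: (L1_dom _ _ (L1D (L1_cst P 1) l)); first exact: measurable_funX.
by move=> w; exact: abs_pow_le4.
Qed.

Lemma L4D (f g : T -> R) : measurable_fun setT f -> measurable_fun setT g ->
  L1 P (fun w => f w ^+ 4) -> L1 P (fun w => g w ^+ 4) -> L1 P (fun w => (f w + g w) ^+ 4).
Proof.
move=> mf mg lf lg; apply: (L1_dom _ _ (L1Z 8 (L1D lf lg))).
  by apply: measurable_funX; exact: measurable_funD.
move=> w; rewrite ger0_norm ?exprn_even_ge0//; move: (f w) (g w) => a b.
have h1 : (a + b) ^+ 2 <= 2 * (a ^+ 2 + b ^+ 2) by have := sqr_ge0 (a - b); lra.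
have h2 : (a ^+ 2 + b ^+ 2) ^+ 2 <= 2 * (a ^+ 4 + b ^+ 4).
  by have := sqr_ge0 (a ^+ 2 - b ^+ 2); rewrite !sqrrD !sqrrN -!exprM /=; lra.
have -> : (a + b) ^+ 4 = ((a + b) ^+ 2) ^+ 2 by rewrite -exprM.
have h3 : ((a + b) ^+ 2) ^+ 2 <= (2 * (a ^+ 2 + b ^+ 2)) ^+ 2.
  by rewrite lerXn2r ?nnegrE ?sqr_ge0// mulr_ge0// addr_ge0 ?sqr_ge0.
by apply: (le_trans h3); rewrite exprMn; lra.
Qed.

Lemma L2_mul (f g : T -> R) : measurable_fun setT f -> measurable_fun setT g ->
  L1 P (fun w => f w ^+ 2) -> L1 P (fun w => g w ^+ 2) -> L1 P (fun w => f w * g w).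
Proof.
move=> mf mg lf lg; apply: (L1_dom _ _ (L1D lf lg)); first exact: measurable_funM.
move=> w; rewrite normrM -(real_normK (num_real (f w))) -(real_normK (num_real (g w))).
have := sqr_ge0 (`|f w| - `|g w|); have := sqr_ge0 (`|f w| + `|g w|); lra.
Qed.

Lemma L2D (f g : T -> R) : measurable_fun setT f -> measurable_fun setT g ->
  L1 P (fun w => f w ^+ 2) -> L1 P (fun w => g w ^+ 2) -> L1 P (fun w => (f w + g w) ^+ 2).
Proof.
move=> mf mg lf lg; apply: (eq_L1 _ (L1D (L1D lf (L1Z 2 (L2_mul mf mg lf lg))) lg)) => w.
by ring.
Qed.

Lemma cauchy_schwarz (f g : T -> R) c : 0 < c -> measurable_fun setT f -> measurable_fun setT g ->
  L1 P (fun w => f w ^+ 2) -> L1 P (fun w => g w ^+ 2) ->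
  Ex P (fun w => `|f w * g w|) <= (c * Ex P (fun w => f w ^+ 2) + Ex P (fun w => g w ^+ 2) / c) / 2.
Proof.
move=> c0 mf mg lf lg.
have l : L1 P (fun w => c / 2 * f w ^+ 2 + (2 * c)^-1 * g w ^+ 2) by apply: L1D; exact: L1Z.
apply: (le_trans (Ex_le (L1_abs (L2_mul mf mg lf lg)) l _)).
  move=> w; rewrite normrM -(real_normK (num_real (f w))) -(real_normK (num_real (g w))).
  rewrite -subr_ge0 (_ : _ - _ = (2 * c)^-1 * (c * `|f w| - `|g w|) ^+ 2).
    by rewrite mulr_ge0 ?sqr_ge0// invr_ge0 mulr_ge0// ltW.
  by field; rewrite gt_eqF.
rewrite ExD; [|exact: L1Z|exact: L1Z].
rewrite !ExZ// le_eqVlt; apply/orP; left; apply/eqP; by field; rewrite gt_eqF.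
Qed.

Variables (I : eqType) (X : I -> {RV P >-> R}).
Hypothesis iX : mutually_indep P (fun i => X i : T -> R).
Variables (iota_ : nat -> I) (g : nat -> R -> R).
Hypothesis iota_inj : injective iota_.
Hypothesis mg : forall i, measurable_fun setT (g i).
Hypothesis l4 : forall i, L1 P (fun w => g i (X (iota_ i) w) ^+ 4).
Hypothesis mean0 : forall i, Ex P (fun w => g i (X (iota_ i) w)) = 0.

Let Y (i : nat) (w : T) : R := g i (X (iota_ i) w).
Let S (n : nat) (w : T) : R := \sum_(i < n) Y i w.
Definition firsts n : pred I := fun j => j \in [seq iota_ i | i <- iota 0 n].

Lemma firsts_disjoint n j : firsts n j -> ~~ pred1 (iota_ n) j.
Proof.
rewrite /firsts => /mapP[i]; rewrite mem_iota add0n => /= h ->.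
by rewrite (inj_eq iota_inj) neq_ltn h.
Qed.

Lemma firsts_mem n i : (i < n)%N -> firsts n (iota_ i).
Proof. by move=> h; rewrite /firsts map_f// mem_iota. Qed.

Lemma indep_sum_adapted n : adapted X (firsts n) (S n).
Proof.
rewrite /adapted /S; apply: measurable_sum => i; apply: adapted_comp => //.
exact: firsts_mem.
Qed.

Lemma indep_term_adapted n : adapted X (pred1 (iota_ n)) (Y n).
Proof. by apply: adapted_comp => //=. Qed.

Lemma indep_sum_meas n : measurable_fun setT (S n).
Proof. exact: (adapted_meas (@indep_sum_adapted n)). Qed.
Arguments indep_sum_meas : clear implicits.

Let mY n : measurable_fun setT (Y n).
Proof. exact: (adapted_meas (@indep_term_adapted n)). Qed.
Arguments mY : clear implicits.

Lemma indep_sum_L4 n : L1 P (fun w => S n w ^+ 4).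
Proof.
elim: n => [|n IH].
  by apply: (eq_L1 _ (L1_cst P 0)) => w; rewrite /S big_ord0 expr0n.
apply: (eq_L1 _ (L4D (indep_sum_meas n) (mY n) IH (l4 n))) => w.
by rewrite /S big_ord_recr.
Qed.

Lemma indep_sum_step n a b : (a <= 4)%N -> (b <= 4)%N ->
  L1 P (fun w => S n w ^+ a * Y n w ^+ b) /\
  Ex P (fun w => S n w ^+ a * Y n w ^+ b) = Ex P (fun w => S n w ^+ a) * Ex P (fun w => Y n w ^+ b).
Proof.
move=> a4 b4; apply: (Ex_indep iX (@firsts_disjoint n)).
- by apply: measurable_funX; exact: indep_sum_adapted.
- by apply: measurable_funX; exact: indep_term_adapted.
- by apply: L4_pow => //; [exact: indep_sum_meas|exact: indep_sum_L4].
- by apply: L4_pow => //; exact: l4.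
Qed.

Lemma indep_sum_sqr n : Ex P (fun w => S n w ^+ 2) = \sum_(i < n) Ex P (fun w => Y i w ^+ 2).
Proof.
elim: n => [|n IH].
  rewrite big_ord0 -[RHS](Ex_cst P); apply: eq_Ex => w; by rewrite /S big_ord0 expr0n.
rewrite big_ord_recr /= -IH.
have lS := L4_pow (isT : 2 <= 4)%N (indep_sum_meas n) (indep_sum_L4 n).
have lY := L4_pow (isT : 2 <= 4)%N (mY n) (l4 n).
have [l11 e11] := @indep_sum_step n 1 1 isT isT.
have Y0 : Ex P (fun w => Y n w ^+ 1) = 0.
  by rewrite -[RHS](mean0 n); apply: eq_Ex => w; rewrite expr1.
rewrite (@eq_Ex _ _ _ _ _ (fun w => S n w ^+ 2 + 2 * (S n w ^+ 1 * Y n w ^+ 1) + Y n w ^+ 2)).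
  rewrite ExD//; last by apply: L1D => //; exact: L1Z.
  rewrite ExD//; last exact: L1Z.
  by rewrite ExZ// e11 Y0 !mulr0 addr0.
by move=> w; rewrite /S big_ord_recr /=; ring.
Qed.

(** In the binomial expansion the terms with a lone factor [S] or [Y n] vanish, leaving
    [6 E S^2 E Y^2]. This is the cross term of [3 (A + y)^2], which is why the second part of the
    bound is stable under induction. *)
Lemma indep_sum_pow4 n : Ex P (fun w => S n w ^+ 4) <=
  \sum_(i < n) Ex P (fun w => Y i w ^+ 4) + 3 * (\sum_(i < n) Ex P (fun w => Y i w ^+ 2)) ^+ 2.
Proof.
elim: n => [|n IH].
  rewrite !big_ord0 expr0n /= mulr0 addr0 (_ : Ex P _ = 0)//.
  by rewrite -[RHS](Ex_cst P); apply: eq_Ex => w; rewrite /S big_ord0 expr0n.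
have [l31 e31] := @indep_sum_step n 3 1 isT isT.
have [l22 e22] := @indep_sum_step n 2 2 isT isT.
have [l13 e13] := @indep_sum_step n 1 3 isT isT.
have lS := indep_sum_L4 n; have lY := l4 n.
have Y0 : Ex P (fun w => Y n w ^+ 1) = 0.
  by rewrite -[RHS](mean0 n); apply: eq_Ex => w; rewrite expr1.
have S0 : Ex P (fun w => S n w ^+ 1) = 0.
  transitivity (Ex P (S n)); first by apply: eq_Ex => w; rewrite expr1.
  rewrite /S Ex_sum; first by apply: big1 => i _; exact: mean0.
  move=> i _; apply: (eq_L1 _ (@L4_pow (Y i) 1 isT (mY i) (l4 i))) => w; by rewrite expr1.
have -> : Ex P (fun w => S n.+1 w ^+ 4) = Ex P (fun w => S n w ^+ 4) +
    6 * (Ex P (fun w => S n w ^+ 2) * Ex P (fun w => Y n w ^+ 2)) + Ex P (fun w => Y n w ^+ 4).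
  rewrite (@eq_Ex _ _ _ _ _ (fun w => S n w ^+ 4 + 4 * (S n w ^+ 3 * Y n w ^+ 1) +
     6 * (S n w ^+ 2 * Y n w ^+ 2) + 4 * (S n w ^+ 1 * Y n w ^+ 3) + Y n w ^+ 4)); last first.
    by move=> w; rewrite /S big_ord_recr /=; ring.
  have m31 := L1Z 4 l31; have m22 := L1Z 6 l22; have m13 := L1Z 4 l13.
  rewrite ExD//; last by apply: L1D => //; apply: L1D => //; exact: L1D.
  rewrite ExD//; last by apply: L1D => //; exact: L1D.
  rewrite ExD//; last exact: L1D.
  rewrite ExD// (ExZ _ l31) (ExZ _ l22) (ExZ _ l13) e31 e22 e13 Y0 S0.
  by rewrite mul0r !mulr0 !addr0.
rewrite !big_ord_recr /= indep_sum_sqr.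
set A := \sum_(i < n) _ in IH *; set y := Ex P (fun w => Y n w ^+ 2).
have := sqr_ge0 y; move: IH; set A2 := \sum_(i < n) _; lra.
Qed.

End moments.

(** * Linear processes *)

Section ident.
Context {d : measure_display} {T : measurableType d} {R : realType}.
Variable P : probability T R.

Lemma ident_Ex (I : Type) (X : I -> {RV P >-> R}) (i j : I) (g : R -> R) :
  ident_distr P (fun i => X i : T -> R) -> measurable_fun setT g ->
  L1 P (fun w => g (X i w)) ->
  L1 P (fun w => g (X j w)) /\ Ex P (fun w => g (X j w)) = Ex P (fun w => g (X i w)).
Proof.
move=> idX mg li.
have E A : measurable A -> distribution P (X j) A = distribution P (X i) A by move=> mA; exact: idX.
have lj : L1 P (fun w => g (X j w)).
  apply/integrableP; split.
    by apply/measurable_EFinP; exact: (measurableT_comp mg).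
  have := ge0_integral_distribution (X j) (f := fun x => `|g x|%:E).
  rewrite /comp => <-//; last by apply/measurable_EFinP; exact: measurableT_comp.
  rewrite (eq_measure_integral (distribution P (X i))); last by move=> A mA _; exact: E.
  rewrite ge0_integral_distribution//; last by apply/measurable_EFinP; exact: measurableT_comp.
  by case/integrableP : li.
split => //; apply: EFin_inj; rewrite !Ex_fin//.
have mgE : measurable_fun setT (EFin \o g) by exact/measurable_EFinP.
have := integral_distribution mgE lj; rewrite /comp => <-.
have := integral_distribution mgE li; rewrite /comp => <-.
by apply: eq_measure_integral => A mA _; exact: E.
Qed.

(** The errors are given as almost sure limits, and this is how integrability and moment bounds
    reach them. *)
Lemma Ex_fatou (f_ : nat -> T -> R) (f : T -> R) C :
  (forall n, L1 P (f_ n)) -> (forall n w, 0 <= f_ n w) -> measurable_fun setT f ->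
  (forall w, 0 <= f w) ->
  {ae P, forall w, f_ n w @[n --> \oo] --> f w} ->
  (\forall n \near \oo, Ex P (f_ n) <= C) -> L1 P f /\ Ex P f <= C.
Proof.
move=> lf f0 mf f0' cf bf.
have key : (\int[P]_w (f w)%:E <= C%:E)%E.
  have mE n : measurable_fun setT (EFin \o f_ n) by apply/measurable_EFinP; exact: L1_meas (lf n).
  have := @fatou _ _ _ P _ measurableT (fun n => EFin \o f_ n) mE (fun n w _ => f0 n w).
  have -> : (\int[P]_w limn_einf (fun n => (EFin \o f_ n) w) = \int[P]_w (f w)%:E)%E.
    apply: ae_eq_integral => //; first 2 last.
    - apply: filterS cf => w cw _.
      have /cvg_limn_einf_sup[-> _]// : ((EFin \o f_ n) w @[n --> \oo] --> (f w)%:E)%E.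
      by apply: cvg_EFin => //; near=> n.
    - have -> : (fun w => limn_einf (fun n => (EFin \o f_ n) w)) =
          (fun w => - limn_esup (fun n => - (EFin \o f_ n) w)%E)%E.
        by apply/funext => w; rewrite -[RHS]oppeK -limn_einfN oppeK; congr limn_einf;
           apply/funext => n /=; rewrite opprK.
      apply: measurableT_comp => //; apply: measurable_fun_limn_esup => n.
      exact: measurableT_comp.
    - exact/measurable_EFinP.
  move=> h; apply: (le_trans h).
  rewrite limn_einf_lim; apply: lime_le; first exact: is_cvg_einfs.
  have [N _ hN] := bf; apply: nearW => n.
  (* The infimum over the indices from [n] on is compared with the term [maxn n N], where the bound
     already holds. *)
  apply: (@le_trans _ _ (\int[P]_w (f_ (maxn n N) w)%:E)%E).
    by apply: ereal_inf_lbound; exists (maxn n N) => //=; rewrite leq_maxl.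
  by rewrite -Ex_fin// lee_fin; apply: hN => /=; rewrite leq_maxr.
have l : L1 P f.
  apply/integrableP; split; first exact/measurable_EFinP.
  under eq_integral do rewrite /= ger0_norm//.
  by apply: le_lt_trans key _; rewrite ltry.
by split => //; rewrite -lee_fin Ex_fin.
Unshelve. all: by end_near. Qed.

End ident.

Section windows.
Context {R : realType}.
Implicit Types (F : int -> R) (M N : nat) (k : int).

(** Sums over windows are reindexed by inserting the indicator of [j == k], exchanging the sums and
    removing it again with this lemma. *)
Lemma ssum_delta F M k :
  ssum (fun j => F j * (j == k)%:R) M = if (`|k| <= M)%N then F k else 0.
Proof.
rewrite /ssum; case: ifPn => kM.
  have h : (`|(k + M%:Z)%R| < M.*2.+1)%N by lia.
  rewrite (bigD1 (Ordinal h))//= big1 ?addr0.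
    have -> : `|(k + M%:Z)%R|%N%:Z - M%:Z = k by lia.
    by rewrite eqxx mulr1.
  move=> i /eqP ih; case: eqP; rewrite ?mulr0// => ik; exfalso; apply: ih; apply/val_inj => /=.
  lia.
rewrite big1// => i _; case: eqP; rewrite ?mulr0// => ik; exfalso.
by have := ltn_ord i; lia.
Qed.

Lemma le_ssum F N M : (forall j, 0 <= F j) -> (N <= M)%N -> ssum F N <= ssum F M.
Proof.
move=> F0; elim: M => [|M IH]; first by rewrite leqn0 => /eqP ->.
rewrite leq_eqVlt => /predU1P[->//|/IH h]; apply: (le_trans h).
rewrite /ssum doubleS [leRHS]big_ord_recr /= [X in _ <= X + _]big_ord_recl /=.
rewrite [X in _ <= _ + X + _](eq_bigr (fun i : 'I_M.*2.+1 => F (i%:Z - M%:Z))); last first.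
  by move=> i _; congr F; rewrite /bump /=; lia.
have := F0 (0%N%:Z - M.+1%:Z); have := F0 (M.*2.+2%:Z - M.+1%:Z); lra.
Qed.

End windows.

Section L2_limits.
Context {d : measure_display} {T : measurableType d} {R : realType}.
Variable P : probability T R.

Lemma L2_cvg_prod (f h : T -> R) (h_ : nat -> T -> R) :
  measurable_fun setT f -> measurable_fun setT h -> (forall M, measurable_fun setT (h_ M)) ->
  L1 P (fun w => f w ^+ 2) -> L1 P (fun w => h w ^+ 2) -> (forall M, L1 P (fun w => h_ M w ^+ 2)) ->
  (forall M, L1 P (fun w => (h w - h_ M w) ^+ 2)) ->
  Ex P (fun w => (h w - h_ M w) ^+ 2) @[M --> \oo] --> (0:R) ->
  Ex P (fun w => f w * h_ M w) @[M --> \oo] --> Ex P (fun w => f w * h w).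
Proof.
move=> mf mh mh_ lf lh lh_ ld c0; apply/cvgrPdist_le => eps e0.
set q := Ex P (fun w => f w ^+ 2).
have q0 : 0 <= q by apply: Ex_ge0 => w; exact: sqr_ge0.
(* The weight in Cauchy-Schwarz: [c q <= eps] whatever [q] is, and the other term tends to 0 because
   [c] is fixed. *)
pose c := eps / (q + 1).
have c0' : 0 < c by rewrite divr_gt0// ltr_wpDl.
have ce : 0 < eps * c by rewrite mulr_gt0.
move/cvgrPdist_le : c0 => /(_ _ ce) c0.
near=> M.
have md : measurable_fun setT (fun w => h w - h_ M w) by exact: measurable_funB.
rewrite -ExB; [|exact: L2_mul|exact: L2_mul].
rewrite (@eq_Ex _ _ _ _ _ (fun w => f w * (h w - h_ M w))); last by move=> w; ring.
have lfd : L1 P (fun w => f w * (h w - h_ M w)) by exact: L2_mul.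
apply: (le_trans (Ex_abs lfd)); apply: (le_trans (cauchy_schwarz c0' mf md lf (ld M))).
have : `|0 - Ex P (fun w => (h w - h_ M w) ^+ 2)| <= eps * c by near: M.
rewrite sub0r normrN => /(le_trans (ler_norm _)) hd.
have h1 : c * q <= eps.
  by rewrite /c mulrAC ler_pdivrMr ?ltr_wpDl// ler_pM2l// lerDl.
have h2 : Ex P (fun w => (h w - h_ M w) ^+ 2) / c <= eps by rewrite ler_pdivrMr.
by rewrite -/q ler_pdivrMr//; lra.
Unshelve. all: by end_near. Qed.

End L2_limits.

Section linear_process.
Context {d : measure_display} {T : measurableType d} {R : realType}.
Variable P : probability T R.
Variables (xi : int -> {RV P >-> R}) (psi : int -> R) (e : int -> {RV P >-> R}) (g0 : R).
Hypothesis ixi : mutually_indep P (fun i => xi i : T -> R).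
Hypothesis idxi : ident_distr P (fun i => xi i : T -> R).
Hypothesis l6 : L1 P (fun w => xi 0 w ^+ 6).
Hypothesis m0 : Ex P (xi 0) = 0.
Hypothesis v1 : Ex P (fun w => xi 0 w ^+ 2) = 1.
Hypothesis cg0 : ssum (fun j => psi j ^+ 2) N @[N --> \oo] --> g0.
Hypothesis ae_e : forall t : int, {ae P, forall w,
  ssum (fun j => psi j * xi (t - j) w) N @[N --> \oo] --> e t w}.

Definition xi4 := Ex P (fun w => xi 0 w ^+ 4).
Definition xi3 := Ex P (fun w => `|xi 0 w| ^+ 3).

Lemma xi_L4 j : L1 P (fun w => xi j w ^+ 4).
Proof.
have l0 : L1 P (fun w => xi 0 w ^+ 4).
  apply: (L1_dom _ _ (L1D (L1_cst P 1) l6)); first exact: measurable_funX.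
  move=> w; rewrite normrX; have -> : xi 0 w ^+ 6 = `|xi 0 w| ^+ 6.
    by rewrite -[LHS]ger0_norm ?exprn_even_ge0// normrX.
  have := normr_ge0 (xi 0 w); move: (`|_|) => z z0.
  have [z1|/ltW z1] := leP z 1.
    by rewrite (le_trans (exprn_ile1 _ _ _))// lerDl exprn_ge0.
  by rewrite (le_trans (ler_weXn2l z1 (isT : 4 <= 6)%N))// lerDr.
have mg : measurable_fun setT (fun x : R => x ^+ 4) by exact: measurable_funX.
by have [] := ident_Ex (i := 0) j idxi mg l0.
Qed.

Lemma xi_L j k : (k <= 4)%N -> L1 P (fun w => xi j w ^+ k).
Proof. by move=> k4; apply: L4_pow => //; exact: xi_L4. Qed.

Lemma xi_L1 j : L1 P (xi j).
Proof. by apply: (eq_L1 _ (@xi_L j 1 isT)) => w; rewrite expr1. Qed.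

Lemma xi_mean j : Ex P (xi j) = 0.
Proof. by rewrite -m0; have [] := ident_Ex (i := 0) j idxi (@measurable_id _ R setT) (xi_L1 0). Qed.

Lemma xi_pow j k : (k <= 4)%N -> Ex P (fun w => xi j w ^+ k) = Ex P (fun w => xi 0 w ^+ k).
Proof.
move=> k4; have mg : measurable_fun setT (fun x : R => x ^+ k) by exact: measurable_funX.
by have [] := ident_Ex (i := 0) j idxi mg (@xi_L 0 k k4).
Qed.

Lemma xi_sqr j : Ex P (fun w => xi j w ^+ 2) = 1.
Proof. by rewrite xi_pow. Qed.

Lemma xi_abs3 j : L1 P (fun w => `|xi j w| ^+ 3) /\ Ex P (fun w => `|xi j w| ^+ 3) = xi3.
Proof.
have mg : measurable_fun setT (fun x : R => `|x| ^+ 3) by apply: measurable_funX; exact: normr_measurable.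
have l0 : L1 P (fun w => `|xi 0 w| ^+ 3).
  apply: (eq_L1 _ (L1_abs (@xi_L 0 3 isT))) => w; by rewrite normrX.
by have [] := ident_Ex (i := 0) j idxi mg l0.
Qed.

Lemma xi_cov i j : Ex P (fun w => xi i w * xi j w) = (i == j)%:R.
Proof.
case: eqVneq => [->|ij].
  by rewrite -(xi_sqr j); apply: eq_Ex => w; rewrite expr2.
have [|||||_ ->] := @Ex_indep _ _ _ _ _ _ ixi (pred1 i) (pred1 j) (xi i) (xi j).
- by move=> k /= /eqP ->.
- by apply: (@adapted_comp _ _ _ _ _ xi _ _ id) => //=.
- by apply: (@adapted_comp _ _ _ _ _ xi _ _ id) => //=.
- exact: xi_L1.
- exact: xi_L1.
by rewrite xi_mean mul0r.
Qed.

Section linear_form.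
Variables (iota_ : nat -> int) (c : nat -> R).
Hypothesis iota_inj : injective iota_.

Definition lform n w := \sum_(i < n) c i * xi (iota_ i) w.

Let mg i : measurable_fun setT (fun x : R => c i * x).
Proof. exact: measurable_funM. Qed.

Let l4 i : L1 P (fun w => (c i * xi (iota_ i) w) ^+ 4).
Proof. by apply: (eq_L1 _ (L1Z (c i ^+ 4) (xi_L4 (iota_ i)))) => w; rewrite exprMn. Qed.

Let mean0 i : Ex P (fun w => c i * xi (iota_ i) w) = 0.
Proof. by rewrite (ExZ _ (xi_L1 _)) xi_mean mulr0. Qed.

Lemma lform_meas n : measurable_fun setT (lform n).
Proof. by apply: measurable_sum => i; exact: measurable_funM. Qed.

Lemma lform_L4 n : L1 P (fun w => lform n w ^+ 4).
Proof. exact: (indep_sum_L4 mg l4). Qed.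

Lemma lform_sqr n : Ex P (fun w => lform n w ^+ 2) = \sum_(i < n) c i ^+ 2.
Proof.
rewrite (indep_sum_sqr ixi iota_inj mg l4 mean0).
apply: eq_bigr => i _; rewrite -[RHS]mulr1 -(xi_sqr (iota_ i)) -ExZ; last exact: xi_L.
by apply: eq_Ex => w; rewrite exprMn.
Qed.

(** The sum of the fourth powers of the coefficients is at most the square of their sum of squares,
    so the bound depends on the variance only and not on the number of terms. *)
Lemma lform_pow4 n : Ex P (fun w => lform n w ^+ 4) <= (xi4 + 3) * (\sum_(i < n) c i ^+ 2) ^+ 2.
Proof.
apply: (le_trans (indep_sum_pow4 ixi iota_inj mg l4 mean0 n)).
have e2 i : Ex P (fun w => (c i * xi (iota_ i) w) ^+ 2) = c i ^+ 2.
  rewrite -[RHS]mulr1 -(xi_sqr (iota_ i)) -ExZ; last exact: xi_L.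
  by apply: eq_Ex => w; rewrite exprMn.
have e4 i : Ex P (fun w => (c i * xi (iota_ i) w) ^+ 4) = c i ^+ 4 * xi4.
  rewrite /xi4 -(xi_pow (iota_ i) (isT : 4 <= 4)%N) -ExZ; last exact: xi_L4.
  by apply: eq_Ex => w; rewrite exprMn.
rewrite [X in X + _](eq_bigr (fun i : 'I_n => c i ^+ 4 * xi4)); last by move=> i _; exact: e4.
rewrite [X in 3 * X ^+ 2](eq_bigr (fun i : 'I_n => c i ^+ 2)); last by move=> i _; exact: e2.
rewrite -mulr_suml.
rewrite [leRHS]mulrDl lerD2r mulrC ler_wpM2l//.
  by apply: Ex_ge0 => w; rewrite exprn_even_ge0.
elim: n => [|n IH]; first by rewrite !big_ord0 expr0n.
rewrite !big_ord_recr /= sqrrD -exprM; have h := sqr_ge0 (c n).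
have : 0 <= \sum_(i < n) c i ^+ 2 by apply: sumr_ge0 => i _; exact: sqr_ge0.
move=> A0; rewrite -[leRHS]addrA; apply: lerD => //.
by rewrite lerDr mulrn_wge0// mulr_ge0.
Qed.

End linear_form.

(** * Truncated errors, and the passage to the limit in mean square *)

Definition eN N t w := ssum (fun j => psi j * xi (t - j) w) N.
Definition gN k N := ssum (fun j => psi j * psi (j + k)) N.

Let io N t (i : nat) : int := t - (i%:Z - N%:Z).

Let io_inj N t : injective (io N t).
Proof. by move=> i j; rewrite /io; lia. Qed.

Lemma eN_meas N t : measurable_fun setT (eN N t).
Proof. exact: (@lform_meas (io N t) (fun i => psi (i%:Z - N%:Z)) N.*2.+1). Qed.

Lemma eN_L4 N t : L1 P (fun w => eN N t w ^+ 4).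
Proof. exact: (@lform_L4 (io N t) (fun i => psi (i%:Z - N%:Z)) N.*2.+1). Qed.

Lemma eN_L2 N t : L1 P (fun w => eN N t w ^+ 2).
Proof. by apply: L4_pow => //; [exact: eN_meas|exact: eN_L4]. Qed.

Lemma gN_le0 N : ssum (fun j => psi j ^+ 2) N <= g0.
Proof.
rewrite -(cvg_lim _ cg0)//; apply: nondecreasing_cvgn_le; last by apply/cvg_ex; exists g0.
by move=> a b ab; apply: le_ssum => // j; exact: sqr_ge0.
Qed.

Lemma g0_ge0 : 0 <= g0.
Proof. by apply: le_trans (gN_le0 0); apply: sumr_ge0 => i _; exact: sqr_ge0. Qed.

Lemma eN_pow4 N t : Ex P (fun w => eN N t w ^+ 4) <= (xi4 + 3) * g0 ^+ 2.
Proof.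
apply: (le_trans (lform_pow4 (fun i => psi (i%:Z - N%:Z)) (@io_inj N t) N.*2.+1)); rewrite ler_wpM2l//.
  by rewrite addr_ge0//; apply: Ex_ge0 => w; rewrite exprn_even_ge0.
rewrite lerXn2r ?nnegrE ?g0_ge0//; first by apply: sumr_ge0 => i _; exact: sqr_ge0.
exact: gN_le0.
Qed.

(* with a large enough second window every product in the first one is hit, so
   no boundary terms appear *)
Lemma eN_cov N M t s : (N + `|(s - t)%R| <= M)%N ->
  Ex P (fun w => eN N t w * eN M s w) = gN (s - t) N.
Proof.
move=> NM; rewrite /eN /gN.
have l (i : int) (j : int) : L1 P (fun w => psi i * psi j * (xi (t - i) w * xi (s - j) w)).
  by apply: L1Z; apply: L2_mul => //; exact: xi_L.
transitivity (\sum_(i < N.*2.+1) \sum_(j < M.*2.+1)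
    psi (i%:Z - N%:Z) * psi (j%:Z - M%:Z) * (t - (i%:Z - N%:Z) == s - (j%:Z - M%:Z))%:R).
  rewrite (@eq_Ex _ _ _ _ _ (fun w => \sum_(i < N.*2.+1) \sum_(j < M.*2.+1)
     psi (i%:Z - N%:Z) * psi (j%:Z - M%:Z) * (xi (t - (i%:Z - N%:Z)) w * xi (s - (j%:Z - M%:Z)) w))).
    rewrite Ex_sum; last by move=> i _; apply: L1_sum => j _; exact: l.
    apply: eq_bigr => i _; rewrite Ex_sum; last by move=> j _; exact: l.
    apply: eq_bigr => j _; rewrite ExZ ?xi_cov//.
    by apply: L2_mul => //; exact: xi_L.
  move=> w; rewrite /ssum mulr_suml; apply: eq_bigr => i _; rewrite mulr_sumr.
  by apply: eq_bigr => j _; ring.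
apply: eq_bigr => i _; set k := i%:Z - N%:Z.
transitivity (psi k * ssum (fun j => psi j * (j == k + (s - t))%:R) M).
  rewrite /ssum mulr_sumr; apply: eq_bigr => j _; rewrite mulrA; congr (_ * _%:R).
  by congr nat_of_bool; apply/eqP/eqP; lia.
rewrite ssum_delta ifT//.
have : (`|k| <= N)%N by rewrite /k; have := ltn_ord i; lia.
lia.
Qed.

Lemma gN0 N : gN 0 N = ssum (fun j => psi j ^+ 2) N.
Proof. by apply: eq_bigr => i _; rewrite addr0 expr2. Qed.

Lemma eN_sqr N t : Ex P (fun w => eN N t w ^+ 2) = gN 0 N.
Proof.
have := @eN_cov N N t t; rewrite subrr addn0 => <-//.
Qed.

Lemma eN_diff_sqr N M t : (N <= M)%N ->
  Ex P (fun w => (eN M t w - eN N t w) ^+ 2) = gN 0 M - gN 0 N.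
Proof.
move=> NM.
have lc : L1 P (fun w => eN N t w * eN M t w).
  by apply: L2_mul; [exact: eN_meas|exact: eN_meas|exact: eN_L2|exact: eN_L2].
rewrite (@eq_Ex _ _ _ _ _ (fun w => eN M t w ^+ 2 - 2 * (eN N t w * eN M t w) + eN N t w ^+ 2)); last first.
  by move=> w; ring.
rewrite ExD; [|apply: L1B; [exact: eN_L2|exact: L1Z]|exact: eN_L2].
rewrite ExB; [|exact: eN_L2|exact: L1Z].
rewrite ExZ// !eN_sqr eN_cov ?subrr ?addn0//; ring.
Qed.

(** The squared distance between the windows [M] and [N] has mean [gN 0 M - gN 0 N], at most the
    tail of the series [g0]; Fatou lets [M] tend to infinity. *)
Lemma e_diff N t : L1 P (fun w => (e t w - eN N t w) ^+ 2) /\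
  Ex P (fun w => (e t w - eN N t w) ^+ 2) <= g0 - gN 0 N.
Proof.
apply: (@Ex_fatou _ _ _ P (fun M w => (eN M t w - eN N t w) ^+ 2)).
- move=> M; apply: (eq_L1 (f := fun w => (eN M t w + (-1) * eN N t w) ^+ 2)).
    by move=> w; rewrite mulN1r.
  apply: L2D; [exact: eN_meas|by apply: measurable_funM => //; exact: eN_meas|exact: eN_L2|].
  apply: (eq_L1 _ (eN_L2 N t)) => w; by rewrite mulN1r sqrrN.
- by move=> M w; exact: sqr_ge0.
- by apply: measurable_funX; apply: measurable_funB => //; exact: eN_meas.
- by move=> w; exact: sqr_ge0.
- apply: filterS (ae_e t) => w cw.
  by apply: (@cvgM _ _ _ _ _ _ _ _); apply: cvgB => //; exact: cvg_cst.
- near=> M; rewrite eN_diff_sqr; last by near: M; exact: nbhs_infty_ge.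
  by rewrite lerD2r gN0 gN_le0.
Unshelve. all: by end_near. Qed.

Lemma e_pow4 t : L1 P (fun w => e t w ^+ 4) /\ Ex P (fun w => e t w ^+ 4) <= (xi4 + 3) * g0 ^+ 2.
Proof.
apply: (@Ex_fatou _ _ _ P (fun M w => eN M t w ^+ 4)).
- by move=> M; exact: eN_L4.
- by move=> M w; rewrite exprn_even_ge0.
- exact: measurable_funX.
- by move=> w; rewrite exprn_even_ge0.
- apply: filterS (ae_e t) => w cw; exact: (continuous_cvg _ (@exprn_continuous _ 4 _)).
- by apply: nearW => M; exact: eN_pow4.
Qed.

Lemma e_L2 t : L1 P (fun w => e t w ^+ 2).
Proof. by apply: L4_pow => //; case: (e_pow4 t). Qed.


Lemma e_diff_cvg t : Ex P (fun w => (e t w - eN N t w) ^+ 2) @[N --> \oo] --> (0:R).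
Proof.
apply: (@squeeze_cvgr _ _ _ _ (cst 0) (fun N => g0 - gN 0 N)).
- apply: nearW => N; apply/andP; split; first by apply: Ex_ge0 => w; exact: sqr_ge0.
  by have [] := e_diff N t.
- exact: cvg_cst.
- rewrite -(subrr g0); apply: cvgB; first exact: cvg_cst.
  have -> : gN 0 = (fun N => ssum (fun j => psi j ^+ 2) N) by apply/funext => N; exact: gN0.
  exact: cg0.
Qed.

Lemma eN_e_prod N t s : Ex P (fun w => eN N t w * e s w) = gN (s - t) N.
Proof.
have cv : Ex P (fun w => eN N t w * eN M s w) @[M --> \oo] --> Ex P (fun w => eN N t w * e s w).
  apply: L2_cvg_prod => //.
  - exact: eN_meas.
  - by move=> M; exact: eN_meas.
  - exact: eN_L2.
  - exact: e_L2.
  - by move=> M; exact: eN_L2.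
  - by move=> M; case: (e_diff M s).
  - exact: e_diff_cvg.
have cv' : Ex P (fun w => eN N t w * eN M s w) @[M --> \oo] --> gN (s - t) N.
  apply: cvg_near_cst; near=> M; apply: eN_cov; near: M; exact: nbhs_infty_ge.
exact: (cvg_unique _ cv cv').
Unshelve. all: by end_near. Qed.

Lemma gN_cvg t s : gN (s - t) N @[N --> \oo] --> Ex P (fun w => e t w * e s w).
Proof.
have cv : Ex P (fun w => e s w * eN N t w) @[N --> \oo] --> Ex P (fun w => e s w * e t w).
  apply: L2_cvg_prod => //.
  - by move=> N; exact: eN_meas.
  - exact: e_L2.
  - exact: e_L2.
  - by move=> N; exact: eN_L2.
  - by move=> N; case: (e_diff N t).
  - exact: e_diff_cvg.
rewrite [X in _ --> X](_ : _ = Ex P (fun w => e s w * e t w)); last first.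
  by apply: eq_Ex => w; rewrite mulrC.
rewrite (_ : (fun N => gN (s - t) N) = (fun N => Ex P (fun w => e s w * eN N t w)))//.
by apply/funext => N; rewrite -eN_e_prod; apply: eq_Ex => w; rewrite mulrC.
Qed.

(** [gam] is a [lim], so it has a meaning only once the windows are known to converge; [gN_cvg]
    supplies this and identifies the limit. *)
Lemma e_cov t s : Ex P (fun w => e t w * e s w) = gam psi (s - t).
Proof. by rewrite /gam /zseries; apply/esym/cvg_lim => //; exact: gN_cvg. Qed.

Lemma gam0 : gam psi 0 = g0.
Proof.
rewrite /gam /zseries; apply/cvg_lim => //.
have -> : ssum (fun j => psi j * psi (j + 0)) = ssum (fun j => psi j ^+ 2).
  by apply/funext => N; exact: gN0.
exact: cg0.
Qed.

Lemma e_sqr t : Ex P (fun w => e t w ^+ 2) = g0.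
Proof.
rewrite -gam0 -(subrr t) -e_cov; apply: eq_Ex => w; by rewrite expr2.
Qed.

(** * Law of large numbers for the squared errors *)

Definition YN N t w := eN N t w ^+ 2 - gN 0 N.

(** A truncated error reads only the innovations at distance at most [N], so these centred squares
    are independent at distance more than [2 N]. *)
Lemma YN_adapted N t : adapted xi (fun j => `|(t - j)%R| <= N)%N (YN N t).
Proof.
apply: measurable_funB => //; apply: measurable_funX; rewrite /eN /ssum.
apply: measurable_sum => i; apply: measurable_funM => //.
apply: (@adapted_comp _ _ _ _ _ xi _ _ id) => //=; have := ltn_ord i; lia.
Qed.

Lemma YN_meas N t : measurable_fun setT (YN N t).
Proof. exact: (adapted_meas (@YN_adapted N t)). Qed.

Definition CY := 2 * ((xi4 + 3) * g0 ^+ 2) + 2 * g0 ^+ 2.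

Lemma YN_sqr N t : L1 P (fun w => YN N t w ^+ 2) /\ Ex P (fun w => YN N t w ^+ 2) <= CY.
Proof.
have l : L1 P (fun w => 2 * eN N t w ^+ 4 + 2 * g0 ^+ 2) by apply: L1D; [exact/L1Z/eN_L4|exact: L1_cst].
have b w : YN N t w ^+ 2 <= 2 * eN N t w ^+ 4 + 2 * g0 ^+ 2.
  have -> : eN N t w ^+ 4 = (eN N t w ^+ 2) ^+ 2 by rewrite -exprM.
  have h0 : 0 <= gN 0 N by rewrite gN0; apply: sumr_ge0 => i _; exact: sqr_ge0.
  have h : gN 0 N ^+ 2 <= g0 ^+ 2 by rewrite lerXn2r ?nnegrE ?g0_ge0// gN0 gN_le0.
  rewrite /YN; have := sqr_ge0 (eN N t w ^+ 2 + gN 0 N); lra.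
have l2 : L1 P (fun w => YN N t w ^+ 2).
  apply: (L1_dom _ _ l); first by apply: measurable_funX; exact: YN_meas.
  by move=> w; rewrite ger0_norm ?sqr_ge0.
split => //; apply: (le_trans (Ex_le l2 l b)).
rewrite ExD ?Ex_cst; [|exact/L1Z/eN_L4|exact: L1_cst].
rewrite (ExZ _ (eN_L4 N t)) /CY lerD2r ler_pM2l//; exact: eN_pow4.
Qed.

Lemma YN_mean N t : Ex P (YN N t) = 0.
Proof. by rewrite /YN ExB; [rewrite Ex_cst eN_sqr subrr|exact: eN_L2|exact: L1_cst]. Qed.

Lemma YN_far N t s : (N.*2 < `|(t - s)%R|)%N -> Ex P (fun w => YN N t w * YN N s w) = 0.
Proof.
move=> h.
have lY u : L1 P (YN N u) by apply: L1B; [exact: eN_L2|exact: L1_cst].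
have [|_ ->] := Ex_indep ixi _ (@YN_adapted N t) (@YN_adapted N s) (lY t) (lY s).
  by move=> j; lia.
by rewrite YN_mean mul0r.
Qed.

Lemma sum_at_most_one (n : nat) (p : pred nat) : (forall i j, p i -> p j -> i = j) ->
  \sum_(i < n) (p i)%:R <= 1 :> R.
Proof.
move=> p1; elim: n => [|n IH]; first by rewrite big_ord0.
rewrite big_ord_recr /=; case: (boolP (p n)) => pn; last by rewrite addr0.
rewrite big1 ?add0r// => i _; case: (boolP (p i)) => // pi.
by have := p1 _ _ pi pn; have := ltn_ord i => /[swap] ->; rewrite ltnn.
Qed.

(** Pairs at distance more than [2 N] are uncorrelated, and each index has at most [4 N + 1]
    partners within that range, itself included; [k] runs over these offsets. *)
Lemma YN_sum_sqr N n : L1 P (fun w => (\sum_(i < n) YN N i.+1%:Z w) ^+ 2) /\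
  Ex P (fun w => (\sum_(i < n) YN N i.+1%:Z w) ^+ 2) <= n%:R * (N.*2.*2.+1)%:R * CY.
Proof.
have C0 : 0 <= CY.
  have := g0_ge0; rewrite /CY => h; have x0 : 0 <= xi4 by apply: Ex_ge0 => w; rewrite exprn_even_ge0.
  by rewrite addr_ge0// mulr_ge0// ?mulr_ge0 ?addr_ge0 ?sqr_ge0.
have lp t s : L1 P (fun w => YN N t w * YN N s w).
  by apply: L2_mul; [exact: YN_meas|exact: YN_meas|case: (YN_sqr N t)|case: (YN_sqr N s)].
have E w : (\sum_(i < n) YN N i.+1%:Z w) ^+ 2 =
    \sum_(i < n) \sum_(j < n) YN N i.+1%:Z w * YN N j.+1%:Z w.
  by rewrite expr2 mulr_suml; apply: eq_bigr => i _; rewrite mulr_sumr.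
split.
  apply: (eq_L1 (fun w => esym (E w))); apply: L1_sum => i _; apply: L1_sum => j _; exact: lp.
rewrite (eq_Ex P E) Ex_sum; last by move=> i _; apply: L1_sum => j _; exact: lp.
apply: (@le_trans _ _ (\sum_(i < n) (N.*2.*2.+1)%:R * CY)); last first.
  by rewrite sumr_const card_ord -mulrA [leRHS]mulr_natl.
apply: ler_sum => i _; rewrite Ex_sum; last by move=> j _; exact: lp.
apply: (@le_trans _ _ (\sum_(j < n) \sum_(k < N.*2.*2.+1) ((i + k)%N == (j + N.*2)%N)%:R * CY)).
  apply: ler_sum => j _; rewrite -mulr_suml.
  have [far|near_] := ltnP N.*2 `|(i.+1%:Z - j.+1%:Z)%R|.
    by rewrite YN_far// mulr_ge0// sumr_ge0.
  apply: (@le_trans _ _ CY).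
    have := @cauchy_schwarz _ _ _ P (YN N i.+1%:Z) (YN N j.+1%:Z) 1 ltr01 (@YN_meas _ _) (@YN_meas _ _)
      (YN_sqr N i.+1%:Z).1 (YN_sqr N j.+1%:Z).1.
    have := (YN_sqr N i.+1%:Z).2; have := (YN_sqr N j.+1%:Z).2.
    have := Ex_abs (lp i.+1%:Z j.+1%:Z); have := ler_norm (Ex P (fun w => YN N i.+1%:Z w * YN N j.+1%:Z w)).
    rewrite mul1r divr1; lra.
  have h : (j + N.*2 - i < N.*2.*2.+1)%N by lia.
  rewrite (bigD1 (Ordinal h))//= (_ : (_ == _) = true) /=; last by apply/eqP; lia.
  by rewrite mulrDl mul1r lerDl mulr_ge0// sumr_ge0.
rewrite exchange_big /= [leRHS]mulr_natl -[X in _ *+ X](card_ord N.*2.*2.+1) -sumr_const.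
apply: ler_sum => k _; rewrite -mulr_suml ler_piMl//.
apply: (@sum_at_most_one n (fun j => (i + k == j + N.*2)%N)) => a b /eqP h1 /eqP h2; lia.
Qed.

Lemma YN_sum_abs N n : Ex P (fun w => `|\sum_(i < n) YN N i.+1%:Z w|) <=
  Num.sqrt (n%:R * (N.*2.*2.+1)%:R * CY).
Proof.
have [l b] := YN_sum_sqr N n.
have m : measurable_fun setT (fun w => \sum_(i < n) YN N i.+1%:Z w).
  by apply: measurable_sum => i; exact: YN_meas.
by apply: (le_trans (Ex_abs_sqrt m l)); rewrite ler_wsqrtr.
Qed.

Lemma e_eN_sqr_diff N t c : 0 < c ->
  L1 P (fun w => `|e t w ^+ 2 - eN N t w ^+ 2|) /\
  Ex P (fun w => `|e t w ^+ 2 - eN N t w ^+ 2|) <= (c * (4 * g0) + (g0 - gN 0 N) / c) / 2.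
Proof.
move=> c0.
have mN := @eN_meas N t.
have mD : measurable_fun setT (fun w => e t w - eN N t w) by exact: measurable_funB.
have mS : measurable_fun setT (fun w => e t w + eN N t w) by exact: measurable_funD.
have lS : L1 P (fun w => (e t w + eN N t w) ^+ 2).
  by apply: L2D => //; [exact: e_L2|exact: eN_L2].
have [lD bD] := e_diff N t.
split; first by apply: L1_abs; apply: L1B; [exact: e_L2|exact: eN_L2].
rewrite (@eq_Ex _ _ _ _ _ (fun w => `|(e t w + eN N t w) * (e t w - eN N t w)|)); last first.
  by move=> w; rewrite mulrC -subr_sqr.
apply: (le_trans (cauchy_schwarz c0 mS mD lS lD)).
have bS : Ex P (fun w => (e t w + eN N t w) ^+ 2) <= 4 * g0.
  have l2 : L1 P (fun w => 2 * e t w ^+ 2 + 2 * eN N t w ^+ 2).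
    by apply: L1D; apply: L1Z; [exact: e_L2|exact: eN_L2].
  apply: (le_trans (Ex_le lS l2 _)).
    by move=> w; have := sqr_ge0 (e t w - eN N t w); lra.
  rewrite ExD; [|exact/L1Z/e_L2|exact/L1Z/eN_L2].
  rewrite (ExZ _ (e_L2 t)) (ExZ _ (eN_L2 N t)) e_sqr eN_sqr gN0; have := gN_le0 N; lra.
rewrite ler_pM2r//; apply: lerD; first by rewrite ler_pM2l.
by rewrite ler_pM2r ?invr_gt0.
Qed.

(** The window [N] is fixed before [n]. The error then splits into the replacement of [e^2] by
    [eN^2], small in mean uniformly in [n]; the sum of centred truncated squares, of order [n^(1/2)]
    by finite-range dependence; and the bias [g0 - gN 0 N]. *)
Lemma e_lln eps : 0 < eps -> \forall n \near \oo,
  Ex P (fun w => `|(\sum_(i < n) e i.+1%:Z w ^+ 2) / n%:R - g0|) <= eps.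
Proof.
move=> e0; have g00 := g0_ge0.
(* This weight makes the part of the replacement error that carries [4 * g0] at most [eps / 4]; [k]
   then takes care of the part divided by [c]. *)
pose c := eps / (8 * (g0 + 1)).
have c0 : 0 < c by rewrite divr_gt0// mulr_gt0// ltr_wpDl.
have h1 : c * (4 * g0) / 2 <= eps / 4.
  have : c * (8 * (g0 + 1)) = eps by rewrite divfK// gt_eqF// mulr_gt0// ltr_wpDl.
  by nra.
pose k := Num.min (eps / 4) (c * (eps / 4)).
have e4 : 0 < eps / 4 by rewrite divr_gt0.
have k0 : 0 < k by rewrite lt_min e4 mulr_gt0.
move/cvgrPdist_le : cg0 => /(_ _ k0) [N _ /(_ N (leqnn N)) hN].
have gk : g0 - gN 0 N <= k by rewrite gN0; exact: le_trans (ler_norm _) hN.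
have gk1 : g0 - gN 0 N <= eps / 4 by apply: (le_trans gk); rewrite ge_min lexx.
have gk2 : (g0 - gN 0 N) / c <= eps / 4.
  by rewrite ler_pdivrMr// mulrC; apply: (le_trans gk); rewrite ge_min lexx orbT.
have gge : 0 <= g0 - gN 0 N by rewrite subr_ge0 gN0 gN_le0.
set a := (N.*2.*2.+1)%:R * CY.
have [n0 hn0] : exists n0 : nat, a / (eps / 4) ^+ 2 <= n0%:R.
  by exists (Num.truncn (a / (eps / 4) ^+ 2)).+1; exact/ltW/truncnS_gt.
exists (maxn 1 n0) => // n /=; rewrite geq_max => /andP[n1 nn0].
have np : 0 < n%:R :> R by rewrite ltr0n.
pose f1 w := n%:R^-1 * \sum_(i < n) `|e i.+1%:Z w ^+ 2 - eN N i.+1%:Z w ^+ 2|.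
pose f2 w := n%:R^-1 * `|\sum_(i < n) YN N i.+1%:Z w|.
have lf1 : L1 P f1 by apply: L1Z; apply: L1_sum => i _; case: (e_eN_sqr_diff N i.+1%:Z c0).
have lY : L1 P (fun w => \sum_(i < n) YN N i.+1%:Z w).
  by apply: L1_sum => i _; apply: L1B; [exact: eN_L2|exact: L1_cst].
have lf2 : L1 P f2 by apply: L1Z; exact: L1_abs.
have le2 : L1 P (fun w => (\sum_(i < n) e i.+1%:Z w ^+ 2) / n%:R - g0).
  apply: L1B; last exact: L1_cst.
  apply: (eq_L1 (f := fun w => n%:R^-1 * \sum_(i < n) e i.+1%:Z w ^+ 2)).
    by move=> w; rewrite mulrC.
  by apply: L1Z; apply: L1_sum => i _; exact: e_L2.
apply: (@le_trans _ _ (Ex P (fun w => f1 w + f2 w + (g0 - gN 0 N)))).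
  apply: Ex_le; first exact: L1_abs.
    by apply: L1D; [exact: L1D|exact: L1_cst].
  move=> w; rewrite (_ : _ - g0 = n%:R^-1 * (\sum_(i < n) (e i.+1%:Z w ^+ 2 - eN N i.+1%:Z w ^+ 2)) +
     n%:R^-1 * (\sum_(i < n) YN N i.+1%:Z w) - (g0 - gN 0 N)).
    apply: (le_trans (ler_normB _ _)); rewrite [`|g0 - _|]ger0_norm// lerD2r.
    apply: (le_trans (ler_normD _ _)); apply: lerD.
      rewrite normrM gtr0_norm ?invr_gt0// ler_pM2l ?invr_gt0//; exact: ler_norm_sum.
    by rewrite normrM gtr0_norm ?invr_gt0.
  rewrite -mulrDr -big_split /= [X in _ = _ * X - _](eq_bigr (fun i : 'I_n => e i.+1%:Z w ^+ 2 - gN 0 N)); last first.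
    by move=> i _; rewrite /YN addrA subrK.
  rewrite sumrB sumr_const card_ord -[gN 0 N *+ n]mulr_natr; field.
  by rewrite gt_eqF.
rewrite ExD; [|exact: L1D|exact: L1_cst].
rewrite Ex_cst ExD//.
have b1 : Ex P f1 <= eps / 4 + eps / 8.
  rewrite ExZ; last by apply: L1_sum => i _; case: (e_eN_sqr_diff N i.+1%:Z c0).
  rewrite Ex_sum; last by move=> i _; case: (e_eN_sqr_diff N i.+1%:Z c0).
  rewrite mulrC ler_pdivrMr//.
  apply: (@le_trans _ _ (\sum_(i < n) (c * (4 * g0) + (g0 - gN 0 N) / c) / 2)).
    by apply: ler_sum => i _; case: (e_eN_sqr_diff N i.+1%:Z c0).
  rewrite sumr_const card_ord -[_ *+ n]mulr_natr ler_pM2r//; lra.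
have b2 : Ex P f2 <= eps / 4.
  rewrite ExZ; last exact: L1_abs.
  rewrite mulrC ler_pdivrMr//; apply: (le_trans (YN_sum_abs N n)).
  rewrite -mulrA -/a -[leRHS]ger0_norm; last by rewrite mulr_ge0 ?divr_ge0// ltW.
  rewrite -sqrtr_sqr ler_wsqrtr// exprMn [n%:R * a]mulrC [n%:R ^+ 2]expr2 mulrA ler_pM2r//.
  have e42 : 0 < (eps / 4) ^+ 2 by rewrite exprn_gt0.
  by rewrite mulrC -ler_pdivrMr// (le_trans hn0)// ler_nat.
lra.
Qed.

(** * Partial sums of the errors as weighted sums of innovations *)

Definition psiN N j : R := if (`|j| <= N)%N then psi j else 0.

(** The sum over lags becomes a sum over innovations; cutting the coefficients to the window lets
    one range [L] serve all the times [t] of a partial sum. *)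
Lemma eN_reindex N L t w : (N + `|t| <= L)%N ->
  eN N t w = ssum (fun k => psiN N (t - k) * xi k w) L.
Proof.
move=> NL; rewrite /eN.
transitivity (\sum_(i < N.*2.+1) \sum_(k < L.*2.+1)
   psi (i%:Z - N%:Z) * xi (k%:Z - L%:Z) w * (k%:Z - L%:Z == t - (i%:Z - N%:Z))%:R).
  apply: eq_bigr => i _.
  have := ssum_delta (fun k => psi (i%:Z - N%:Z) * xi k w) L (t - (i%:Z - N%:Z)).
  by rewrite /ssum ifT//; have := ltn_ord i; lia.
rewrite exchange_big /=; apply: eq_bigr => k _; set k' := k%:Z - L%:Z.
have := ssum_delta (fun j => psi j * xi k' w) N (t - k'); rewrite /psiN.
rewrite (_ : (if _ then _ * xi k' w else 0) = (if (`|(t - k')%R| <= N)%N then psi (t - k') else 0) * xi k' w).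
  move=> <-; apply: eq_bigr => i _; congr (_ * _%:R).
  by congr nat_of_bool; apply/eqP/eqP; lia.
by case: ifP => // _; rewrite mul0r.
Qed.

Lemma psiN_sum_sqr N n k : \sum_(t < n) psiN N (t.+1%:Z - k) ^+ 2 <= g0.
Proof.
apply: le_trans (gN_le0 N).
have -> : \sum_(t < n) psiN N (t.+1%:Z - k) ^+ 2 =
    \sum_(t < n) \sum_(i < N.*2.+1) psi (i%:Z - N%:Z) ^+ 2 * (i%:Z - N%:Z == t.+1%:Z - k)%:R.
  apply: eq_bigr => t _; have := ssum_delta (fun j => psi j ^+ 2) N (t.+1%:Z - k).
  rewrite /ssum => ->; rewrite /psiN; case: ifP => // _; by rewrite expr0n.
rewrite exchange_big /=; apply: ler_sum => i _; rewrite -mulr_sumr.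
rewrite ler_piMr ?sqr_ge0//.
apply: (@sum_at_most_one n (fun t => i%:Z - N%:Z == t.+1%:Z - k)) => a b /eqP h1 /eqP h2; lia.
Qed.

Lemma sqr_sum_le (n : nat) (x : nat -> R) : (\sum_(i < n) x i) ^+ 2 <= n%:R * \sum_(i < n) x i ^+ 2.
Proof.
elim: n => [|n IH]; first by rewrite !big_ord0 expr0n mulr0.
rewrite !big_ord_recr /=.
have h : 0 <= \sum_(i < n) (x i - x n) ^+ 2 by apply: sumr_ge0 => i _; exact: sqr_ge0.
have : \sum_(i < n) (x i - x n) ^+ 2 =
    \sum_(i < n) x i ^+ 2 - 2 * x n * \sum_(i < n) x i + n%:R * x n ^+ 2.
  have -> : n%:R * x n ^+ 2 = \sum_(i < n) x n ^+ 2 by rewrite sumr_const card_ord mulr_natl.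
  by rewrite mulr_sumr -sumrB -big_split /=; apply: eq_bigr => i _; ring.
rewrite -natr1 => E; rewrite E in h; move: IH h.
set S := \sum_(i < n) x i; set Q := \sum_(i < n) x i ^+ 2 => IH h; lra.
Qed.

Definition An n w := \sum_(i < n) e i.+1%:Z w.
Definition AN N n w := \sum_(i < n) eN N i.+1%:Z w.
(** The total weight that the truncated partial sum gives to one innovation, with a shift by [N + n]
    so that the indices start at 0. *)
Definition bN N n (i : nat) : R := \sum_(t < n) psiN N (t.+1%:Z - (i%:Z - (N + n)%N%:Z)).
Let io' N n (i : nat) : int := i%:Z - (N + n)%N%:Z.

Let io'_inj N n : injective (io' N n).
Proof. by move=> i j; rewrite /io'; lia. Qed.

Lemma AN_lform N n w : AN N n w = lform (io' N n) (bN N n) (N + n).*2.+1 w.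
Proof.
rewrite /AN /lform /bN.
under [RHS]eq_bigr do rewrite mulr_suml.
rewrite [RHS]exchange_big /=; apply: eq_bigr => t _.
by rewrite (@eN_reindex N (N + n))//; have := ltn_ord t; lia.
Qed.

(** Cauchy-Schwarz over the [n] coefficients that enter one weight. The variance of the partial sum
    will be of order [n^(2 - alpha)], larger than [n g0], so no single innovation dominates. *)
Lemma bN_le N n i : bN N n i ^+ 2 <= n%:R * g0.
Proof.
rewrite /bN; apply: (le_trans (sqr_sum_le n (fun t => psiN N (t.+1%:Z - (i%:Z - (N + n)%N%:Z))))).
by rewrite ler_wpM2l//; exact: psiN_sum_sqr.
Qed.

Lemma An_meas n : measurable_fun setT (An n).
Proof. by apply: measurable_sum => i. Qed.

Lemma AN_meas N n : measurable_fun setT (AN N n).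
Proof. by apply: measurable_sum => i; exact: eN_meas. Qed.

Lemma An_L2 n : L1 P (fun w => An n w ^+ 2).
Proof.
elim: n => [|n IH]; first by apply: (eq_L1 _ (L1_cst P 0)) => w; rewrite /An big_ord0 expr0n.
apply: (eq_L1 _ (L2D (@An_meas n) (measurable_funP (e n.+1%:Z)) IH (e_L2 n.+1%:Z))) => w.
by rewrite /An big_ord_recr.
Qed.

Lemma AN_L2 N n : L1 P (fun w => AN N n w ^+ 2).
Proof.
elim: n => [|n IH]; first by apply: (eq_L1 _ (L1_cst P 0)) => w; rewrite /AN big_ord0 expr0n.
apply: (eq_L1 _ (L2D (@AN_meas N n) (@eN_meas N n.+1%:Z) IH (eN_L2 N n.+1%:Z))) => w.
by rewrite /AN big_ord_recr.
Qed.

(** The factor [n^2] is harmless: [N] tends to infinity while [n] stays fixed. *)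
Lemma An_diff N n : L1 P (fun w => (An n w - AN N n w) ^+ 2) /\
  Ex P (fun w => (An n w - AN N n w) ^+ 2) <= n%:R ^+ 2 * (g0 - gN 0 N).
Proof.
have l : L1 P (fun w => n%:R * \sum_(i < n) (e i.+1%:Z w - eN N i.+1%:Z w) ^+ 2).
  by apply: L1Z; apply: L1_sum => i _; case: (e_diff N i.+1%:Z).
have b w : (An n w - AN N n w) ^+ 2 <= n%:R * \sum_(i < n) (e i.+1%:Z w - eN N i.+1%:Z w) ^+ 2.
  rewrite /An /AN -sumrB; exact: (sqr_sum_le n (fun i => e i.+1%:Z w - eN N i.+1%:Z w)).
have l2 : L1 P (fun w => (An n w - AN N n w) ^+ 2).
  apply: (L1_dom _ _ l); last by move=> w; rewrite ger0_norm ?sqr_ge0.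
  by apply: measurable_funX; apply: measurable_funB; [exact: An_meas|exact: AN_meas].
split => //; apply: (le_trans (Ex_le l2 l b)).
rewrite ExZ; last by apply: L1_sum => i _; case: (e_diff N i.+1%:Z).
rewrite Ex_sum; last by move=> i _; case: (e_diff N i.+1%:Z).
rewrite expr2 -mulrA ler_wpM2l//.
apply: (@le_trans _ _ (\sum_(i < n) (g0 - gN 0 N))).
  by apply: ler_sum => i _; case: (e_diff N i.+1%:Z).
by rewrite sumr_const card_ord mulr_natl.
Qed.

Lemma An_diff_cvg n : Ex P (fun w => (An n w - AN N n w) ^+ 2) @[N --> \oo] --> (0:R).
Proof.
apply: (@squeeze_cvgr _ _ _ _ (cst 0) (fun N => n%:R ^+ 2 * (g0 - gN 0 N))).
- apply: nearW => N; apply/andP; split; first by apply: Ex_ge0 => w; exact: sqr_ge0.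
  by have [] := An_diff N n.
- exact: cvg_cst.
- rewrite [X in _ --> X](_ : _ = n%:R ^+ 2 * 0 :> R); last by rewrite mulr0.
  apply: (@cvgM _ _ _ _ (fun=> n%:R ^+ 2)); first exact: cvg_cst.
  rewrite -(subrr g0); apply: cvgB; first exact: cvg_cst.
  have -> : gN 0 = (fun N => ssum (fun j => psi j ^+ 2) N) by apply/funext => N; exact: gN0.
  exact: cg0.
Qed.

Lemma An_sqr_rec n : Ex P (fun w => An n.+1 w ^+ 2) =
  Ex P (fun w => An n w ^+ 2) + g0 + 2 * \sum_(i < n) gam psi i.+1%:Z.
Proof.
have le i : L1 P (fun w => e i w * e n.+1%:Z w) by apply: L2_mul => //; exact: e_L2.
have lp : L1 P (fun w => An n w * e n.+1%:Z w).
  apply: (eq_L1 (f := fun w => \sum_(i < n) e i.+1%:Z w * e n.+1%:Z w)).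
    by move=> w; rewrite /An mulr_suml.
  by apply: L1_sum => i _; exact: le.
have ep : Ex P (fun w => An n w * e n.+1%:Z w) = \sum_(i < n) gam psi i.+1%:Z.
  rewrite (@eq_Ex _ _ _ _ _ (fun w => \sum_(i < n) e i.+1%:Z w * e n.+1%:Z w)); last first.
    by move=> w; rewrite /An mulr_suml.
  rewrite Ex_sum; last by move=> i _; exact: le.
  rewrite (reindex_inj rev_ord_inj) /=; apply: eq_bigr => i _.
  by rewrite e_cov; congr gam; have := ltn_ord i; lia.
rewrite (@eq_Ex _ _ _ _ _ (fun w => An n w ^+ 2 + 2 * (An n w * e n.+1%:Z w) + e n.+1%:Z w ^+ 2)).
  rewrite ExD; [|by apply: L1D; [exact: An_L2|exact: L1Z]|exact: e_L2].
  rewrite ExD; [|exact: An_L2|exact: L1Z].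
  by rewrite ExZ// ep e_sqr addrAC.
by move=> w; rewrite /An big_ord_recr /=; ring.
Qed.

Lemma AN_sqr_cvg n : Ex P (fun w => AN N n w ^+ 2) @[N --> \oo] --> Ex P (fun w => An n w ^+ 2).
Proof.
have cp : Ex P (fun w => An n w * AN N n w) @[N --> \oo] --> Ex P (fun w => An n w * An n w).
  apply: L2_cvg_prod.
  - exact: An_meas.
  - exact: An_meas.
  - by move=> N; exact: AN_meas.
  - exact: An_L2.
  - exact: An_L2.
  - by move=> N; exact: AN_L2.
  - by move=> N; case: (An_diff N n).
  - exact: An_diff_cvg.
have E N : Ex P (fun w => AN N n w ^+ 2) = Ex P (fun w => (An n w - AN N n w) ^+ 2) +
    2 * Ex P (fun w => An n w * AN N n w) - Ex P (fun w => An n w ^+ 2).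
  have lp : L1 P (fun w => An n w * AN N n w).
    by apply: L2_mul; [exact: An_meas|exact: AN_meas|exact: An_L2|exact: AN_L2].
  have [ld _] := An_diff N n.
  rewrite -ExZ// -ExD//; last exact: L1Z.
  rewrite -ExB; [|by apply: L1D => //; exact: L1Z|exact: An_L2].
  by apply: eq_Ex => w; ring.
have -> : (fun N => Ex P (fun w => AN N n w ^+ 2)) = (fun N => Ex P (fun w => (An n w - AN N n w) ^+ 2) +
    2 * Ex P (fun w => An n w * AN N n w) - Ex P (fun w => An n w ^+ 2)) by exact/funext.
rewrite [X in _ --> X](_ : _ = 0 + 2 * Ex P (fun w => An n w * An n w) - Ex P (fun w => An n w ^+ 2)).
  apply: cvgB; last exact: cvg_cst.
  by apply: cvgD; [exact: An_diff_cvg|apply: cvgM => //; exact: cvg_cst].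
rewrite (@eq_Ex _ _ _ _ (fun w => An n w * An n w) (fun w => An n w ^+ 2)); first by ring.
by move=> w; rewrite expr2.
Qed.

(** For independent summands the conditional variance is constant, so [delta = 0]. In the cubic
    terms one factor [|b i|] is bounded uniformly and the remaining squares add up to the
    variance. *)
Lemma AN_lindeberg N n s B phi phi1 phi2 : 0 < s -> smooth3 B phi phi1 phi2 ->
  `|Ex P (fun w => phi (AN N n w / s)) - Gs (Ex P (fun w => AN N n w ^+ 2) / s ^+ 2) phi 0| <=
  B * ((xi3 + gauss3) * (Num.sqrt (n%:R * g0) / s) * (Ex P (fun w => AN N n w ^+ 2) / s ^+ 2)).
Proof.
move=> s0 sm; have B0 : 0 <= B by exact: le_trans (normr_ge0 _) (sm_b1 sm 0).
set L := (N + n).*2.+1; pose b i := bN N n i / s.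
pose D i w := b i * xi (io' N n i) w.
have mD i : measurable_fun setT (D i) by exact: measurable_funM.
have lD i : L1 P (D i) by apply: L1Z; exact: xi_L1.
have mlin i : measurable_fun setT (fun x : R => b i * x) by exact: measurable_funM.
have l3 i : L1 P (fun w => `|D i w| ^+ 3) /\ Ex P (fun w => `|D i w| ^+ 3) = `|b i| ^+ 3 * xi3.
  have [l E] := xi_abs3 (io' N n i).
  have h w : `|D i w| ^+ 3 = `|b i| ^+ 3 * `|xi (io' N n i) w| ^+ 3 by rewrite normrM exprMn.
  split; first by apply: (eq_L1 (fun w => esym (h w))); exact: L1Z.
  by rewrite (eq_Ex P h) ExZ// E.
have D2 i : L1 P (fun w => D i w ^+ 2) /\ Ex P (fun w => D i w ^+ 2) = b i ^+ 2.
  have h w : D i w ^+ 2 = b i ^+ 2 * xi (io' N n i) w ^+ 2 by rewrite exprMn.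
  have l2 := @xi_L (io' N n i) 2 isT.
  split; first by apply: (eq_L1 (fun w => esym (h w))); exact: L1Z.
  by rewrite (eq_Ex P h) ExZ// xi_sqr mulr1.
have adS k (g : R -> R) : measurable_fun setT g ->
    adapted xi (firsts (io' N n) k) (fun w => g (\sum_(i < k) D i w)).
  move=> mg; apply: (measurableT_comp mg); apply: measurable_sum => i.
  apply: (@adapted_comp _ _ _ _ _ xi _ _ (fun x => b i * x)) => //; exact: firsts_mem.
have lg k (g : R -> R) C : measurable_fun setT g -> (forall x, `|g x| <= C) ->
    L1 P (fun w => g (\sum_(i < k) D i w)).
  by move=> mg bg; apply: (@L1_bnd _ _ _ _ _ C) => //; exact: (adapted_meas (adS k g mg)).
have h1 k (g : R -> R) C : measurable_fun setT g -> (forall x, `|g x| <= C) ->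
    Ex P (fun w => g (\sum_(i < k) D i w) * D k w) = 0.
  move=> mg bg.
  have aD : adapted xi (pred1 (io' N n k)) (D k).
    by apply: (@adapted_comp _ _ _ _ _ xi _ _ (fun x => b k * x)) => //=.
  have [|_ ->] := Ex_indep ixi _ (adS k g mg) aD (lg k g C mg bg) (lD k).
    exact: (firsts_disjoint (@io'_inj N n)).
  by rewrite (ExZ _ (xi_L1 _)) xi_mean !mulr0.
have h2 k (g : R -> R) C : measurable_fun setT g -> (forall x, `|g x| <= C) ->
    `|Ex P (fun w => g (\sum_(i < k) D i w) * (D k w ^+ 2 - b k ^+ 2))| <= C * 0.
  move=> mg bg.
  have aD : adapted xi (pred1 (io' N n k)) (fun w => D k w ^+ 2 - b k ^+ 2).
    apply: (@adapted_comp _ _ _ _ _ xi _ _ (fun x => (b k * x) ^+ 2 - b k ^+ 2)) => //=.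
    by apply: measurable_funB => //; exact: measurable_funX.
  have lDk : L1 P (fun w => D k w ^+ 2 - b k ^+ 2).
    by apply: L1B; [case: (D2 k)|exact: L1_cst].
  have [|_ ->] := Ex_indep ixi _ (adS k g mg) aD (lg k g C mg bg) lDk.
    exact: (firsts_disjoint (@io'_inj N n)).
  rewrite ExB; [|by case: (D2 k)|exact: L1_cst].
  by rewrite Ex_cst (D2 k).2 subrr !mulr0 normr0.
have Li := @lindeberg _ _ _ P D (fun i => b i ^+ 2) (fun=> 0) mD (fun i => sqr_ge0 (b i))
  (fun i => (l3 i).1) h1 h2 L _ _ _ _ sm.
have ES : Ex P (fun w => AN N n w ^+ 2) / s ^+ 2 = \sum_(i < L) b i ^+ 2.
  rewrite (@eq_Ex _ _ _ _ _ (fun w => lform (io' N n) (bN N n) L w ^+ 2)); last first.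
    by move=> w; rewrite AN_lform.
  rewrite (lform_sqr (bN N n) (@io'_inj N n) L) mulr_suml; apply: eq_bigr => i _.
  by rewrite /b exprMn exprVn.
have EA w : AN N n w / s = \sum_(i < L) D i w.
  rewrite AN_lform /lform mulr_suml; apply: eq_bigr => i _; by rewrite /D /b mulrAC.
rewrite (@eq_Ex _ _ _ _ _ (fun w => phi (\sum_(i < L) D i w))); last by move=> w; rewrite EA.
rewrite ES; apply: (le_trans Li); rewrite ler_wpM2l// mulr_sumr; apply: ler_sum => i _.
rewrite mul0r add0r (l3 i).2 sqrtr_sqr.
have bb : `|b i| <= Num.sqrt (n%:R * g0) / s.
  rewrite normrM [`|s^-1|]gtr0_norm ?invr_gt0// ler_pM2r ?invr_gt0// -sqrtr_sqr.
  by rewrite ler_wsqrtr// bN_le.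
have g3 := @gauss3_ge0 R; have x3 : 0 <= xi3 by apply: Ex_ge0 => w; exact: exprn_ge0.
rewrite -(real_normK (num_real (b i))) exprS.
have := mulr_ge0 (addr_ge0 x3 g3) (exprn_ge0 2 (normr_ge0 (b i))).
nra.
Qed.

(** The estimate for [AN] sees the window only through the scaled variance [V N], which tends to 1;
    so [N] goes to infinity in the inequality [key] and the window disappears. *)
Theorem An_clt_bound n s B phi phi1 phi2 : 0 < s -> s ^+ 2 = Ex P (fun w => An n w ^+ 2) ->
  smooth3 B phi phi1 phi2 ->
  `|Ex P (fun w => phi (An n w / s)) - Gs 1 phi 0| <=
  B * ((xi3 + gauss3) * (Num.sqrt (n%:R * g0) / s)).
Proof.
move=> s0 s2 sm; have B0 : 0 <= B by exact: le_trans (normr_ge0 _) (sm_b1 sm 0).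
set C := (xi3 + gauss3) * _; pose V N := Ex P (fun w => AN N n w ^+ 2) / s ^+ 2.
pose q N := Num.sqrt (Ex P (fun w => (An n w - AN N n w) ^+ 2)).
have cV : V N @[N --> \oo] --> (1:R).
  rewrite -(@divff _ (s ^+ 2)); last by rewrite expf_neq0// gt_eqF.
  apply: cvgM; last exact: cvg_cst.
  by rewrite {1}s2; exact: AN_sqr_cvg.
have cq : q N @[N --> \oo] --> (0:R).
  rewrite -sqrtr0; apply: (continuous_cvg _ (@sqrt_continuous _ _)); exact: An_diff_cvg.
have lphi (X : T -> R) : measurable_fun setT X -> L1 P (fun w => phi (X w / s)).
  move=> mX; apply: (@L1_bnd _ _ _ _ _ 1); last by move=> w; exact: sm_bnd sm.
  by apply: (measurableT_comp (sm_m sm)); exact: measurable_funM.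
have key N : `|Ex P (fun w => phi (An n w / s)) - Gs 1 phi 0| <=
   (3 * B + 1) / s * q N + B * (C * V N) + (3 * B + 1) * `|V N - 1|.
  have V0 : 0 <= V N by rewrite divr_ge0 ?sqr_ge0//; apply: Ex_ge0 => w; exact: sqr_ge0.
  have a1 := AN_lindeberg N n s0 sm; have a2 := Gs_near1 sm V0.
  have a3 : `|Ex P (fun w => phi (An n w / s)) - Ex P (fun w => phi (AN N n w / s))| <= (3 * B + 1) / s * q N.
    have [ld _] := An_diff N n.
    have md : measurable_fun setT (fun w => An n w - AN N n w).
      by apply: measurable_funB; [exact: An_meas|exact: AN_meas].
    have lA : L1 P (fun w => An n w - AN N n w).
      apply: (L1_dom md _ (L1D (L1_cst P 1) ld)) => w; rewrite -(real_normK (num_real (An n w - AN N n w))).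
      by have := sqr_ge0 (`|An n w - AN N n w| - 1); have := sqr_ge0 `|An n w - AN N n w|; lra.
    rewrite -ExB; [|apply: lphi; exact: An_meas|apply: lphi; exact: AN_meas].
    apply: (@le_trans _ _ (Ex P (fun w => (3 * B + 1) / s * `|An n w - AN N n w|))).
      apply: Ex_abs_le.
      - by apply: L1B; apply: lphi; [exact: An_meas|exact: AN_meas].
      - exact/L1Z/L1_abs.
      - move=> w; apply: (le_trans (smooth3_lip _ _ sm)).
        by rewrite -mulrBl normrM [`|s^-1|]gtr0_norm ?invr_gt0// mulrAC mulrA.
    rewrite ExZ; last exact: L1_abs.
    rewrite ler_wpM2l//; first by apply: divr_ge0; [rewrite addr_ge0// mulr_ge0|exact: ltW].
    exact: Ex_abs_sqrt.
  have -> : Ex P (fun w => phi (An n w / s)) - Gs 1 phi 0 =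
     (Ex P (fun w => phi (An n w / s)) - Ex P (fun w => phi (AN N n w / s))) +
     (Ex P (fun w => phi (AN N n w / s)) - Gs (V N) phi 0) + (Gs (V N) phi 0 - Gs 1 phi 0) by ring.
  apply: (le_trans (ler_normD _ _)); apply: lerD => //.
  by apply: (le_trans (ler_normD _ _)); apply: lerD.
have cR : (3 * B + 1) / s * q N + B * (C * V N) + (3 * B + 1) * `|V N - 1| @[N --> \oo] --> B * C.
  rewrite [X in _ --> X](_ : _ = (3 * B + 1) / s * 0 + B * (C * 1) + (3 * B + 1) * `|1 - 1|); last first.
    by rewrite subrr normr0 !mulr0 mulr1 add0r addr0.
  apply: cvgD; first apply: cvgD.
  - by apply: cvgM => //; exact: cvg_cst.
  - by apply: cvgM; [exact: cvg_cst|apply: cvgM => //; exact: cvg_cst].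
  - apply: cvgM; first exact: cvg_cst.
    by apply: cvg_norm; apply: cvgB => //; exact: cvg_cst.
rewrite -(cvg_lim _ cR)//; apply: limr_ge; first by apply/cvg_ex; exists (B * C).
by apply: nearW => N; exact: key.
Qed.

End linear_process.

(** * Growth of the variance of the partial sums *)

Section stolz.
Context {R : realType}.
Implicit Types (a b : nat -> R) (l : R).

(** Past a rank where the increment quotients are within [eps / 2] of [l], telescoping controls
    [a - l b] up to its value at that rank, which the growth of [b] absorbs. *)
Lemma stolz_cesaro a b l : (forall n, b n < b n.+1) -> b n @[n --> \oo] --> +oo ->
  ((a n.+1 - a n) / (b n.+1 - b n)) @[n --> \oo] --> l -> (a n / b n) @[n --> \oo] --> l.
Proof.
move=> bS boo c; apply/cvgrPdist_le => eps e0.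
have e2 : 0 < eps / 2 by rewrite divr_gt0.
move/cvgrPdist_le : c => /(_ _ e2) [N1 _ hN1].
have bge A : \forall n \near \oo, A <= b n by move/cvgryPge : boo; exact.
have [N2 _ hN2] := bge 1.
(* [N2] ensures that [b] is at least 1, hence positive, from this rank on. *)
pose N := maxn N1 N2.
have step k : `|a (N + k)%N - l * b (N + k)%N - (a N - l * b N)| <= eps / 2 * (b (N + k)%N - b N).
  elim: k => [|k IH]; first by rewrite addn0 !subrr normr0 mulr0.
  rewrite addnS; have d0 : 0 < b (N + k).+1 - b (N + k)%N by rewrite subr_gt0.
  have NN : (N1 <= N + k)%N by rewrite /N; lia.
  have h : `|l * (b (N + k).+1 - b (N + k)%N) - (a (N + k).+1 - a (N + k)%N)| <=
      eps / 2 * (b (N + k).+1 - b (N + k)%N).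
    have := hN1 _ NN; rewrite /= -(ler_pM2r d0); apply: le_trans.
    rewrite -[X in _ <= _ * X](gtr0_norm d0) -normrM mulrBl divfK ?gt_eqF//.
  have -> : a (N + k).+1 - l * b (N + k).+1 - (a N - l * b N) =
     - (l * (b (N + k).+1 - b (N + k)%N) - (a (N + k).+1 - a (N + k)%N)) +
     (a (N + k)%N - l * b (N + k)%N - (a N - l * b N)) by ring.
  apply: (le_trans (ler_normD _ _)); rewrite normrN; apply: (le_trans (lerD h IH)).
  by rewrite -mulrDr subrKA.
have [N3 _ hN3] := bge (`|a N - l * b N| / (eps / 2)).
exists (maxn N N3) => // n /=; rewrite geq_max => /andP[Nn N3n].
have bn1 : 1 <= b n by apply: hN2 => /=; apply: leq_trans Nn; rewrite leq_maxr.
have bn0 : 0 < b n by exact: lt_le_trans bn1.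
have bN1 : 1 <= b N by apply: hN2 => /=; rewrite leq_maxr.
have := step (n - N)%N; rewrite subnKC// => h.
have h3 : `|a N - l * b N| <= eps / 2 * b n by rewrite [leRHS]mulrC -ler_pdivrMr//; apply: hN3.
rewrite -(ler_pM2r bn0) -[X in _ * X <= _](gtr0_norm bn0) -normrM mulrBl divfK ?gt_eqF//.
have -> : l * b n - a n = - ((a n - l * b n - (a N - l * b N)) + (a N - l * b N)) by ring.
rewrite normrN; apply: (le_trans (ler_normD _ _)); apply: (le_trans (lerD h h3)).
nra.
Qed.

(** The increment behaves like the derivative [p n^(p - 1)]. With [y = 1 / n], the bounds
    [y / (1 + y) <= ln (1 + y) <= y] squeeze it between explicit functions; [n >= 2 p] keeps
    [1 - p y] positive. *)
Lemma powR_increment (p : R) : 0 < p ->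
  ((n.+1%:R `^ p - n%:R `^ p) / n%:R `^ (p - 1)) @[n --> \oo] --> p.
Proof.
move=> p0.
have cn : (n%:R^-1 : R) @[n --> \oo] --> 0 by rewrite -(cvg_shiftS (fun n : nat => n%:R^-1 : R)); exact: cvg_harmonic.
apply: (@squeeze_cvgr _ _ _ _ (fun n : nat => p / (1 + n%:R^-1)) (fun n : nat => p / (1 - p * n%:R^-1))).
- have hp : \forall n \near \oo, p * 2 <= n%:R :> R by exact: nbhs_infty_ger.
  near=> n.
  have n0 : 0 < n%:R :> R.
    have h : p * 2 <= n%:R by near: n.
    by apply: lt_le_trans h; rewrite mulr_gt0.
  set y := n%:R^-1; have y0 : 0 < y by rewrite invr_gt0.
  have py : p * y <= 1 / 2.
    have h : p * 2 <= n%:R by near: n.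
    by rewrite /y ler_pdivrMr//; lra.
  have -> : (n.+1%:R `^ p - n%:R `^ p) / n%:R `^ (p - 1) = ((1 + y) `^ p - 1) / y.
    have -> : n.+1%:R = n%:R * (1 + y) :> R by rewrite mulrDr mulr1 divff ?gt_eqF// -natr1.
    rewrite powRM ?addr_ge0 ?ltW// powRB; last by apply/implyP => _; rewrite gt_eqF.
    rewrite powRr1 ?ltW// /y invf_div.
    by field; rewrite !gt_eqF// powR_gt0.
  have y1 : 0 < 1 + y by rewrite addr_gt0.
  have E : (1 + y) `^ p = expR (p * ln (1 + y)) by rewrite /powR gt_eqF.
  have l1 : ln (1 + y) <= y by apply: le_ln1Dx; lra.
  have l2 : y / (1 + y) <= ln (1 + y).
    have : ln (1 + - (y / (1 + y))) <= - (y / (1 + y)).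
      by apply: le_ln1Dx; rewrite ltrN2 ltr_pdivrMr//; lra.
    have -> : 1 + - (y / (1 + y)) = (1 + y)^-1 by field; rewrite gt_eqF.
    by rewrite lnV ?posrE// lerN2.
  apply/andP; split.
    rewrite ler_pdivlMr//; have := expR_ge1Dx (p * ln (1 + y)); rewrite -E.
    have := ler_wpM2l (ltW p0) l2; rewrite mulrA [p * y / _]mulrAC; lra.
  rewrite ler_pdivrMr// E.
  have q0 : 0 < 1 - p * y by lra.
  have e1 : expR (p * ln (1 + y)) <= expR (p * y) by rewrite ler_expR ler_pM2l.
  have e2 := expR_ge1Dx (- (p * y)).
  have e3 : expR (p * y) * expR (- (p * y)) = 1 by rewrite -expRD subrr expR0.
  have e4 := expR_gt0 (p * y).
  have e5 : expR (p * y) * (1 - p * y) <= 1 by nra.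
  have e6 : expR (p * y) <= (1 - p * y)^-1 by rewrite -[leRHS]mul1r ler_pdivlMr.
  have -> : p / (1 - p * y) * y = (1 - p * y)^-1 - 1 by field; rewrite gt_eqF.
  lra.
- rewrite -[X in _ --> X]divr1; apply: cvgM; first exact: cvg_cst.
  apply: cvgV; first exact: oner_neq0.
  by rewrite -[X in _ --> X]addr0; apply: cvgD => //; exact: cvg_cst.
- rewrite -[X in _ --> X]divr1; apply: cvgM; first exact: cvg_cst.
  apply: cvgV; first exact: oner_neq0.
  rewrite -[X in _ --> X]subr0; apply: cvgB; first exact: cvg_cst.
  by rewrite -[X in _ --> X](mulr0 p); apply: cvgM => //; exact: cvg_cst.
Unshelve. all: by end_near. Qed.

Lemma powR_natS_lt (p : R) n : 0 < p -> n%:R `^ p < n.+1%:R `^ p :> R.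
Proof. by move=> p0; rewrite gt0_ltr_powR ?nnegrE// ltr_nat. Qed.

Lemma powR_nat_cvgy (p : R) : 0 < p -> (n%:R `^ p : R) @[n --> \oo] --> +oo.
Proof.
move=> p0; apply/cvgryPge => A.
have [A0|A0] := leP A 0; first by near=> n; rewrite (le_trans A0)// powR_ge0.
have h : \forall n \near \oo, A `^ p^-1 <= n%:R :> R by exact: nbhs_infty_ger.
near=> n.
have h1 : A `^ p^-1 <= n%:R by near: n.
have -> : A = (A `^ p^-1) `^ p by rewrite -powRrM mulVf ?gt_eqF// powRr1// ltW.
by rewrite ge0_ler_powR ?nnegrE ?powR_ge0// ltW.
Unshelve. all: by end_near. Qed.

(* two applications of Stolz-Cesaro, one for each summation *)
Lemma double_sum_growth (alpha eta g0 : R) (g c : nat -> R) : 0 < alpha < 1 -> 0 < eta ->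
  (g k / (eta * k%:R `^ (- alpha))) @[k --> \oo] --> (1:R) ->
  (forall n, c n.+1 = c n + g0 + 2 * \sum_(i < n) g i.+1) ->
  (c n / n%:R `^ (2 - alpha)) @[n --> \oo] --> 2 * eta / ((1 - alpha) * (2 - alpha)).
Proof.
move=> /andP[a0 a1] e0 cg cc.
have p1 : 0 < 1 - alpha by lra.
have p2 : 0 < 2 - alpha by lra.
pose G n := \sum_(i < n) g i.+1.
have pos n p : 0 < (n.+1)%:R `^ p :> R by apply: powR_gt0; rewrite ltr0n.
have inc (p : R) : 0 < p -> (n%:R `^ (p - 1) / (n.+1%:R `^ p - n%:R `^ p)) @[n --> \oo] --> p^-1.
  move=> p0.
  have -> : (fun n : nat => n%:R `^ (p - 1) / (n.+1%:R `^ p - n%:R `^ p)) =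
      (fun n : nat => ((n.+1%:R `^ p - n%:R `^ p) / n%:R `^ (p - 1))^-1).
    by apply/funext => n; rewrite invf_div.
  exact: cvgV (lt0r_neq0 p0) (powR_increment p0).
have cG : (G n / n%:R `^ (1 - alpha)) @[n --> \oo] --> eta / (1 - alpha).
  apply: stolz_cesaro; [by move=> n; exact: powR_natS_lt|exact: powR_nat_cvgy|].
  (* The increment of [G] is [g n.+1] and not [g n], so the powers at [n.+1] and [n] must be
     compared. *)
  have r : (n.+1%:R `^ (- alpha) / n%:R `^ (- alpha)) @[n --> \oo] --> (1:R).
    apply: (@squeeze_cvgr _ _ _ _ (fun n : nat => (1 + n%:R^-1)^-1) (fun=> 1)); last exact: cvg_cst.
      near=> n.
      have n0 : 0 < n%:R :> R by rewrite ltr0n; near: n; exact: nbhs_infty_gt.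
      have y0 : 0 < n%:R^-1 :> R by rewrite invr_gt0.
      have y1 : 0 <= 1 + n%:R^-1 :> R by rewrite addr_ge0// ltW.
      have -> : n.+1%:R `^ (- alpha) / n%:R `^ (- alpha) = (1 + n%:R^-1) `^ (- alpha) :> R.
        have -> : n.+1%:R = n%:R * (1 + n%:R^-1) :> R by rewrite mulrDr mulr1 divff ?gt_eqF// -natr1.
        by rewrite powRM// mulrAC divff ?mul1r// gt_eqF// powR_gt0.
      have b1 : 1 <= 1 + n%:R^-1 :> R by rewrite lerDl ltW.
      apply/andP; split.
        rewrite -(powR_inv1 y1).
        by apply: ler_powR => //; lra.
      by rewrite -[leRHS](powRr0 (1 + n%:R^-1)); apply: ler_powR => //; lra.
    rewrite -[X in _ --> X]invr1; apply: cvgV; first exact: oner_neq0.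
    rewrite -[X in _ --> X]addr0; apply: cvgD; first exact: cvg_cst.
    by rewrite -(cvg_shiftS (fun n : nat => n%:R^-1 : R)); exact: cvg_harmonic.
  have cg' : (g n.+1 / (eta * n.+1%:R `^ (- alpha))) @[n --> \oo] --> (1:R).
    by move: cg; rewrite -(cvg_shiftS (fun k : nat => g k / (eta * k%:R `^ (- alpha)))).
  have H : (g n.+1 / (eta * n.+1%:R `^ (- alpha)) * eta * (n.+1%:R `^ (- alpha) / n%:R `^ (- alpha)) *
      (n%:R `^ (1 - alpha - 1) / (n.+1%:R `^ (1 - alpha) - n%:R `^ (1 - alpha)))) @[n --> \oo] -->
      1 * eta * 1 * (1 - alpha)^-1.
    by apply: cvgM (inc _ p1); apply: cvgM r; apply: cvgM cg' _; exact: cvg_cst.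
  rewrite mul1r mulr1 in H; apply: cvg_trans H; apply: near_eq_cvg; near=> n.
  have n0 : 0 < n%:R :> R by rewrite ltr0n; near: n; exact: nbhs_infty_gt.
  have GS : G n.+1 - G n = g n.+1 by rewrite /G big_ord_recr /= addrAC subrr add0r.
  rewrite GS; have -> : 1 - alpha - 1 = - alpha by ring.
  have := pos n (- alpha); have := powR_gt0 (- alpha) n0; have := powR_natS_lt n p1.
  move=> h1 h2 h3.
  have h4 : n.+1%:R `^ (1 - alpha) - n%:R `^ (1 - alpha) != 0 by rewrite subr_eq0 gt_eqF.
  by field; rewrite h4 !gt_eqF.
apply: stolz_cesaro; [by move=> n; exact: powR_natS_lt|exact: powR_nat_cvgy|].
have z : ((n%:R `^ (1 - alpha))^-1 : R) @[n --> \oo] --> 0.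
  apply/gtr0_cvgV0; last exact: powR_nat_cvgy.
  by exists 1%N => // n /= n0; rewrite powR_gt0// ltr0n.
(* The constant [g0] is divided by [n^(1 - alpha)] and disappears in the limit. *)
have H : ((g0 * (n%:R `^ (1 - alpha))^-1 + 2 * (G n / n%:R `^ (1 - alpha))) *
    (n%:R `^ (2 - alpha - 1) / (n.+1%:R `^ (2 - alpha) - n%:R `^ (2 - alpha)))) @[n --> \oo] -->
    (g0 * 0 + 2 * (eta / (1 - alpha))) * (2 - alpha)^-1.
  by apply: cvgM (inc _ p2); apply: cvgD; apply: cvgM => //; exact: cvg_cst.
have EL : (g0 * 0 + 2 * (eta / (1 - alpha))) * (2 - alpha)^-1 = 2 * eta / ((1 - alpha) * (2 - alpha)).
  by field; rewrite !gt_eqF.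
rewrite EL in H; apply: cvg_trans H; apply: near_eq_cvg; near=> n.
have n0 : 0 < n%:R :> R by rewrite ltr0n; near: n; exact: nbhs_infty_gt.
have cS : c n.+1 - c n = g0 + 2 * G n by rewrite cc /G; ring.
rewrite cS; have -> : 2 - alpha - 1 = 1 - alpha by ring.
have h2 := powR_gt0 (1 - alpha) n0; have h1 := powR_natS_lt n p2.
have h4 : n.+1%:R `^ (2 - alpha) - n%:R `^ (2 - alpha) != 0 by rewrite subr_eq0 gt_eqF.
by field; rewrite h4 !gt_eqF.
Unshelve. all: by end_near. Qed.

End stolz.

(** * Kernel averages *)

Section kernel.
Context {d : measure_display} {T : measurableType d} {R : realType}.
Variable P : probability T R.
Local Notation mu := (@lebesgue_measure R).
Local Notation Rm := (measurableTypeR R).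
Variables (X : {RV P >-> R}) (f : R -> R) (M : R).
Hypothesis Xf : is_density P X f.
Hypothesis fM : forall x, `|f x| <= M.
Hypothesis f_unif : forall eps : R, 0 < eps -> exists2 delta : R, 0 < delta &
  forall x y, `|x - y| < delta -> `|f x - f y| < eps.

Let mf : measurable_fun setT (f : Rm -> R). Proof. by case: Xf. Qed.
Let f0 x : 0 <= f x. Proof. by case: Xf => _ []. Qed.
Let M0 : 0 <= M. Proof. exact: le_trans (normr_ge0 _) (fM 0). Qed.

Lemma integral_density (g : R -> R) : measurable_fun setT g -> (forall x, 0 <= g x) ->
  (\int[P]_w (g (X w))%:E = \int[mu]_x (g x * f x)%:E)%E.
Proof.
move=> mg g0.
have mX : measurable_fun setT (X : T -> Rm).
  by move=> _ A mA; rewrite setTI; exact: (measurable_funPTI X mA).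
pose X' : {mfun T >-> Rm} := HB.pack (X : T -> Rm) (isMeasurableFun.Build _ _ _ _ _ mX).
have mg' : measurable_fun setT (fun x : Rm => (g x)%:E) by apply/measurable_EFinP.
transitivity (\int[distribution P X']_x (g x)%:E)%E.
  by rewrite ge0_integral_distribution.
rewrite (@ge0_integral_density _ _ _ mu (distribution P X') f)//.
by case: Xf => _ [_ h] A mA; exact: h.
Qed.

Section one_kernel.
Variables (k : R -> R) (Mk : R).
Hypothesis mk : measurable_fun setT (k : Rm -> R).
Hypothesis k0 : forall x, 0 <= k x.
Hypothesis kM : forall x, k x <= Mk.
Hypothesis ik : mu.-integrable setT (EFin \o k).

Let Ik := lint k.

Let mkf h y : measurable_fun setT (fun u : Rm => k u * f (h * u + y)).
Proof.
apply: measurable_funM => //; apply: (measurableT_comp mf).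
by apply: measurable_funD => //; exact: measurable_funM.
Qed.

Let ikf h y : mu.-integrable setT (EFin \o (fun u => k u * f (h * u + y))).
Proof.
apply: (le_integrable _ _ _ (integrableZl measurableT M ik)) => //.
  by apply/measurable_EFinP; exact: mkf.
move=> u _ /=; rewrite lee_fin !normrM mulrC ler_wpM2r//.
by rewrite (ger0_norm M0).
Qed.

Definition kmean h y := Ex P (fun w => k ((X w - y) / h)).

Lemma kmean_L1 h y : L1 P (fun w => k ((X w - y) / h)).
Proof.
apply: (@L1_bnd _ _ _ _ _ Mk); last by move=> w; rewrite ger0_norm.
apply: (measurableT_comp mk); apply: measurable_funM => //.
exact: measurable_funB.
Qed.

Lemma kmeanE h y : 0 < h -> kmean h y = h * \int[mu]_u (k u * f (h * u + y)).
Proof.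
move=> h0; apply: EFin_inj; rewrite /kmean Ex_fin; last exact: kmean_L1.
rewrite (@integral_density (fun x => k ((x - y) / h))); last 2 first.
- by apply: (measurableT_comp mk); apply: measurable_funM => //; exact: measurable_funB.
- by move=> x.
have mg : measurable_fun setT (fun x : Rm => (k ((x - y) / h) * f x)%:E).
  apply/measurable_EFinP; apply: measurable_funM => //.
  by apply: (measurableT_comp mk); apply: measurable_funM => //; exact: measurable_funB.
have := @ge0_integral_affine R h y _ h0 mg (fun x => _); move=> /(_ _)/= ->; last first.
  by move=> x; rewrite lee_fin mulr_ge0.
rewrite EFinM /Rintegral fineK; last exact: (integrable_fin_num measurableT (ikf h y)).
congr (_ * _)%E; apply: eq_integral => u _ /=; congr (k _ * _)%:E.
by rewrite addrK mulrC mulKf// gt_eqF.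
Qed.

Lemma lint_ge0 : 0 <= Ik.
Proof. by rewrite /Ik /lint fine_ge0// integral_ge0// => x _; rewrite lee_fin. Qed.

Lemma kmean_bound h y : 0 < h -> 0 <= kmean h y <= h * (M * Ik).
Proof.
move=> h0; rewrite kmeanE//; apply/andP; split.
  by apply: mulr_ge0; [exact: ltW|apply: Rintegral_ge0 => u _; exact: mulr_ge0].
rewrite ler_pM2l// /Ik /lint -[fine _]/(Rintegral mu setT k) -RintegralZl//.
apply: le_Rintegral => //.
- exact: (integrableZl measurableT M ik).
- by move=> u _; rewrite mulrC ler_wpM2r//; exact: le_trans (ler_norm _) (fM _).
Qed.

Let tail (n : nat) : set Rm := [set u | n%:R <= `|u|].

Let mtail n : measurable (tail n).
Proof. by apply: measurable_ge_set; exact: normr_measurable. Qed.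

Let mkt n : measurable_fun setT (fun u : Rm => k u * \1_(tail n) u).
Proof. by apply: measurable_funM => //; exact: measurable_indic. Qed.

Let ikt n : mu.-integrable setT (EFin \o (fun u => k u * \1_(tail n) u)).
Proof.
apply: (le_integrable _ _ _ ik) => //; first by apply/measurable_EFinP; exact: mkt.
move=> u _ /=; rewrite lee_fin normrM ler_piMr// indicE.
by case: (_ \in _); rewrite ?normr1 ?normr0.
Qed.

Lemma kernel_tail eps : 0 < eps -> exists n, \int[mu]_u (k u * \1_(tail n) u) <= eps.
Proof.
move=> e0.
have h1 : {ae mu, forall u, setT u -> (EFin \o (fun u => k u * \1_(tail n) u)) u @[n --> \oo] --> (0%E : \bar R)}.
  apply: aeW => u _; apply: cvg_near_cst.
  have h : \forall n \near \oo, `|u| + 1 <= n%:R by exact: nbhs_infty_ger.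
  near=> n; have hn : `|u| + 1 <= n%:R by near: n.
  rewrite /= indicE memNset ?mulr0// /tail /=; lra.
have h2 : {ae mu, forall u (n : nat), setT u -> (`|(EFin \o (fun u => k u * \1_(tail n) u)%R) u| <= (EFin \o k) u)%E}.
  apply: aeW => u n _; rewrite /= lee_fin normrM ger0_norm// ler_piMr// indicE.
  by case: (_ \in _); rewrite ?normr1 ?normr0.
have mE n : measurable_fun setT (EFin \o (fun u : Rm => k u * \1_(tail n) u)) by apply/measurable_EFinP; exact: mkt.
have mz : measurable_fun setT (cst 0%E : Rm -> \bar R) by exact: measurable_cst.
have [_ _] := dominated_convergence measurableT mE mz h1 ik h2.
rewrite integral0 => /fine_cvg.
move/cvgrPdist_le => /(_ _ e0) [N _ /(_ N (leqnn N))].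
by rewrite /= sub0r normrN => h; exists N; exact: le_trans (ler_norm _) h.
Unshelve. all: by end_near. Qed.

(** The threshold [h0] does not depend on [y]. Inside [|u| < L] uniform continuity applies because
    [h L < delta]; outside, [f] is merely bounded and the kernel has little mass. *)
Lemma kmean_approx eps : 0 < eps -> exists2 h0 : R, 0 < h0 &
  forall h y, 0 < h < h0 -> `|kmean h y / h - f y * Ik| <= eps.
Proof.
move=> e0; have I0 := lint_ge0.
have e1 : 0 < eps / (2 * (Ik + 1)) by rewrite divr_gt0// mulr_gt0// ltr_wpDl.
have [delta d0 hd] := f_unif e1.
have e2 : 0 < eps / (4 * (M + 1)) by rewrite divr_gt0// mulr_gt0// ltr_wpDl.
have [L hL] := kernel_tail e2.
(* [L.+1] rather than [L], since [L] may be 0. *)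
exists (delta / L.+1%:R); first by rewrite divr_gt0.
move=> h y /andP[h0 hh].
have iB : mu.-integrable setT (EFin \o (fun u => f y * k u)) by exact: (integrableZl measurableT (f y) ik).
have i1 : mu.-integrable setT (EFin \o (fun u => eps / (2 * (Ik + 1)) * k u)).
  exact: (integrableZl measurableT _ ik).
have i2 : mu.-integrable setT (EFin \o (fun u => 2 * M * (k u * \1_(tail L) u))).
  exact: (integrableZl measurableT _ (ikt L)).
have i12 : mu.-integrable setT (EFin \o (fun u => eps / (2 * (Ik + 1)) * k u + 2 * M * (k u * \1_(tail L) u))).
  exact: (integrableD measurableT i1 i2).
have iD : mu.-integrable setT (EFin \o (fun u => k u * f (h * u + y) - f y * k u)).
  exact: (integrableB measurableT (ikf h y) iB).
have -> : kmean h y / h - f y * Ik = \int[mu]_u (k u * f (h * u + y) - f y * k u).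
  rewrite kmeanE// RintegralB//.
  rewrite RintegralZl// -[X in _ = _ - _ * X]/Ik; congr (_ - _).
  by rewrite mulrC mulKf// gt_eqF.
apply: (le_trans (le_normr_Rintegral measurableT iD)).
apply: (@le_trans _ _ (\int[mu]_u (eps / (2 * (Ik + 1)) * k u + 2 * M * (k u * \1_(tail L) u)))).
  apply: le_Rintegral => //; first exact: (integrable_norm iD).
  move=> u _; rewrite [f y * _]mulrC -mulrBr normrM (ger0_norm (k0 u)).
  rewrite indicE; case: (boolP (u \in tail L)) => [_|/negP nu].
    have : `|f (h * u + y) - f y| <= 2 * M.
      by apply: (le_trans (ler_normB _ _)); have := fM (h * u + y); have := fM y; lra.
    have q : 0 <= eps / (2 * (Ik + 1)) * k u by rewrite mulr_ge0// ltW.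
    by move=> b; rewrite mulr1; have := ler_wpM2l (k0 u) b; lra.
  rewrite mulr0 mulr0 addr0 mulrC ler_wpM2r// ltW// hd// addrK normrM gtr0_norm//.
  have uL : `|u| < L%:R by rewrite ltNge; apply/negP => uL; apply: nu; rewrite inE.
  have hh' : h * L.+1%:R < delta by rewrite -ltr_pdivlMr.
  apply: le_lt_trans hh'; rewrite ler_pM2l// (le_trans (ltW uL))// ler_nat//.
rewrite RintegralD// !RintegralZl//.
rewrite -[X in _ * X + _]/Ik.
have a1 : eps / (2 * (Ik + 1)) * Ik <= eps / 2.
  rewrite mulrAC ler_pdivrMr ?mulr_gt0 ?ltr_wpDl//; nra.
have a2 : 2 * M * \int[mu]_u (k u * \1_(tail L) u) <= eps / 2.
  apply: (le_trans (ler_wpM2l _ hL)); first by rewrite mulr_ge0.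
  rewrite mulrA ler_pdivrMr ?mulr_gt0 ?ltr_wpDl//; nra.
lra.
Qed.

End one_kernel.

Lemma Ex_density : L1 P (fun w => f (X w)) /\ Ex P (fun w => f (X w)) = lint (fun y => f y ^+ 2).
Proof.
have l : L1 P (fun w => f (X w)).
  apply: (@L1_bnd _ _ _ _ _ M) => //.
  by case: Xf => mf' _; exact: (measurableT_comp mf').
split => //; rewrite /lint /Ex /Rintegral; congr fine.
by rewrite integral_density//; apply: eq_integral => x _; rewrite expr2.
Qed.

(** The integral of [f^2] is the mean of [f (X)]. Were it zero, [f (X)] would vanish almost surely,
    whereas the zero set of [f] has probability 0 under the law with density [f]. *)
Lemma Ex_density_gt0 : 0 < lint (fun y => f y ^+ 2).
Proof.
have [l <-] := Ex_density; rewrite lt_neqAle Ex_ge0// andbT; apply/eqP => e0.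
have : (\int[P]_w (f (X w))%:E = 0)%E by rewrite -Ex_fin// -e0.
have mfX : measurable_fun setT (fun w => (f (X w))%:E) by apply/measurable_EFinP; exact: L1_meas l.
have := (ae_eq_integral_abs P measurableT mfX).1.
under eq_integral do rewrite gee0_abs ?lee_fin//.
move=> h /h [N [mN N0 hN]].
have mZ : measurable (f @^-1` [set 0] : set Rm).
  by rewrite -[X in measurable X]setTI; exact: mf.
have mXZ : measurable (X @^-1` (f @^-1` [set 0])) by exact: (measurable_funPTI X mZ).
have A0 : P (~` (X @^-1` (f @^-1` [set 0]))) = 0%E.
  apply/eqP; rewrite eq_le measure_ge0 andbT -N0; apply: le_measure; rewrite ?inE//.
    exact: measurableC.
  by move=> w /= fw; apply: hN => /= /(_ Logic.I) [] /fw.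
have B0 : P (X @^-1` (f @^-1` [set 0])) = 0%E.
  case: Xf => _ [_ ->//]; rewrite integral0_eq// => x /= -> //.
move: A0; rewrite probability_setC// B0 sube0 => /eqP; by rewrite onee_eq0.
Qed.

End kernel.

(** * Degenerate quadratic forms with fixed weights *)

Section degenerate.
Context {d : measure_display} {T : measurableType d} {R : realType}.
Variable P : probability T R.

Lemma Ex_param_measurable d' (A : measurableType d') (F : A -> T -> R) B :
  measurable_fun setT (fun z : A * T => F z.1 z.2) -> (forall a w, `|F a w| <= B) ->
  measurable_fun setT (fun a => Ex P (F a)).
Proof.
move=> mF bF.
pose F' (u : A * T) := (F u.1 u.2 + B)%:E.
have mF' : measurable_fun setT F' by apply/measurable_EFinP; exact: measurable_funD.
have F0 u : (0 <= F' u)%E.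
  by rewrite lee_fin; have := bF u.1 u.2; rewrite ler_norml => /andP[h _]; rewrite -lerBlDr sub0r.
have mG := measurable_fun_fubini_tonelli_F (m2 := P) _ mF' F0.
have lF a : L1 P (F a).
  apply: (@L1_bnd _ _ _ _ _ B) => //; exact: (measurable_fun_pair2 _ mF).
have -> : (fun a => Ex P (F a)) = (fun a => fine (fubini_F P F' a) - B).
  apply/funext => a; apply/esym; rewrite -[fine _]/(Ex P (fun w => F a w + B)).
  by rewrite ExD ?Ex_cst ?addrK//; exact: L1_cst.
apply: measurable_funB => //.
exact: (measurableT_comp (@fine_measurable R setT measurableT) mG).
Qed.

Lemma Ex_swap (F : T -> T -> R) B : measurable_fun setT (fun z : T * T => F z.1 z.2) ->
  (forall w w', `|F w w'| <= B) ->
  Ex P (fun w => Ex P (fun w' => F w w')) = Ex P (fun w' => Ex P (fun w => F w w')).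
Proof.
move=> mF bF.
have l1 w : L1 P (F w) by apply: (@L1_bnd _ _ _ _ _ B) => //; exact: (measurable_fun_pair2 _ mF).
have l2 w' : L1 P (F^~ w') by apply: (@L1_bnd _ _ _ _ _ B) => //; exact: (measurable_fun_pair1 _ mF).
have lE1 : L1 P (fun w => Ex P (F w)).
  apply: (@L1_bnd _ _ _ _ _ B); first exact: (Ex_param_measurable mF bF).
  by move=> w; exact: Ex_abs_le_cst.
have mF' : measurable_fun setT (fun z : T * T => F z.2 z.1) by exact: (measurableT_comp mF (@measurable_swap _ _ T T)).
have lE2 : L1 P (fun w' => Ex P (F^~ w')).
  apply: (@L1_bnd _ _ _ _ _ B); last by move=> w; exact: Ex_abs_le_cst.
  exact: (@Ex_param_measurable _ _ (fun w' w => F w w') B mF').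
have iF : (P \x P)%E.-integrable setT (EFin \o (fun z : T * T => F z.1 z.2)).
  apply/integrable12ltyP; first exact/measurable_EFinP.
  apply: (@le_lt_trans _ _ (\int[P]_w B%:E)%E).
    apply: ge0_le_integral => //.
    - by move=> w _; exact: integral_ge0.
    - apply: (measurable_fun_fubini_tonelli_F (m2 := P) (fun z => `|F z.1 z.2|%:E)) => //.
      by apply/measurable_EFinP; exact: measurableT_comp.
    - move=> w _; have lw := L1_abs (l1 w).
      by rewrite -(Ex_fin lw) lee_fin; apply: Ex_le_cst.
  by rewrite integral_cst// [X in (_ * X)%E]probability_setT mule1 ltry.
have := Fubini iF => h.
apply: EFin_inj; rewrite !Ex_fin//.
under eq_integral do rewrite Ex_fin//.
by rewrite h; apply: eq_integral => w _; rewrite Ex_fin.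
Qed.

Variable X : nat -> {RV P >-> R}.
Hypothesis iX : mutually_indep P (fun i => X i : T -> R).
Hypothesis idX : ident_distr P (fun i => X i : T -> R).

Definition before k : pred nat := fun i => (i < k)%N.

(* [F w y] depends on [w] only through [X 0], ..., [X k.-1] *)
Definition predictable k (F : T -> R -> R) :=
  measurable_fun setT (fun z : sgX X (before k) * R => F z.1 z.2) /\
  exists B, forall w y, `|F w y| <= B.

Lemma predictable_cst k c : predictable k (fun _ _ => c).
Proof. by split => //; exists `|c|. Qed.

Lemma predictableD k F G : predictable k F -> predictable k G -> predictable k (fun w y => F w y + G w y).
Proof.
move=> [mF [B bF]] [mG [C bG]]; split; first exact: measurable_funD.
by exists (B + C) => w y; apply: (le_trans (ler_normD _ _)); apply: lerD.
Qed.

Lemma predictableM k F G : predictable k F -> predictable k G -> predictable k (fun w y => F w y * G w y).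
Proof.
move=> [mF [B bF]] [mG [C bG]]; split; first exact: measurable_funM.
by exists (B * C) => w y; rewrite normrM ler_pM.
Qed.

Lemma predictableZ k c F : predictable k F -> predictable k (fun w y => c * F w y).
Proof. by move=> gF; apply: predictableM => //; exact: predictable_cst. Qed.

Lemma predictableX k n F : predictable k F -> predictable k (fun w y => F w y ^+ n).
Proof.
move=> [mF [B bF]]; split; first exact: measurable_funX.
by exists (B ^+ n) => w y; rewrite normrX lerXn2r// nnegrE (le_trans (normr_ge0 _) (bF w y)).
Qed.

Lemma predictable_sum k n (F : nat -> T -> R -> R) : (forall i, (i < n)%N -> predictable k (F i)) ->
  predictable k (fun w y => \sum_(i < n) F i w y).
Proof.
elim: n => [|n IH] gF.
  have := predictable_cst k 0; rewrite (_ : (fun w y => \sum_(i < 0) F i w y) = (fun _ _ => 0))//.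
  by apply/funext => w; apply/funext => y; rewrite big_ord0.
rewrite (_ : (fun w y => _) = (fun w y => \sum_(i < n) F i w y + F n w y)).
  by apply: predictableD; [apply: IH => i h; apply: gF; exact: ltnW|exact: gF].
by apply/funext => w; apply/funext => y; rewrite big_ord_recr.
Qed.

Lemma predictable_last k (g : R -> R) B : measurable_fun setT g -> (forall y, `|g y| <= B) ->
  predictable k (fun _ y => g y).
Proof.
move=> mg bg; split; last by exists B.
exact: (measurableT_comp mg (@measurable_snd _ _ (sgX X (before k)) R)).
Qed.

Lemma predictable_past k (Phi : T -> R) B : adapted X (before k) Phi -> (forall w, `|Phi w| <= B) ->
  predictable k (fun w _ => Phi w).
Proof.
move=> mg bg; split; last by exists B.
exact: (measurableT_comp mg (@measurable_fst _ _ (sgX X (before k)) R)).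
Qed.

Lemma predictable_pair k s (F : R -> R -> R) B : (s < k)%N ->
  measurable_fun setT (fun z : R * R => F z.1 z.2) -> (forall x y, `|F x y| <= B) ->
  predictable k (fun w y => F (X s w) y).
Proof.
move=> sk mF bF; split; last by exists B.
have mX : measurable_fun setT (X s : sgX X (before k) -> R).
  exact: (@sigmaX_measurable _ _ _ _ (fun i => X i : T -> R) (before k) s sk).
have m1 : measurable_fun setT (fun z : sgX X (before k) * R => X s z.1).
  exact: (measurableT_comp mX (@measurable_fst _ _ (sgX X (before k)) R)).
have m2 := @measurable_snd _ _ (sgX X (before k)) R.
exact: (measurableT_comp mF (measurable_fun_pair m1 m2)).
Qed.

(** Given the past, [X k] acts as a fresh copy of [X 0]. The integrability facts are bundled with
    the identity because its uses need them. *)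
Lemma freeze k F : predictable k F ->
  [/\ L1 P (fun w => F w (X k w)), L1 P (fun w => Ex P (fun w' => F w (X 0%N w'))),
      forall w, L1 P (fun w' => F w (X 0%N w')) &
      Ex P (fun w => F w (X k w)) = Ex P (fun w => Ex P (fun w' => F w (X 0%N w')))].
Proof.
move=> [mF [B bF]].
have nk : ~~ before k k by rewrite /before ltnn.
have [m e] := Ex_freeze iX nk mF bF.
have mFw w : measurable_fun setT (F w).
  exact: (@measurable_fun_pair2 _ _ _ (sgX X (before k)) _ _ _ w mF).
have lw j w : L1 P (fun w' => F w (X j w')).
  by apply: (@L1_bnd _ _ _ _ _ B) => //; exact: (measurableT_comp (mFw w)).
have E w : Ex P (fun w' => F w (X k w')) = Ex P (fun w' => F w (X 0%N w')).
  by have [] := ident_Ex (i := 0%N) k idX (mFw w) (lw _ _).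
have EE : (fun w => Ex P (fun w' => F w (X k w'))) = (fun w => Ex P (fun w' => F w (X 0%N w'))).
  exact/funext.
rewrite EE in m e; split => //.
- apply: (@L1_bnd _ _ _ _ _ B) => //.
  have idm := @sigmaX_id_measurable _ _ _ P _ X (before k).
  exact: (measurableT_comp mF (measurable_fun_pair idm (@measurable_funP _ _ _ _ setT (X k)))).
- apply: (@L1_bnd _ _ _ _ _ B) => // w; exact: Ex_abs_le_cst.
Qed.

(** * A degenerate symmetric kernel and its martingale *)

Variables (H : R -> R -> R) (CH Q QG : R).
Hypothesis mH : measurable_fun setT (fun z : R * R => H z.1 z.2).
Hypothesis symH : forall x y, H x y = H y x.
Hypothesis bH : forall x y, `|H x y| <= CH.
Hypothesis degH : forall x, Ex P (fun w => H x (X 0%N w)) = 0.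
Hypothesis HQ : forall x, Ex P (fun w => H x (X 0%N w) ^+ 2) <= Q.

(** The kernel of the square of the integral operator of [H]. Weighted sums of [Gk] over the past
    are the conditional variances, and the bound [QG] on its mean square decides how much these
    fluctuate. *)
Definition Gk x y := Ex P (fun w => H x (X 0%N w) * H y (X 0%N w)).
Hypothesis HQG : Ex P (fun w => Ex P (fun w' => Gk (X 0%N w') (X 0%N w) ^+ 2)) <= QG.

Definition qH := Ex P (fun w => Gk (X 0%N w) (X 0%N w)).

Let CH0 : 0 <= CH. Proof. exact: le_trans (normr_ge0 _) (bH 0 0). Qed.

Let mHx x : measurable_fun setT (H x).
Proof. exact: (measurable_fun_pair2 x mH). Qed.

Let lH x : L1 P (fun w => H x (X 0%N w)).
Proof. by apply: (@L1_bnd _ _ _ _ _ CH) => //; exact: (measurableT_comp (mHx x)). Qed.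

Lemma Gk_bnd x y : `|Gk x y| <= CH ^+ 2.
Proof.
apply: Ex_abs_le_cst => [|w]; last by rewrite normrM expr2 ler_pM.
apply: (@L1_bnd _ _ _ _ _ (CH ^+ 2)) => [|w]; last by rewrite normrM expr2 ler_pM.
by apply: measurable_funM; [exact: (measurableT_comp (mHx x))|exact: (measurableT_comp (mHx y))].
Qed.

Lemma Gk_meas : measurable_fun setT (fun z : R * R => Gk z.1 z.2).
Proof.
apply: (@Ex_param_measurable _ (R * R)%type (fun z w => H z.1 (X 0%N w) * H z.2 (X 0%N w)) (CH ^+ 2)); last first.
  by move=> z w; rewrite normrM expr2 ler_pM.
have mX0 : measurable_fun setT (fun u : (R * R) * T => X 0%N u.2).
  exact: (measurableT_comp (@measurable_funP _ _ _ _ setT (X 0%N)) (@measurable_snd _ _ (R * R)%type T)).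
have mf := @measurable_fst _ _ (R * R)%type T.
apply: measurable_funM.
- apply: (measurableT_comp mH (measurable_fun_pair _ mX0)); exact: (measurableT_comp (@measurable_fst _ _ R R) mf).
- apply: (measurableT_comp mH (measurable_fun_pair _ mX0)); exact: (measurableT_comp (@measurable_snd _ _ R R) mf).
Qed.

Lemma GkC x y : Gk x y = Gk y x.
Proof. by apply: eq_Ex => w; rewrite mulrC. Qed.

Lemma Gk_diag x : Gk x x = Ex P (fun w => H x (X 0%N w) ^+ 2).
Proof. by apply: eq_Ex => w; rewrite expr2. Qed.

Lemma Gk_diag_bnd x : 0 <= Gk x x <= Q.
Proof. by rewrite Gk_diag HQ andbT; apply: Ex_ge0 => w; exact: sqr_ge0. Qed.

Let mGd : measurable_fun setT (fun y => Gk y y).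
Proof.
have md : measurable_fun setT (fun y : R => (y, y)) by exact: measurable_fun_pair.
exact: (measurableT_comp Gk_meas md).
Qed.

Let lGd : L1 P (fun w => Gk (X 0%N w) (X 0%N w)).
Proof. by apply: (@L1_bnd _ _ _ _ _ (CH ^+ 2)) => [|w]; [exact: (measurableT_comp mGd)|exact: Gk_bnd]. Qed.

Lemma qH_bnd : 0 <= qH <= Q.
Proof.
apply/andP; split; first by apply: Ex_ge0 => w; case/andP : (Gk_diag_bnd (X 0%N w)).
by apply: Ex_le_cst => // w; case/andP : (Gk_diag_bnd (X 0%N w)).
Qed.

Let Q0 : 0 <= Q. Proof. by case/andP : qH_bnd => a b; exact: le_trans a b. Qed.

(** The average over the second argument is moved onto [H], which is degenerate. To exchange the two
    integrations, [X 1] is used as an independent copy of [X 0], and one variable or the other is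
    frozen. *)
Lemma Gk_deg x : Ex P (fun w => Gk x (X 0%N w)) = 0.
Proof.
pose F := fun (w : T) y => H x y * H (X 0%N w) y.
have gF : predictable 1 F.
  apply: predictableM; first exact: predictable_last (mHx x) (bH x).
  exact: (@predictable_pair 1 0 H CH).
have [_ _ _ E1] := freeze gF.
rewrite /F in E1; rewrite -[LHS]E1.
have n0 : ~~ (fun i : nat => i == 1%N) 0%N by [].
pose F' := fun (w : T) y => H x (X 1%N w) * H y (X 1%N w).
have mX1 : measurable_fun setT (X 1%N : sgX X (fun i : nat => i == 1%N) -> R).
  exact: (@sigmaX_measurable _ _ _ _ (fun i => X i : T -> R) (fun i : nat => i == 1%N) 1%N).
have m1 : measurable_fun setT (fun z : sgX X (fun i : nat => i == 1%N) * R => X 1%N z.1).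
  exact: (measurableT_comp mX1 (@measurable_fst _ _ (sgX X (fun i : nat => i == 1%N)) R)).
have m2 := @measurable_snd _ _ (sgX X (fun i : nat => i == 1%N)) R.
have mF' : measurable_fun setT (fun z : sgX X (fun i : nat => i == 1%N) * R => F' z.1 z.2).
  apply: measurable_funM; first exact: (measurableT_comp (mHx x) m1).
  exact: (measurableT_comp mH (measurable_fun_pair m2 m1)).
have [|_ E2] := @Ex_freeze _ _ _ P _ X iX (fun i : nat => i == 1%N) 0%N F' (CH ^+ 2) n0 mF'.
  by move=> w y; rewrite normrM expr2 ler_pM.
rewrite /F' in E2; rewrite E2 -[RHS](Ex_cst P); apply: eq_Ex => w.
rewrite (@eq_Ex _ _ _ _ _ (fun w' => H x (X 1%N w) * H (X 1%N w) (X 0%N w'))); last by move=> w'; rewrite (symH (X 0%N w')).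
by rewrite ExZ// degH mulr0.
Qed.

Variables (a : nat -> R) (c : R).

Definition Dsum k w y := \sum_(s < k) a s * H (X s w) y.
Definition Dk k w := c * a k * Dsum k w (X k w).

Lemma predictable_Dsum k : predictable k (Dsum k).
Proof.
apply: (predictable_sum (F := fun s w y => a s * H (X s w) y)) => s sk; apply: predictableZ.
exact: (predictable_pair sk mH bH).
Qed.

Lemma Dk_orth k (Phi : T -> R) : predictable k (fun w _ => Phi w) -> Ex P (fun w => Phi w * Dk k w) = 0.
Proof.
move=> gP.
have [_ _ _] := freeze (predictableM gP (predictableZ (c * a k) (predictable_Dsum k))).
rewrite /Dk => ->; rewrite -[RHS](Ex_cst P); apply: eq_Ex => w.
have l s : L1 P (fun w' => a s * H (X s w) (X 0%N w')) by exact: L1Z.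
rewrite (@eq_Ex _ _ _ _ _ (fun w' => Phi w * (c * a k) * Dsum k w (X 0%N w'))); last by move=> w'; rewrite mulrA.
rewrite ExZ; last by apply: L1_sum => s _; exact: l.
rewrite Ex_sum; last by move=> s _; exact: l.
by rewrite big1 ?mulr0// => s _; rewrite ExZ// degH mulr0.
Qed.

Definition GG k w := \sum_(s < k) \sum_(r < k) a s * a r * Gk (X s w) (X r w).

Lemma Dk_sqr k (Phi : T -> R) : predictable k (fun w _ => Phi w) ->
  L1 P (fun w => Phi w * Dk k w ^+ 2) /\
  Ex P (fun w => Phi w * Dk k w ^+ 2) = Ex P (fun w => Phi w * ((c * a k) ^+ 2 * GG k w)).
Proof.
move=> gP.
have gF := predictableM gP (predictableX 2 (predictableZ (c * a k) (predictable_Dsum k))).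
have [l _ _ e] := freeze gF.
split; first exact: l.
rewrite /Dk e; apply: eq_Ex => w.
have lp s r : L1 P (fun w' => a s * a r * (H (X s w) (X 0%N w') * H (X r w) (X 0%N w'))).
  apply: L1Z; apply: (@L1_bnd _ _ _ _ _ (CH ^+ 2)) => [|w']; last by rewrite normrM expr2 ler_pM.
  by apply: measurable_funM; [exact: (measurableT_comp (mHx _))|exact: (measurableT_comp (mHx _))].
rewrite (@eq_Ex _ _ _ _ _ (fun w' => Phi w * (c * a k) ^+ 2 * \sum_(s < k) \sum_(r < k)
   a s * a r * (H (X s w) (X 0%N w') * H (X r w) (X 0%N w')))); last first.
  move=> w'; rewrite exprMn mulrA; congr (_ * _); rewrite /Dsum expr2 mulr_suml.
  by apply: eq_bigr => s _; rewrite mulr_sumr; apply: eq_bigr => r _; ring.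
rewrite ExZ; last by apply: L1_sum => s _; apply: L1_sum => r _; exact: lp.
rewrite -mulrA; congr (_ * (_ * _)); rewrite Ex_sum; last by move=> s _; apply: L1_sum => r _; exact: lp.
apply: eq_bigr => s _; rewrite Ex_sum; last by move=> r _; exact: lp.
apply: eq_bigr => r _; rewrite ExZ//.
apply: (@L1_bnd _ _ _ _ _ (CH ^+ 2)) => [|w']; last by rewrite normrM expr2 ler_pM.
by apply: measurable_funM; [exact: (measurableT_comp (mHx _))|exact: (measurableT_comp (mHx _))].
Qed.

Lemma predictable_pair2 k s r (F : R -> R -> R) B : (s < k)%N -> (r < k)%N ->
  measurable_fun setT (fun z : R * R => F z.1 z.2) -> (forall x y, `|F x y| <= B) ->
  predictable k (fun w _ => F (X s w) (X r w)).
Proof.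
move=> sk rk mF bF; apply: (@predictable_past k _ B) => // .
have mX i : (i < k)%N -> measurable_fun setT (X i : sgX X (before k) -> R).
  by move=> ik; exact: (@sigmaX_measurable _ _ _ _ (fun i => X i : T -> R) (before k) i ik).
exact: (measurableT_comp mF (measurable_fun_pair (mX s sk) (mX r rk))).
Qed.

(** Opposite order to [freeze]: the current point is held fixed and the past is averaged, which
    turns [Dsum] into a sum of independent centred terms. *)
Lemma predictable_double k F : predictable k F ->
  Ex P (fun w => F w (X k w)) = Ex P (fun w' => Ex P (fun w => F w (X 0%N w'))).
Proof.
move=> gF; have [_ _ _ ->] := freeze gF.
case: gF => mF [B bF]; apply: (@Ex_swap (fun w w' => F w (X 0%N w')) B) => //.
have idm := @sigmaX_id_measurable _ _ _ P _ X (before k).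
have m1 := measurableT_comp idm (@measurable_fst _ _ T T).
have m2 := measurableT_comp (@measurable_funP _ _ _ _ setT (X 0%N)) (@measurable_snd _ _ T T).
exact: (measurableT_comp mF (measurable_fun_pair m1 m2)).
Qed.

Let A2 k := \sum_(s < k) a s ^+ 2.
Let A4 k := \sum_(s < k) a s ^+ 4.

Section weighted_sum.
Variables (g : R -> R) (Bg : R).
Hypothesis mg : measurable_fun setT g.
Hypothesis bg : forall x, `|g x| <= Bg.
Hypothesis g_mean : Ex P (fun w => g (X 0%N w)) = 0.

Let lg i n : L1 P (fun w => g (X i w) ^+ n).
Proof.
apply: (@L1_bnd _ _ _ _ _ (Bg ^+ n)).
  by apply: measurable_funX; exact: (measurableT_comp mg).
by move=> w; rewrite normrX lerXn2r// nnegrE (le_trans (normr_ge0 _) (bg (X i w))).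
Qed.

Let gid i n : Ex P (fun w => g (X i w) ^+ n) = Ex P (fun w => g (X 0%N w) ^+ n).
Proof. by have [] := ident_Ex (i := 0%N) i idX (measurable_funX n mg) (lg 0 n). Qed.

Let mag i : measurable_fun setT (fun x => a i * g x).
Proof. exact: measurable_funM. Qed.

Let l4 i : L1 P (fun w => (a i * g (X i w)) ^+ 4).
Proof. by apply: (eq_L1 _ (L1Z (a i ^+ 4) (lg i 4))) => w; rewrite exprMn. Qed.

Let mean0 i : Ex P (fun w => a i * g (X i w)) = 0.
Proof.
have l1 : L1 P (fun w => g (X i w)) by apply: (eq_L1 _ (lg i 1)) => w; rewrite expr1.
rewrite ExZ// -[X in _ * X = _](@eq_Ex _ _ _ _ (fun w => g (X i w) ^+ 1)); last by move=> w; rewrite expr1.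
by rewrite gid (@eq_Ex _ _ _ _ _ (fun w => g (X 0%N w))) ?g_mean ?mulr0// => w; rewrite expr1.
Qed.

Lemma weighted_sum_sqr k : L1 P (fun w => (\sum_(s < k) a s * g (X s w)) ^+ 2) /\
  Ex P (fun w => (\sum_(s < k) a s * g (X s w)) ^+ 2) = A2 k * Ex P (fun w => g (X 0%N w) ^+ 2).
Proof.
have idinj : injective (id : nat -> nat) by [].
split.
  apply: L4_pow => //; last exact: (indep_sum_L4 mag l4).
  by apply: measurable_sum => i; apply: measurable_funM => //; exact: (measurableT_comp mg).
rewrite (indep_sum_sqr iX idinj mag l4 mean0) /A2 mulr_suml; apply: eq_bigr => i _.
rewrite -(gid i 2) -ExZ//; by apply: eq_Ex => w; rewrite exprMn.
Qed.

Lemma weighted_sum_pow4 k : Ex P (fun w => (\sum_(s < k) a s * g (X s w)) ^+ 4) <=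
  A4 k * Ex P (fun w => g (X 0%N w) ^+ 4) + 3 * (A2 k * Ex P (fun w => g (X 0%N w) ^+ 2)) ^+ 2.
Proof.
have idinj : injective (id : nat -> nat) by [].
apply: (le_trans (indep_sum_pow4 iX idinj mag l4 mean0 k)).
rewrite le_eqVlt; apply/orP; left; apply/eqP.
congr (_ + 3 * _ ^+ 2).
- rewrite /A4 mulr_suml; apply: eq_bigr => i _.
  rewrite -(gid i 4) -ExZ//; by apply: eq_Ex => w; rewrite exprMn.
- rewrite /A2 mulr_suml; apply: eq_bigr => i _.
  rewrite -(gid i 2) -ExZ//; by apply: eq_Ex => w; rewrite exprMn.
Qed.

End weighted_sum.

Let lHs y n : L1 P (fun w => H (X 0%N w) y ^+ n).
Proof.
apply: (@L1_bnd _ _ _ _ _ (CH ^+ n)).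
  by apply: measurable_funX; exact: (measurableT_comp (measurable_fun_pair1 y mH)).
by move=> w; rewrite normrX lerXn2r// nnegrE.
Qed.

(** For a fixed current point [y] the sum over the past has independent centred terms, and the
    fourth-moment inequality applies; [H^4 <= CH^2 H^2] reduces the fourth moment of one term to
    [Q]. *)
Lemma Dk_pow4 k : L1 P (fun w => Dk k w ^+ 4) /\
  Ex P (fun w => Dk k w ^+ 4) <= (c * a k) ^+ 4 * (CH ^+ 2 * Q * A4 k + 3 * Q ^+ 2 * A2 k ^+ 2).
Proof.
have gF := predictableX 4 (predictableZ (c * a k) (predictable_Dsum k)).
have [l _ _ _] := freeze gF; split; first exact: l.
have gD := predictableX 4 (predictable_Dsum k); have [lD _ _ _] := freeze gD.
rewrite (@eq_Ex _ _ _ _ _ (fun w => (c * a k) ^+ 4 * Dsum k w (X k w) ^+ 4)); last first.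
  by move=> w; rewrite /Dk exprMn.
rewrite ExZ// ler_wpM2l ?exprn_even_ge0// (predictable_double gD).
case: gD => mD [B bD].
have key y : Ex P (fun w => Dsum k w y ^+ 4) <= CH ^+ 2 * Q * A4 k + 3 * Q ^+ 2 * A2 k ^+ 2.
  have mHy : measurable_fun setT (H^~ y) by exact: (measurable_fun_pair1 y mH).
  have dHy : Ex P (fun w => H (X 0%N w) y) = 0.
    by rewrite -(degH y); apply: eq_Ex => w; rewrite symH.
  have E2 : Ex P (fun w => H (X 0%N w) y ^+ 2) <= Q.
    by rewrite (@eq_Ex _ _ _ _ _ (fun w => H y (X 0%N w) ^+ 2)) ?HQ// => w; rewrite symH.
  have E20 : 0 <= Ex P (fun w => H (X 0%N w) y ^+ 2) by apply: Ex_ge0 => w; exact: sqr_ge0.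
  have E4 : Ex P (fun w => H (X 0%N w) y ^+ 4) <= CH ^+ 2 * Q.
    apply: (@le_trans _ _ (CH ^+ 2 * Ex P (fun w => H (X 0%N w) y ^+ 2))); last first.
      by rewrite ler_wpM2l ?sqr_ge0.
    rewrite -ExZ//; apply: Ex_le => //; first exact: L1Z.
    move=> w; have -> : H (X 0%N w) y ^+ 4 = H (X 0%N w) y ^+ 2 * H (X 0%N w) y ^+ 2 by rewrite -exprD.
    by rewrite ler_wpM2r ?sqr_ge0// -(real_normK (num_real (H (X 0%N w) y))) lerXn2r// nnegrE.
  apply: (le_trans (weighted_sum_pow4 mHy (fun x => bH x y) dHy k)).
  have A40 : 0 <= A4 k by apply: sumr_ge0 => i _; rewrite exprn_even_ge0.
  have A20 : 0 <= A2 k by apply: sumr_ge0 => i _; exact: sqr_ge0.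
  apply: lerD; first by rewrite mulrC ler_wpM2r.
  rewrite -mulrA ler_wpM2l// -exprMn lerXn2r ?nnegrE ?mulr_ge0//.
  by rewrite mulrC ler_wpM2r.
have lin y : L1 P (fun w => Dsum k w y ^+ 4).
  have idm := @sigmaX_id_measurable _ _ _ P _ X (before k).
  apply: (@L1_bnd _ _ _ _ _ B) => //.
  exact: (measurableT_comp (@measurable_fun_pair1 _ _ _ (sgX X (before k)) _ _ _ y mD) idm).
apply: Ex_le_cst => [|w']; last exact: key.
apply: (@L1_bnd _ _ _ _ _ B); last by move=> w; exact: Ex_abs_le_cst.
apply: (@Ex_param_measurable _ _ (fun w' w => Dsum k w (X 0%N w') ^+ 4) B) => //.
have idm := @sigmaX_id_measurable _ _ _ P _ X (before k).
have m1 := measurableT_comp idm (@measurable_snd _ _ T T).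
have m2 := measurableT_comp (@measurable_funP _ _ _ _ setT (X 0%N)) (@measurable_fst _ _ T T).
exact: (measurableT_comp mD (measurable_fun_pair m1 m2)).
Qed.

Lemma predictable_GG k : predictable k (fun w _ => GG k w).
Proof.
apply: (predictable_sum (F := fun s w _ => \sum_(r < k) a s * a r * Gk (X s w) (X r w))) => s sk.
apply: (predictable_sum (F := fun r w _ => a s * a r * Gk (X s w) (X r w))) => r rk.
by apply: predictableZ; exact: (predictable_pair2 sk rk Gk_meas Gk_bnd).
Qed.

(* [(c * a k) ^+ 2 * GG k] is the conditional variance of [Dk k] given the past;
   centred, it is again a martingale in [k], with increments [Zk]. *)
Definition Wk k w := GG k w - qH * A2 k.
Definition Zk k w y := a k ^+ 2 * (Gk y y - qH) + 2 * a k * \sum_(s < k) a s * Gk (X s w) y.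

Lemma predictable_Wk k : predictable k (fun w _ => Wk k w).
Proof. by apply: predictableD; [exact: predictable_GG|exact: predictable_cst]. Qed.

Let predictable_GS k : predictable k (fun w y => \sum_(s < k) a s * Gk (X s w) y).
Proof.
apply: (predictable_sum (F := fun s w y => a s * Gk (X s w) y)) => s sk.
by apply: predictableZ; exact: (predictable_pair sk Gk_meas Gk_bnd).
Qed.

Lemma predictable_Zk k : predictable k (Zk k).
Proof.
apply: predictableD; apply: predictableZ; last exact: predictable_GS.
by apply: predictableD; [exact: (predictable_last _ mGd (fun y => Gk_bnd y y))|exact: predictable_cst].
Qed.

Lemma Wk_rec k w : Wk k.+1 w = Wk k w + Zk k w (X k w).
Proof.
rewrite /Wk /Zk /GG /A2 !big_ord_recr /=.
have -> : \sum_(i < k) \sum_(r < k.+1) a i * a r * Gk (X i w) (X r w) =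
    \sum_(i < k) \sum_(r < k) a i * a r * Gk (X i w) (X r w) +
    a k * \sum_(i < k) a i * Gk (X i w) (X k w).
  rewrite mulr_sumr -big_split /=; apply: eq_bigr => i _; rewrite big_ord_recr /=; ring.
have -> : \sum_(i < k) a k * a i * Gk (X k w) (X i w) = a k * \sum_(i < k) a i * Gk (X i w) (X k w).
  by rewrite mulr_sumr; apply: eq_bigr => i _; rewrite GkC; ring.
ring.
Qed.

Let lGx x : L1 P (fun w => Gk x (X 0%N w)).
Proof.
apply: (@L1_bnd _ _ _ _ _ (CH ^+ 2)) => [|w]; last exact: Gk_bnd.
exact: (measurableT_comp (measurable_fun_pair2 x Gk_meas)).
Qed.

Lemma Zk_mean k w : Ex P (fun w' => Zk k w (X 0%N w')) = 0.
Proof.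
have l1 : L1 P (fun w' => a k ^+ 2 * (Gk (X 0%N w') (X 0%N w') - qH)).
  by apply: L1Z; apply: L1B => //; exact: L1_cst.
have l2 s : L1 P (fun w' => a s * Gk (X s w) (X 0%N w')) by exact: L1Z.
have l3 : L1 P (fun w' => \sum_(s < k) a s * Gk (X s w) (X 0%N w')) by apply: L1_sum => s _.
rewrite ExD//; last exact: L1Z.
rewrite !ExZ//; last by apply: L1B => //; exact: L1_cst.
rewrite ExB//; last exact: L1_cst.
rewrite Ex_cst subrr mulr0 add0r Ex_sum// big1 ?mulr0// => s _.
by rewrite ExZ// Gk_deg mulr0.
Qed.

Lemma Wk_mean k : L1 P (Wk k) /\ Ex P (Wk k) = 0.
Proof.
have l j : L1 P (Wk j) by have [l _ _ _] := freeze (predictable_Wk j).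
split => //; elim: k => [|k IH].
  rewrite -[RHS](Ex_cst P); apply: eq_Ex => w.
  by rewrite /Wk /GG /A2 !big_ord0 mulr0 subrr.
have [lZ _ _ eZ] := freeze (predictable_Zk k).
rewrite (@eq_Ex _ _ _ _ _ (fun w => Wk k w + Zk k w (X k w))); last by move=> w; exact: Wk_rec.
rewrite ExD// IH add0r eZ -[RHS](Ex_cst P); apply: eq_Ex => w; exact: Zk_mean.
Qed.

(** [(u + v)^2 <= 2 u^2 + 2 v^2] separates two parts. The diagonal one is bounded through [Q]; in
    the other, for a fixed current point, [Gk] is degenerate and the past terms have variances
    adding up to [A2 k] times a mean square of [Gk]. *)
Lemma Zk_sqr k : Ex P (fun w => Zk k w (X k w) ^+ 2) <=
  2 * Q ^+ 2 * a k ^+ 4 + 8 * QG * (a k ^+ 2 * A2 k).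
Proof.
have [lZ _ _ _] := freeze (predictableX 2 (predictable_Zk k)).
have gS := predictableX 2 (predictable_GS k).
have [lS _ _ _] := freeze gS.
pose S w y := \sum_(s < k) a s * Gk (X s w) y.
have lR : L1 P (fun w => 2 * Q ^+ 2 * a k ^+ 4 + 8 * a k ^+ 2 * S w (X k w) ^+ 2).
  by apply: L1D; [exact: L1_cst|exact: L1Z].
apply: (le_trans (Ex_le lZ lR _)).
  move=> w; rewrite /Zk -/(S w (X k w)).
  have /andP[g0 g1] := Gk_diag_bnd (X k w); have /andP[q0 q1] := qH_bnd.
  set G := Gk _ _ in g0 g1 *; set Sw := S _ _.
  have h : (G - qH) ^+ 2 <= Q ^+ 2.
    rewrite -(real_normK (num_real (G - qH))) lerXn2r ?nnegrE// ler_norml.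
    by apply/andP; split; lra.
  have h' : a k ^+ 4 * (G - qH) ^+ 2 <= a k ^+ 4 * Q ^+ 2 by rewrite ler_wpM2l// exprn_even_ge0.
  have := sqr_ge0 (a k ^+ 2 * (G - qH) - 2 * a k * Sw).
  lra.
rewrite ExD ?Ex_cst; [|exact: L1_cst|exact: L1Z].
rewrite ExZ// lerD2l (_ : 8 * QG * (a k ^+ 2 * A2 k) = 8 * a k ^+ 2 * (A2 k * QG)); last by ring.
have a8 : 0 <= 8 * a k ^+ 2 by apply: mulr_ge0 => //; exact: sqr_ge0.
apply: (ler_wpM2l a8).
have -> : Ex P (fun w => S w (X k w) ^+ 2) = Ex P (fun w' => Ex P (fun w => S w (X 0%N w') ^+ 2)).
  exact: (predictable_double gS).
rewrite (@eq_Ex _ _ _ _ _ (fun w' => A2 k * Ex P (fun w => Gk (X 0%N w) (X 0%N w') ^+ 2))); last first.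
  move=> w'; set y := X 0%N w'.
  have mGy : measurable_fun setT (Gk^~ y) by exact: (measurable_fun_pair1 y Gk_meas).
  have dGy : Ex P (fun w => Gk (X 0%N w) y) = 0.
    by rewrite -(Gk_deg y); apply: eq_Ex => w; rewrite GkC.
  exact: (weighted_sum_sqr mGy (fun x => Gk_bnd x y) dGy k).2.
rewrite ExZ; last first.
  apply: (@L1_bnd _ _ _ _ _ ((CH ^+ 2) ^+ 2)); last first.
    move=> w'; apply: Ex_abs_le_cst => [|w]; last by rewrite normrX lerXn2r ?nnegrE ?sqr_ge0// Gk_bnd.
    apply: (@L1_bnd _ _ _ _ _ ((CH ^+ 2) ^+ 2)) => [|w]; last by rewrite normrX lerXn2r ?nnegrE ?sqr_ge0// Gk_bnd.
    by apply: measurable_funX; exact: (measurableT_comp (measurable_fun_pair1 (X 0%N w') Gk_meas)).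
  apply: (@Ex_param_measurable _ _ (fun w' w => Gk (X 0%N w) (X 0%N w') ^+ 2) ((CH ^+ 2) ^+ 2)).
    apply: measurable_funX.
    have m1 := measurableT_comp (@measurable_funP _ _ _ _ setT (X 0%N)) (@measurable_snd _ _ T T).
    have m2 := measurableT_comp (@measurable_funP _ _ _ _ setT (X 0%N)) (@measurable_fst _ _ T T).
    exact: (measurableT_comp Gk_meas (measurable_fun_pair m1 m2)).
  by move=> w w'; rewrite normrX lerXn2r ?nnegrE ?sqr_ge0// Gk_bnd.
by rewrite ler_wpM2l//; apply: sumr_ge0 => i _; exact: sqr_ge0.
Qed.

Let QG0 : 0 <= QG.
Proof. by apply: le_trans HQG; apply: Ex_ge0 => w; apply: Ex_ge0 => w'; exact: sqr_ge0. Qed.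

(** The increments [Zk] are orthogonal to the past, so their second moments add up, and the sum of
    [a k ^ 2 * A2 k] stays below [A2 ^ 2]. For the bandwidth kernel [Q^2] is of order [h^2] and [QG]
    of order [h^3]: the bound is small against the squared variance when [h] is small and [A4] is
    small against [A2^2]. *)
Lemma Wk_sqr k : L1 P (fun w => Wk k w ^+ 2) /\
  Ex P (fun w => Wk k w ^+ 2) <= 2 * Q ^+ 2 * A4 k + 8 * QG * A2 k ^+ 2.
Proof.
have l j : L1 P (fun w => Wk j w ^+ 2) by have [l _ _ _] := freeze (predictableX 2 (predictable_Wk j)).
split => //; elim: k => [|k IH].
  rewrite (@eq_Ex _ _ _ _ _ (fun=> 0)); last by move=> w; rewrite /Wk /GG /A2 !big_ord0 mulr0 subrr expr0n.
  by rewrite Ex_cst /A4 /A2 !big_ord0 expr0n !mulr0 addr0.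
have [lZ _ _ _] := freeze (predictableX 2 (predictable_Zk k)).
have [lWZ _ lw eWZ] := freeze (predictableM (predictable_Wk k) (predictable_Zk k)).
have E0 : Ex P (fun w => Wk k w * Zk k w (X k w)) = 0.
  rewrite eWZ -[RHS](Ex_cst P); apply: eq_Ex => w; rewrite ExZ ?Zk_mean ?mulr0//.
  by have [_ _ h _] := freeze (predictable_Zk k); exact: h.
rewrite (@eq_Ex _ _ _ _ _ (fun w => Wk k w ^+ 2 + 2 * (Wk k w * Zk k w (X k w)) + Zk k w (X k w) ^+ 2)); last first.
  by move=> w; rewrite Wk_rec; ring.
rewrite ExD//; last by apply: L1D => //; exact: L1Z.
rewrite ExD//; last exact: L1Z.
rewrite ExZ// E0 mulr0 addr0; apply: (le_trans (lerD IH (Zk_sqr k))).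
rewrite /A4 /A2 !big_ord_recr /= -/(A2 k) -/(A4 k).
have A20 : 0 <= A2 k by apply: sumr_ge0 => i _; exact: sqr_ge0.
have ak := sqr_ge0 (a k); have p := mulr_ge0 A20 ak; have p2 := sqr_ge0 (a k ^+ 2).
have -> : 2 * Q ^+ 2 * A4 k + 8 * QG * A2 k ^+ 2 + (2 * Q ^+ 2 * a k ^+ 4 + 8 * QG * (a k ^+ 2 * A2 k)) =
   2 * Q ^+ 2 * (A4 k + a k ^+ 4) + 8 * QG * (A2 k ^+ 2 + a k ^+ 2 * A2 k) by ring.
by rewrite lerD2l ler_wpM2l ?mulr_ge0// sqrrD -addrA lerD2l [a k ^+ 2 * _]mulrC mulr2n; lra.
Qed.

Definition vk k := (c * a k) ^+ 2 * (qH * A2 k).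

Lemma vk_ge0 k : 0 <= vk k.
Proof.
have /andP[q0 _] := qH_bnd; rewrite mulr_ge0 ?sqr_ge0// mulr_ge0//.
by apply: sumr_ge0 => i _; exact: sqr_ge0.
Qed.

Lemma Dk_var k : L1 P (fun w => Dk k w ^+ 2) /\ Ex P (fun w => Dk k w ^+ 2) = vk k.
Proof.
have [l e] := @Dk_sqr k (fun=> 1) (predictable_cst k 1).
have [lW eW] := Wk_mean k.
split; first by apply: (eq_L1 _ l) => w; rewrite mul1r.
rewrite (@eq_Ex _ _ _ _ _ (fun w => 1 * Dk k w ^+ 2)); last by move=> w; rewrite mul1r.
rewrite e (@eq_Ex _ _ _ _ _ (fun w => (c * a k) ^+ 2 * Wk k w + vk k)); last first.
  by move=> w; rewrite /vk /Wk; ring.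
rewrite ExD; [|exact: L1Z|exact: L1_cst].
by rewrite ExZ// eW Ex_cst mulr0 add0r.
Qed.

Lemma predictable_Dk k i : (i < k)%N -> predictable k (fun w _ => Dk i w).
Proof.
move=> ik; rewrite /Dk; apply: predictableZ; rewrite /Dsum.
apply: (predictable_sum (F := fun s w _ => a s * H (X s w) (X i w))) => s si; apply: predictableZ.
exact: (predictable_pair2 (ltn_trans si ik) ik mH bH).
Qed.

Definition Uk k w := \sum_(i < k) Dk i w.

Lemma predictable_Uk k : predictable k (fun w _ => Uk k w).
Proof. by apply: (predictable_sum (F := fun i w _ => Dk i w)) => i ik; exact: predictable_Dk. Qed.

Lemma Uk_meas k : measurable_fun setT (Uk k).
Proof. by have [/L1_meas] := freeze (predictable_Uk k). Qed.

Lemma Uk_sqr k : L1 P (fun w => Uk k w ^+ 2) /\ Ex P (fun w => Uk k w ^+ 2) = \sum_(i < k) vk i.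
Proof.
have l j : L1 P (fun w => Uk j w ^+ 2) by have [l _ _ _] := freeze (predictableX 2 (predictable_Uk j)).
split => //; elim: k => [|k IH].
  rewrite big_ord0 -[RHS](Ex_cst P); apply: eq_Ex => w; by rewrite /Uk big_ord0 expr0n.
have [lD eD] := Dk_var k.
have [lUD _ _ _] := freeze (predictableM (predictable_Uk k) (predictableZ (c * a k) (predictable_Dsum k))).
have lUD' : L1 P (fun w => Uk k w * Dk k w) by exact: lUD.
rewrite (@eq_Ex _ _ _ _ _ (fun w => Uk k w ^+ 2 + 2 * (Uk k w * Dk k w) + Dk k w ^+ 2)); last first.
  by move=> w; rewrite /Uk big_ord_recr /=; ring.
rewrite ExD//; last by apply: L1D => //; exact: L1Z.
rewrite ExD//; last exact: L1Z.
by rewrite ExZ// (Dk_orth (predictable_Uk k)) mulr0 addr0 IH eD big_ord_recr.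
Qed.

(** Twice the sum of [a s ^ 2 * a k ^ 2] over [s < k] is the square of the full sum minus its
    diagonal. *)
Lemma sum_vk n : \sum_(i < n) vk i = c ^+ 2 * qH * ((A2 n ^+ 2 - A4 n) / 2).
Proof.
elim: n => [|n IH]; first by rewrite big_ord0 /A2 /A4 !big_ord0 expr0n /= subrr mul0r mulr0.
by rewrite big_ord_recr /= IH /vk /A2 /A4 !big_ord_recr /= -/(A2 n) -/(A4 n); field.
Qed.

(** Trades third absolute moments for second and fourth ones, which are computable; [theta] is tuned
    at the end. *)
Lemma cube_le (y theta : R) : 0 < theta -> `|y| ^+ 3 <= (theta * y ^+ 2 + y ^+ 4 / theta) / 2.
Proof.
move=> t0; have -> : y ^+ 4 = `|y| ^+ 4 by rewrite -[LHS]ger0_norm ?exprn_even_ge0// normrX.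
rewrite -[y ^+ 2](real_normK (num_real y)); move: (`|y|) => z.
rewrite -subr_ge0 (_ : _ - _ = (2 * theta)^-1 * (z * (theta - z)) ^+ 2); last by field; rewrite gt_eqF.
by rewrite mulr_ge0 ?sqr_ge0// invr_ge0 mulr_ge0// ltW.
Qed.

(** The first term is the mean deviation of the conditional variances, through [Wk_sqr]. The second
    collects the cubic remainders through [cube_le], the Gaussian ones included because [vk i ^ 2]
    obeys the same bound as the fourth moment of [Dk i]. The weights survive only through [A2 n] and
    [A4 n]. *)
Theorem Uk_clt_bound n theta B phi phi1 phi2 : 0 < theta -> smooth3 B phi phi1 phi2 ->
  `|Ex P (fun w => phi (Uk n w)) - Gs (\sum_(i < n) vk i) phi 0| <=
  B * (c ^+ 2 * A2 n * Num.sqrt (2 * Q ^+ 2 * A4 n + 8 * QG * A2 n ^+ 2) +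
   (1 + gauss3) * (theta * \sum_(i < n) vk i +
     c ^+ 4 * A4 n * (CH ^+ 2 * Q * A4 n + 3 * Q ^+ 2 * A2 n ^+ 2) / theta)).
Proof.
move=> t0 sm; have B0 : 0 <= B by exact: le_trans (normr_ge0 _) (sm_b1 sm 0).
have A2le k : (k <= n)%N -> 0 <= A2 k <= A2 n.
  move=> kn; rewrite sumr_ge0 /=; last by move=> i _; exact: sqr_ge0.
  rewrite /A2 -(subnKC kn) big_split_ord /=.
  by rewrite lerDl sumr_ge0// => i _; exact: sqr_ge0.
have A4le k : (k <= n)%N -> 0 <= A4 k <= A4 n.
  move=> kn; rewrite sumr_ge0 /=; last by move=> i _; rewrite exprn_even_ge0.
  rewrite /A4 -(subnKC kn) big_split_ord /=.
  by rewrite lerDl sumr_ge0// => i _; rewrite exprn_even_ge0.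
have ca4 i : 0 <= c ^+ 4 * a i ^+ 4 by apply: mulr_ge0; rewrite exprn_even_ge0.
have Q3 : 0 <= 3 * Q ^+ 2 by apply: mulr_ge0 => //; exact: sqr_ge0.
set S := Num.sqrt (2 * Q ^+ 2 * A4 n + 8 * QG * A2 n ^+ 2).
set T4 := CH ^+ 2 * Q * A4 n + 3 * Q ^+ 2 * A2 n ^+ 2.
pose delta k := (c * a k) ^+ 2 * Ex P (fun w => `|Wk k w|).
have lWabs k : L1 P (fun w => `|Wk k w|) by apply: L1_abs; exact: (Wk_mean k).1.
have mDk k : measurable_fun setT (Dk k).
  by have [/L1_meas] := freeze (predictableZ (c * a k) (predictable_Dsum k)).
have l3 k : L1 P (fun w => `|Dk k w| ^+ 3).
  have [l _ _ _] := freeze (predictableX 3 (predictableZ (c * a k) (predictable_Dsum k))).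
  by apply: (eq_L1 _ (L1_abs l)) => w; rewrite normrX.
have gg k (g : R -> R) C : measurable_fun setT g -> (forall x, `|g x| <= C) ->
    predictable k (fun w _ => g (\sum_(i < k) Dk i w)).
  move=> mg bg; have [mU _] := predictable_Uk k; split; last by exists C.
  exact: (measurableT_comp mg mU).
have h1 k (g : R -> R) C : measurable_fun setT g -> (forall x, `|g x| <= C) ->
    Ex P (fun w => g (\sum_(i < k) Dk i w) * Dk k w) = 0.
  by move=> mg bg; apply: Dk_orth; exact: gg mg bg.
have h2 k (g : R -> R) C : measurable_fun setT g -> (forall x, `|g x| <= C) ->
    `|Ex P (fun w => g (\sum_(i < k) Dk i w) * (Dk k w ^+ 2 - vk k))| <= C * delta k.
  move=> mg bg; have gk := gg k g C mg bg.
  have [l e] := Dk_sqr gk.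
  have [lg _ _ _] := freeze gk.
  have [lGG _ _ _] := freeze (predictableM gk (predictableZ ((c * a k) ^+ 2) (predictable_GG k))).
  have [lW _ _ _] := freeze (predictableM gk (predictableZ ((c * a k) ^+ 2) (predictable_Wk k))).
  have -> : Ex P (fun w => g (\sum_(i < k) Dk i w) * (Dk k w ^+ 2 - vk k)) =
     Ex P (fun w => g (\sum_(i < k) Dk i w) * ((c * a k) ^+ 2 * Wk k w)).
    rewrite (@eq_Ex _ _ _ _ _ (fun w => g (\sum_(i < k) Dk i w) * Dk k w ^+ 2 - vk k * g (\sum_(i < k) Dk i w))).
      rewrite ExB//; last exact: L1Z.
      rewrite e -ExB//; last exact: L1Z.
      by apply: eq_Ex => w; rewrite /vk /Wk; ring.
    by move=> w; ring.
  rewrite /delta [leRHS]mulrA -ExZ//; apply: Ex_abs_le => //; first exact: L1Z.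
  by move=> w; rewrite normrM -[leRHS]mulrA ler_pM// normrM [X in X * _ <= _]ger0_norm ?sqr_ge0.
have := @lindeberg _ _ _ P Dk vk delta mDk vk_ge0 l3 h1 h2 n _ _ _ _ sm.
move/le_trans; apply; rewrite ler_wpM2l// big_split /= big_split /= -addrA; apply: lerD.
- apply: (@le_trans _ _ (\sum_(i < n) c ^+ 2 * a i ^+ 2 * S)); last first.
    by rewrite -mulr_suml -mulr_sumr.
  apply: ler_sum => i _; rewrite /delta exprMn.
  have W : Ex P (fun w => `|Wk i w|) <= S.
    have [lW bW] := Wk_sqr i.
    have mW : measurable_fun setT (Wk i) by apply: L1_meas; exact: (Wk_mean i).1.
    apply: (le_trans (Ex_abs_sqrt mW lW)); rewrite ler_wsqrtr// (le_trans bW)//.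
    have /andP[x0 x1] := A2le i (ltnW (ltn_ord i)); have /andP[y0 y1] := A4le i (ltnW (ltn_ord i)).
    apply: lerD; first by rewrite ler_wpM2l// mulr_ge0// sqr_ge0.
    by rewrite ler_wpM2l ?mulr_ge0// lerXn2r// nnegrE// (le_trans x0).
  have W0 : 0 <= Ex P (fun w => `|Wk i w|) by exact: Ex_ge0.
  have := mulr_ge0 (sqr_ge0 c) (sqr_ge0 (a i)) => ca.
  have := ler_wpM2l ca W; have := mulr_ge0 ca W0; lra.
- rewrite mulrDl mul1r; apply: lerD.
    apply: (@le_trans _ _ (\sum_(i < n) (theta * vk i + c ^+ 4 * a i ^+ 4 * T4 / theta))).
      apply: ler_sum => i _.
      have [l2 e2] := Dk_var i; have [l4 b4] := Dk_pow4 i.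
      have lr : L1 P (fun w => theta / 2 * Dk i w ^+ 2 + (2 * theta)^-1 * Dk i w ^+ 4).
        by apply: L1D; exact: L1Z.
      apply: (le_trans (Ex_le (l3 i) lr _)).
        by move=> w; apply: (le_trans (cube_le _ t0)); rewrite le_eqVlt; apply/orP; left; apply/eqP; field; rewrite gt_eqF.
      rewrite ExD; [|exact: L1Z|exact: L1Z]; rewrite !ExZ// e2.
      apply: lerD; first by have := mulr_ge0 (ltW t0) (vk_ge0 i); lra.
      have b4' : Ex P (fun w => Dk i w ^+ 4) <= c ^+ 4 * a i ^+ 4 * T4.
        rewrite exprMn in b4; apply: (le_trans b4); apply: (ler_wpM2l (ca4 i)).
        have /andP[x0 x1] := A2le i (ltnW (ltn_ord i)); have /andP[y0 y1] := A4le i (ltnW (ltn_ord i)).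
        apply: lerD; first by rewrite ler_wpM2l// mulr_ge0// sqr_ge0.
        by apply: (ler_wpM2l Q3); rewrite lerXn2r// nnegrE// (le_trans x0).
      have b0 : 0 <= Ex P (fun w => Dk i w ^+ 4) by apply: Ex_ge0 => w; rewrite exprn_even_ge0.
      rewrite ler_pdivlMr// [leLHS](_ : _ = Ex P (fun w => Dk i w ^+ 4) / 2); last by field; rewrite gt_eqF.
      lra.
    by rewrite big_split /= -mulr_sumr -!mulr_suml -mulr_sumr.
  rewrite -mulr_sumr ler_wpM2l ?gauss3_ge0//.
  apply: (@le_trans _ _ (\sum_(i < n) (theta * vk i + c ^+ 4 * a i ^+ 4 * T4 / theta))); last first.
    by rewrite big_split /= -mulr_sumr -!mulr_suml -mulr_sumr.
  apply: ler_sum => i _; have v0 := vk_ge0 i.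
  have := cube_le (Num.sqrt (vk i)) t0; rewrite ger0_norm ?sqrtr_ge0//.
  have -> : Num.sqrt (vk i) ^+ 4 = vk i ^+ 2 by rewrite (exprM _ 2 2) sqr_sqrtr.
  rewrite sqr_sqrtr// => h; apply: (le_trans h).
  have vb : vk i ^+ 2 <= c ^+ 4 * a i ^+ 4 * T4.
    rewrite /vk exprMn -exprM exprMn; apply: (ler_wpM2l (ca4 i)).
    have /andP[x0 x1] := A2le i (ltnW (ltn_ord i)); have /andP[y0 y1] := A4le n (leqnn n).
    have /andP[q0 q1] := qH_bnd.
    have e1 : (qH * A2 i) ^+ 2 <= Q ^+ 2 * A2 n ^+ 2.
      by rewrite -exprMn lerXn2r ?nnegrE ?mulr_ge0// ?ler_pM// (le_trans x0).
    have e2 : 0 <= CH ^+ 2 * Q * A4 n by rewrite !mulr_ge0// sqr_ge0.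
    rewrite /T4; have := mulr_ge0 (sqr_ge0 Q) (sqr_ge0 (A2 n)); lra.
  rewrite ler_pdivrMr// mulrDl -[_ / theta * 2]mulrAC.
  apply: lerD; first by have := mulr_ge0 (ltW t0) v0; lra.
  rewrite ler_pM2r ?invr_gt0//; have := sqr_ge0 (vk i); lra.
Qed.

End degenerate.

(** * Conditioning on the errors *)

Section quenched.
Context {d : measure_display} {T : measurableType d} {R : realType}.
Variable P : probability T R.
Variables (I J : eqType) (X : I -> {RV P >-> R}) (e : J -> {RV P >-> R}).
Hypothesis iXe : indep_families P (fun i => X i : T -> R) (fun j => e j : T -> R).

Let ie : {RV P >-> sgX e predT} :=
  HB.pack (idfun : T -> sgX e predT) (isMeasurableFun.Build _ _ _ _ _ (@sigmaX_id_measurable _ _ _ P J e predT)).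
Let iX : {RV P >-> sgX X predT} :=
  HB.pack (idfun : T -> sgX X predT) (isMeasurableFun.Build _ _ _ _ _ (@sigmaX_id_measurable _ _ _ P I X predT)).

Let UV C D : measurable C -> measurable D ->
  (P (ie @^-1` C `&` iX @^-1` D) = P (ie @^-1` C) * P (iX @^-1` D))%E.
Proof.
move=> mC mD; rewrite setIC muleC.
apply: (@indep_generated _ _ _ P (cylinders (fun i => X i : T -> R) predT) (cylinders (fun i => e i : T -> R) predT)) => //;
  try exact: cylindersI; try exact: cylindersT; try exact: cylinders_measurable.
by move=> _ _ [s [A [_ mA ->]]] [s' [A' [_ mA' ->]]]; exact: iXe.
Qed.

(** The first argument is reserved for the errors and the second for the design points; [F w w] is
    the actual variable, [F w] the one with the errors frozen at [w]. *)
Definition jmeas (F : T -> T -> R) :=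
  measurable_fun setT (fun z : sgX e predT * sgX X predT => F z.1 z.2).

Lemma jmeas_diag F : jmeas F -> measurable_fun setT (fun w => F w w).
Proof.
move=> mF; have m : measurable_fun setT (fun w => (ie w, iX w)) by exact: measurable_fun_pair.
exact: (measurableT_comp mF m).
Qed.

Lemma jmeas_section F w : jmeas F -> measurable_fun setT (F w).
Proof.
move=> mF; have h := @measurable_fun_pair2 _ _ _ (sgX e predT) _ _ _ w mF.
exact: (measurableT_comp h (@measurable_funP _ _ _ _ setT iX)).
Qed.

Lemma jmeas_e j : jmeas (fun w _ => e j w).
Proof.
exact: (measurableT_comp (@sigmaX_measurable _ _ _ _ (fun i => e i : T -> R) predT j isT)
  (@measurable_fst _ _ (sgX e predT) (sgX X predT))).
Qed.

Lemma jmeas_X i : jmeas (fun _ w => X i w).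
Proof.
exact: (measurableT_comp (@sigmaX_measurable _ _ _ _ (fun i => X i : T -> R) predT i isT)
  (@measurable_snd _ _ (sgX e predT) (sgX X predT))).
Qed.

Lemma quenched_bounded F B : jmeas F -> (forall w w', `|F w w'| <= B) ->
  L1 P (fun w => Ex P (F w)) /\ Ex P (fun w => F w w) = Ex P (fun w => Ex P (F w)).
Proof.
move=> mF bF.
apply: (@diag_expectation _ _ _ P _ _ _ _ ie iX F UV mF).
  by apply: (@L1_bnd _ _ _ _ _ B) => //; exact: jmeas_diag.
by move=> w; apply: (@L1_bnd _ _ _ _ _ B) => //; exact: jmeas_section.
Qed.

(** An [L^1] bound for frozen errors, with a right side that depends on them, integrates to a bound
    for the actual variable. Tonelli gives integrability along the way, so [F] may be unbounded. *)
Lemma quenched_abs F b : jmeas F -> (forall w, L1 P (F w)) ->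
  (forall w, Ex P (fun w' => `|F w w'|) <= b w) -> L1 P b ->
  L1 P (fun w => F w w) /\ Ex P (fun w => `|F w w|) <= Ex P b.
Proof.
move=> mF lF bF lb.
have mF' : measurable_fun setT (fun z : sgX e predT * sgX X predT => `|F z.1 z.2|%:E).
  by apply/measurable_EFinP; exact: measurableT_comp.
have F0 (z : sgX e predT * sgX X predT) : (0 <= `|F z.1 z.2|%:E)%E by rewrite lee_fin.
have E := @diag_integral_ge0 _ _ _ P _ _ _ _ ie iX (fun z => `|F z.1 z.2|%:E)%E UV mF' F0.
have b0 w : 0 <= b w by apply: le_trans (bF w); exact: Ex_ge0.
have le : (\int[P]_w `|F w w|%:E <= \int[P]_w (b w)%:E)%E.
  rewrite [leLHS]E; apply: ge0_le_integral => //.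
  - by move=> w _; apply: integral_ge0 => w' _; rewrite lee_fin.
  - have := measurable_fun_fubini_tonelli_F (m2 := distribution P iX) _ mF' F0 => m.
    have := measurableT_comp m (@measurable_funP _ _ _ _ setT ie).
    apply: eq_measurable_fun => w _ /=; rewrite /fubini_F ge0_integral_distribution//.
    exact: (@measurable_fun_pair2 _ _ _ (sgX e predT) _ _ _ w mF').
  - by apply/measurable_EFinP; exact: L1_meas lb.
  - by move=> w _; rewrite -(Ex_fin (L1_abs (lF w))) lee_fin.
have l : L1 P (fun w => F w w).
  apply/integrableP; split; first by apply/measurable_EFinP; exact: jmeas_diag.
  by apply: le_lt_trans le _; rewrite -(Ex_fin lb) ltry.
by split => //; move: le; rewrite -(Ex_fin (L1_abs l)) -(Ex_fin lb) lee_fin.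
Qed.

End quenched.

(** * The kernel and its degenerate part *)

Section kernel_projection.
Context {d : measure_display} {T : measurableType d} {R : realType}.
Variable P : probability T R.
Local Notation mu := (@lebesgue_measure R).
Local Notation Rm := (measurableTypeR R).
Variables (X : nat -> {RV P >-> R}) (f : R -> R) (M : R).
Hypothesis Xf : is_density P (X 0%N) f.
Hypothesis fM : forall x, `|f x| <= M.
Hypothesis f_unif : forall eps : R, 0 < eps -> exists2 delta : R, 0 < delta &
  forall x y, `|x - y| < delta -> `|f x - f y| < eps.
Variables (K : R -> R) (MK : R).
Hypothesis mK : measurable_fun setT K.
Hypothesis K0 : forall x, 0 <= K x.
Hypothesis K1 : (\int[mu]_x (K x)%:E = 1)%E.
Hypothesis KN : forall x, K (- x) = K x.
Hypothesis KM : forall x, K x <= MK.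

Let M0 : 0 <= M. Proof. exact: le_trans (normr_ge0 _) (fM 0). Qed.
Let MK0 : 0 <= MK. Proof. exact: le_trans (K0 0) (KM 0). Qed.

Let mKm : measurable_fun setT (K : Rm -> R).
Proof. by move=> _ A mA; have := mK measurableT mA. Qed.

Let iK : mu.-integrable setT (EFin \o K).
Proof.
apply/integrableP; split; first exact/measurable_EFinP.
under eq_integral do rewrite /= ger0_norm//.
by rewrite K1 ltry.
Qed.

Let lK : lint K = 1. Proof. by rewrite /lint K1. Qed.

Let mK2 : measurable_fun setT (fun x : Rm => K x ^+ 2).
Proof. exact: measurable_funX. Qed.

Let K2M x : K x ^+ 2 <= MK ^+ 2.
Proof. by rewrite lerXn2r ?nnegrE. Qed.

Let K2K x : K x ^+ 2 <= MK * K x.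
Proof. by rewrite expr2 ler_wpM2r. Qed.

Let iK2 : mu.-integrable setT (EFin \o (fun x => K x ^+ 2)).
Proof.
apply: (le_integrable measurableT _ _ (integrableZl measurableT MK iK)).
  exact/measurable_EFinP.
move=> x _ /=; rewrite lee_fin ger0_norm ?sqr_ge0// ger0_norm ?mulr_ge0//.
Qed.

(** If the integral of [K^2] were zero, [K] would vanish almost everywhere, against its integral
    being 1. *)
Lemma lint_sqr_gt0 : 0 < lint (fun x => K x ^+ 2).
Proof.
rewrite lt_neqAle lint_ge0 ?andbT; last by move=> x; exact: sqr_ge0.
apply/eqP => e0.
have i0 : (\int[mu]_x (K x ^+ 2)%:E = 0)%E.
  have fn : (\int[mu]_x (K x ^+ 2)%:E \is a fin_num)%E by exact: integrable_fin_num iK2.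
  by move: e0; rewrite /lint => e0; rewrite -(fineK fn) -e0.
have m2 : measurable_fun setT (fun x : Rm => (K x ^+ 2)%:E) by exact/measurable_EFinP.
have := (ae_eq_integral_abs mu measurableT m2).1.
under eq_integral do rewrite gee0_abs ?lee_fin ?sqr_ge0//.
move=> /(_ i0) ae0.
have : (\int[mu]_x (K x)%:E = \int[mu]_x 0)%E.
  apply: ae_eq_integral => //; first exact/measurable_EFinP.
  apply: filterS ae0 => x h _; have := h I => /= -[] /eqP; rewrite sqrf_eq0 => /eqP ->//.
by rewrite K1 integral0 => /eqP; rewrite onee_eq0.
Qed.

Section fixed_bandwidth.
Variable h : R.
Hypothesis h0 : 0 < h.
Hypothesis h1 : h <= 1.

(** The Hoeffding components of the kernel at bandwidth [h]: [Kmu] is its mean, [Kg] the centred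
    projection on one variable, [KH] the part that averages to zero in each variable. *)
Definition Km y := kmean (X 0%N) K h y.
Definition Kmu := Ex P (fun w => Km (X 0%N w)).
Definition Kg y := Km y - Kmu.
Definition KH x y := K ((x - y) / h) - Km x - Km y + Kmu.

Lemma Km_bnd y : 0 <= Km y <= h * M.
Proof. by have := kmean_bound Xf fM mKm K0 KM iK y h0; rewrite lK mulr1. Qed.

Let hM : 0 <= h * M. Proof. by rewrite mulr_ge0// ltW. Qed.

Let mKxy : measurable_fun setT (fun z : R * R => K ((z.1 - z.2) / h)).
Proof.
apply: (measurableT_comp mK); apply: measurable_funM => //; exact: measurable_funB.
Qed.

Lemma Km_meas : measurable_fun setT Km.
Proof.
apply: (@Ex_param_measurable _ _ _ P _ R (fun y w => K ((X 0%N w - y) / h)) MK); last first.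
  by move=> y w; rewrite ger0_norm.
apply: (measurableT_comp mK); apply: measurable_funM => //; apply: measurable_funB => //.
exact: (measurableT_comp (@measurable_funP _ _ _ _ setT (X 0%N)) (@measurable_snd _ _ R T)).
Qed.

Let mmX : measurable_fun setT (fun w => Km (X 0%N w)).
Proof. exact: (measurableT_comp Km_meas). Qed.

Let lmX : L1 P (fun w => Km (X 0%N w)).
Proof.
by apply: (@L1_bnd _ _ _ _ _ (h * M)) => // w; have /andP[a b] := Km_bnd (X 0%N w); rewrite ger0_norm.
Qed.

Lemma Kmu_bnd : 0 <= Kmu <= h * M.
Proof.
apply/andP; split; first by apply: Ex_ge0 => w; case/andP: (Km_bnd (X 0%N w)).
by apply: Ex_le_cst => // w; case/andP: (Km_bnd (X 0%N w)).
Qed.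

Lemma Kg_bnd y : `|Kg y| <= h * M.
Proof.
by have /andP[a b] := Km_bnd y; have /andP[a' b'] := Kmu_bnd; rewrite ler_norml; apply/andP; split; rewrite /Kg; lra.
Qed.

Lemma Kg_meas : measurable_fun setT Kg.
Proof. by apply: measurable_funB => //; exact: Km_meas. Qed.

Lemma Kg_mean : Ex P (fun w => Kg (X 0%N w)) = 0.
Proof. by rewrite ExB//; [rewrite Ex_cst subrr|exact: L1_cst]. Qed.

Lemma Kg_sqr : 0 <= Ex P (fun w => Kg (X 0%N w) ^+ 2) <= (h * M) ^+ 2.
Proof.
have b y : Kg y ^+ 2 <= (h * M) ^+ 2.
  by rewrite -(real_normK (num_real (Kg y))) lerXn2r ?nnegrE// Kg_bnd.
apply/andP; split; first by apply: Ex_ge0 => w; exact: sqr_ge0.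
apply: Ex_le_cst => //; apply: (@L1_bnd _ _ _ _ _ ((h * M) ^+ 2)) => [|w].
  by apply: measurable_funX; exact: (measurableT_comp Kg_meas).
by rewrite ger0_norm ?sqr_ge0.
Qed.

Lemma KH_meas : measurable_fun setT (fun z : R * R => KH z.1 z.2).
Proof.
apply: measurable_funD => //; apply: measurable_funB; first apply: measurable_funB => //.
- exact: (measurableT_comp Km_meas (@measurable_fst _ _ R R)).
- exact: (measurableT_comp Km_meas (@measurable_snd _ _ R R)).
Qed.

Let Ksym x y : K ((x - y) / h) = K ((y - x) / h).
Proof. by rewrite -KN -mulNr opprB. Qed.

Lemma KH_sym x y : KH x y = KH y x.
Proof. by rewrite /KH Ksym; ring. Qed.

(** What [KH] takes away from the kernel. It is uniformly of order [h], so it perturbs second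
    moments, themselves of order [h], only by order [h^2]. *)
Let r x y := Km x + Km y - Kmu.

Let KHE x y : KH x y = K ((y - x) / h) - r x y.
Proof. by rewrite /KH /r Ksym; ring. Qed.

Let r_bnd x y : `|r x y| <= 2 * (h * M).
Proof.
have /andP[a b] := Km_bnd x; have /andP[a1 b1] := Km_bnd y; have /andP[a' b'] := Kmu_bnd.
by rewrite ler_norml; apply/andP; split; rewrite /r; lra.
Qed.

Lemma KH_bnd x y : `|KH x y| <= MK + 2 * M.
Proof.
rewrite KHE; apply: (le_trans (ler_normB _ _)); rewrite ger0_norm//; apply: lerD => //.
by apply: (le_trans (r_bnd _ _)); rewrite ler_pM2l// ler_piMl.
Qed.

Let lKx x : L1 P (fun w => K ((X 0%N w - x) / h)).
Proof. exact: (@kmean_L1 _ _ _ _ _ _ MK). Qed.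

Let EK x : Ex P (fun w => K ((X 0%N w - x) / h)) = Km x. Proof. by []. Qed.

Lemma KH_deg x : Ex P (fun w => KH x (X 0%N w)) = 0.
Proof.
have l1 : L1 P (fun w => r x (X 0%N w)).
  by apply: L1B; [apply: L1D => //; exact: L1_cst|exact: L1_cst].
rewrite (@eq_Ex _ _ _ _ _ (fun w => K ((X 0%N w - x) / h) - r x (X 0%N w))); last by move=> w; exact: KHE.
rewrite ExB// /r ExB; [|by apply: L1D => //; exact: L1_cst|exact: L1_cst].
rewrite ExD//; last exact: L1_cst.
by rewrite !Ex_cst EK -/Kmu; ring.
Qed.

Let KHsq x y : `|KH x y ^+ 2 - K ((y - x) / h) ^+ 2| <= 4 * (h * M) * K ((y - x) / h) + 4 * (h * M) ^+ 2.
Proof.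
rewrite KHE; set k := K _; have k0 : 0 <= k by exact: K0.
have rb := r_bnd x y.
have -> : (k - r x y) ^+ 2 - k ^+ 2 = r x y ^+ 2 - 2 * k * r x y by ring.
apply: (le_trans (ler_normB _ _)); rewrite normrX normrM (ger0_norm (mulr_ge0 _ k0))//.
have e1 : `|r x y| ^+ 2 <= (2 * (h * M)) ^+ 2 by rewrite lerXn2r ?nnegrE ?mulr_ge0// ltW.
have e2 : k * `|r x y| <= k * (2 * (h * M)) by rewrite ler_wpM2l.
lra.
Qed.

Let lKx2 x : L1 P (fun w => K ((X 0%N w - x) / h) ^+ 2).
Proof. by apply: (@kmean_L1 _ _ _ _ _ (fun x => K x ^+ 2) (MK ^+ 2)) => // y; exact: sqr_ge0. Qed.

Let lKH2 x : L1 P (fun w => KH x (X 0%N w) ^+ 2).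
Proof.
apply: (@L1_bnd _ _ _ _ _ ((MK + 2 * M) ^+ 2)).
  apply: measurable_funX; exact: (measurableT_comp (measurable_fun_pair2 x KH_meas)).
by move=> w; rewrite normrX lerXn2r ?nnegrE ?KH_bnd// addr_ge0// mulr_ge0.
Qed.

Let KHsq_mean x :
  `|Ex P (fun w => KH x (X 0%N w) ^+ 2) - kmean (X 0%N) (fun u => K u ^+ 2) h x| <= 8 * (h * M) ^+ 2.
Proof.
rewrite -ExB//.
have lr : L1 P (fun w => 4 * (h * M) * K ((X 0%N w - x) / h) + 4 * (h * M) ^+ 2).
  by apply: L1D; [exact: L1Z|exact: L1_cst].
apply: (le_trans (Ex_abs_le (L1B (lKH2 x) (lKx2 x)) lr _)); first by move=> w; exact: KHsq.
rewrite ExD; [|exact: L1Z|exact: L1_cst]; rewrite ExZ// Ex_cst EK.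
have /andP[_ b] := Km_bnd x; have := ler_wpM2l hM b; lra.
Qed.

Lemma KH_sqr x : Ex P (fun w => KH x (X 0%N w) ^+ 2) <= (MK * M + 8 * M ^+ 2) * h.
Proof.
have := KHsq_mean x; rewrite ler_norml => /andP[_ b].
have k2 : kmean (X 0%N) (fun u => K u ^+ 2) h x <= MK * Km x.
  rewrite /kmean /Km /kmean -ExZ//; apply: Ex_le => //; first exact: L1Z.
have /andP[_ c] := Km_bnd x; have c' := ler_wpM2l MK0 c.
have hh : h ^+ 2 * M ^+ 2 <= h * M ^+ 2 by rewrite ler_wpM2r ?sqr_ge0// expr2 ler_piMl// ltW.
lra.
Qed.

(** The analogue of [Gk] for the kernel before projection. It is nonnegative and dominates [Gk] up
    to order [h^2]. *)
Let Gam x y := Ex P (fun w => K ((X 0%N w - x) / h) * K ((X 0%N w - y) / h)).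

Let lKK x y : L1 P (fun w => K ((X 0%N w - x) / h) * K ((X 0%N w - y) / h)).
Proof.
apply: (@L1_bnd _ _ _ _ _ (MK * MK)) => [|w]; last by rewrite normrM ler_pM// ger0_norm.
by apply: measurable_funM; exact: L1_meas (lKx _).
Qed.

Let Gam_bnd x y : 0 <= Gam x y <= MK * (h * M).
Proof.
apply/andP; split; first by apply: Ex_ge0 => w; exact: mulr_ge0.
have /andP[_ c] := Km_bnd y; apply: le_trans (ler_wpM2l MK0 c).
by rewrite /Km /kmean -ExZ//; apply: Ex_le => //; [exact: L1Z|move=> w; rewrite ler_wpM2r].
Qed.

Let lKHKH x y : L1 P (fun w => KH x (X 0%N w) * KH y (X 0%N w)).
Proof.
apply: (@L1_bnd _ _ _ _ _ ((MK + 2 * M) ^+ 2)).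
  by apply: measurable_funM; exact: (measurableT_comp (measurable_fun_pair2 _ KH_meas)).
by move=> w; rewrite normrM expr2 ler_pM ?KH_bnd.
Qed.

Let Gk_Gam x y : `|Gk X KH x y| <= Gam x y + 8 * (h * M) ^+ 2.
Proof.
have lr : L1 P (fun w => K ((X 0%N w - x) / h) * K ((X 0%N w - y) / h) +
    (2 * (h * M) * K ((X 0%N w - x) / h) + (2 * (h * M) * K ((X 0%N w - y) / h) + 4 * (h * M) ^+ 2))).
  apply: L1D => //; apply: L1D; first exact: L1Z.
  by apply: L1D; [exact: L1Z|exact: L1_cst].
apply: (le_trans (Ex_abs_le (lKHKH x y) lr _)).
  move=> w; rewrite !KHE; set z := X 0%N w.
  set k := K _; set k' := K _; have k0 : 0 <= k by exact: K0.
  have k0' : 0 <= k' by exact: K0.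
  have rb := r_bnd x z; have rb' := r_bnd y z.
  have -> : (k - r x z) * (k' - r y z) = k * k' - k' * r x z - k * r y z + r x z * r y z by ring.
  have e1 : k * `|r y z| <= k * (2 * (h * M)) by rewrite ler_wpM2l.
  have e2 : k' * `|r x z| <= k' * (2 * (h * M)) by rewrite ler_wpM2l.
  have e3 : `|r x z| * `|r y z| <= (2 * (h * M)) * (2 * (h * M)) by rewrite ler_pM.
  apply: (le_trans (ler_normD _ _)); rewrite normrM.
  have : `|k * k' - k' * r x z - k * r y z| <= k * k' + k' * `|r x z| + k * `|r y z|.
    apply: (le_trans (ler_normB _ _)); rewrite [`|k * r _ _|]normrM (ger0_norm k0) lerD2r.
    apply: (le_trans (ler_normB _ _)); rewrite normrM (ger0_norm k0) (ger0_norm k0') normrM (ger0_norm k0')//.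
  lra.
rewrite ExD//; last first.
  by apply: L1D; [exact: L1Z|apply: L1D; [exact: L1Z|exact: L1_cst]].
rewrite -/(Gam x y) lerD2l ExD; [|exact: L1Z|by apply: L1D; [exact: L1Z|exact: L1_cst]].
rewrite ExD; [|exact: L1Z|exact: L1_cst].
rewrite Ex_cst !ExZ// !EK.
have /andP[_ b] := Km_bnd x; have /andP[_ b'] := Km_bnd y.
have := ler_wpM2l hM b; have := ler_wpM2l hM b'; lra.
Qed.

(** [Gam] is at most of order [h] pointwise and of order [h^2] in mean over one argument, so its
    square has mean of order [h^3]: one power of [h] more than the square of the bound in [KH_sqr].
    The constant [128] is [2 * 8^2]. *)
Lemma Gk_KH_sqr : Ex P (fun w => Ex P (fun w' => Gk X KH (X 0%N w') (X 0%N w) ^+ 2)) <=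
  (2 * MK * M ^+ 3 + 128 * M ^+ 4) * h ^+ 3.
Proof.
have C0 : 0 <= MK + 2 * M by rewrite addr_ge0// mulr_ge0.
have mG := Gk_meas X KH_meas KH_bnd.
have bG := Gk_bnd X KH_meas KH_bnd.
have bG2 x y : `|Gk X KH x y ^+ 2| <= ((MK + 2 * M) ^+ 2) ^+ 2.
  by rewrite normrX lerXn2r ?nnegrE ?sqr_ge0// bG.
have lG y : L1 P (fun w' => Gk X KH (X 0%N w') y ^+ 2).
  apply: (@L1_bnd _ _ _ _ _ (((MK + 2 * M) ^+ 2) ^+ 2)) => [|w]; last exact: bG2.
  by apply: measurable_funX; exact: (measurableT_comp (measurable_fun_pair1 y mG)).
have mKXX : measurable_fun setT (fun z : T * T => K ((X 0%N z.2 - X 0%N z.1) / h)).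
  apply: (measurableT_comp mK); apply: measurable_funM => //; apply: measurable_funB.
  - exact: (measurableT_comp (@measurable_funP _ _ _ _ setT (X 0%N)) (@measurable_snd _ _ T T)).
  - exact: (measurableT_comp (@measurable_funP _ _ _ _ setT (X 0%N)) (@measurable_fst _ _ T T)).
have mF y : measurable_fun setT (fun z : T * T => K ((X 0%N z.2 - X 0%N z.1) / h) * K ((X 0%N z.2 - y) / h)).
  apply: measurable_funM => //.
  apply: (measurableT_comp mK); apply: measurable_funM => //; apply: measurable_funB => //.
  exact: (measurableT_comp (@measurable_funP _ _ _ _ setT (X 0%N)) (@measurable_snd _ _ T T)).
have bF y w w' : `|K ((X 0%N w' - X 0%N w) / h) * K ((X 0%N w' - y) / h)| <= MK * MK.
  by rewrite normrM ler_pM// ger0_norm.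
have lGam y : L1 P (fun w' => Gam (X 0%N w') y).
  apply: (@L1_bnd _ _ _ _ _ (MK * (h * M))) => [|w]; last by have /andP[a b] := Gam_bnd (X 0%N w) y; rewrite ger0_norm.
  exact: (@Ex_param_measurable _ _ _ P _ _ (fun w w' => K ((X 0%N w' - X 0%N w) / h) * K ((X 0%N w' - y) / h)) (MK * MK)).
have EGam y : Ex P (fun w' => Gam (X 0%N w') y) <= (h * M) * (h * M).
  rewrite /Gam (@Ex_swap _ _ _ P (fun w w' => K ((X 0%N w' - X 0%N w) / h) * K ((X 0%N w' - y) / h)) (MK * MK))//.
  have /andP[_ b] := Km_bnd y; apply: le_trans (ler_wpM2l hM b).
  have E w' : Ex P (fun w => K ((X 0%N w' - X 0%N w) / h) * K ((X 0%N w' - y) / h)) =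
     Km (X 0%N w') * K ((X 0%N w' - y) / h).
    rewrite (@eq_Ex _ _ _ _ _ (fun w => K ((X 0%N w' - y) / h) * K ((X 0%N w - X 0%N w') / h))).
      by rewrite ExZ// mulrC.
    by move=> w; rewrite [RHS]mulrC; congr (_ * _); exact: Ksym.
  rewrite (eq_Ex P E) -[Km y]EK -ExZ//; apply: Ex_le.
  - apply: (@L1_bnd _ _ _ _ _ ((h * M) * MK)).
      by apply: measurable_funM => //; exact: L1_meas (lKx y).
    move=> w; rewrite normrM ler_pM// ger0_norm//; by have /andP[a c] := Km_bnd (X 0%N w).
  - exact: L1Z.
  - by move=> w; rewrite ler_wpM2r//; have /andP[a c] := Km_bnd (X 0%N w).
have pt y : Ex P (fun w' => Gk X KH (X 0%N w') y ^+ 2) <= (2 * MK * M ^+ 3 + 128 * M ^+ 4) * h ^+ 3.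
  have lr : L1 P (fun w' => 2 * (MK * (h * M)) * Gam (X 0%N w') y + 128 * (h * M) ^+ 4).
    by apply: L1D; [exact: L1Z|exact: L1_cst].
  apply: (le_trans (Ex_le (lG y) lr _)).
    move=> w'; set x := X 0%N w'.
    have /andP[g0 g1] := Gam_bnd x y; have gg := ler_wpM2r g0 g1.
    have e1 : Gk X KH x y ^+ 2 <= (Gam x y + 8 * (h * M) ^+ 2) ^+ 2.
      rewrite -(real_normK (num_real (Gk X KH x y))) lerXn2r ?nnegrE// ?Gk_Gam//.
      by rewrite addr_ge0// mulr_ge0// sqr_ge0.
    have := sqr_ge0 (Gam x y - 8 * (h * M) ^+ 2); lra.
  rewrite ExD ?Ex_cst; [|exact: L1Z|exact: L1_cst]; rewrite ExZ//.
  have MhM : 0 <= 2 * (MK * (h * M)) by rewrite !mulr_ge0// ltW.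
  have e2 := ler_wpM2l MhM (EGam y).
  have e3 : (h * M) ^+ 4 <= M ^+ 4 * h ^+ 3.
    rewrite exprMn mulrC ler_wpM2l ?exprn_ge0// exprS ler_piMl// exprn_ge0// ltW//.
  lra.
apply: Ex_le_cst => //.
apply: (@L1_bnd _ _ _ _ _ (((MK + 2 * M) ^+ 2) ^+ 2)); last first.
  by move=> w; apply: Ex_abs_le_cst.
apply: (@Ex_param_measurable _ _ _ P _ _ (fun w w' => Gk X KH (X 0%N w') (X 0%N w) ^+ 2) (((MK + 2 * M) ^+ 2) ^+ 2)) => //.
apply: measurable_funX.
have m1 := measurableT_comp (@measurable_funP _ _ _ _ setT (X 0%N)) (@measurable_snd _ _ T T).
have m2 := measurableT_comp (@measurable_funP _ _ _ _ setT (X 0%N)) (@measurable_fst _ _ T T).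
exact: (measurableT_comp mG (measurable_fun_pair m1 m2)).
Qed.

Lemma qH_kmean : `|qH X KH - Ex P (fun w => kmean (X 0%N) (fun u => K u ^+ 2) h (X 0%N w))| <= 8 * (h * M) ^+ 2.
Proof.
have E : qH X KH = Ex P (fun w => Ex P (fun w' => KH (X 0%N w) (X 0%N w') ^+ 2)).
  by apply: eq_Ex => w; apply: eq_Ex => w'; rewrite expr2.
have mXX : measurable_fun setT (fun z : T * T => (X 0%N z.1, X 0%N z.2)).
  apply: measurable_fun_pair.
  - exact: (measurableT_comp (@measurable_funP _ _ _ _ setT (X 0%N)) (@measurable_fst _ _ T T)).
  - exact: (measurableT_comp (@measurable_funP _ _ _ _ setT (X 0%N)) (@measurable_snd _ _ T T)).
have l1 : L1 P (fun w => Ex P (fun w' => KH (X 0%N w) (X 0%N w') ^+ 2)).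
  have b x y : `|KH x y ^+ 2| <= (MK + 2 * M) ^+ 2.
    by rewrite normrX lerXn2r ?nnegrE ?KH_bnd// addr_ge0// mulr_ge0.
  apply: (@L1_bnd _ _ _ _ _ ((MK + 2 * M) ^+ 2)) => [|w]; last exact: Ex_abs_le_cst.
  apply: (@Ex_param_measurable _ _ _ P _ _ (fun w w' => KH (X 0%N w) (X 0%N w') ^+ 2) ((MK + 2 * M) ^+ 2)) => //.
  apply: measurable_funX; exact: (measurableT_comp KH_meas mXX).
have l2 : L1 P (fun w => kmean (X 0%N) (fun u => K u ^+ 2) h (X 0%N w)).
  have b x : `|K x ^+ 2| <= MK ^+ 2 by rewrite ger0_norm ?sqr_ge0.
  apply: (@L1_bnd _ _ _ _ _ (MK ^+ 2)) => [|w]; last exact: Ex_abs_le_cst.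
  apply: (@Ex_param_measurable _ _ _ P _ _ (fun w w' => K ((X 0%N w' - X 0%N w) / h) ^+ 2) (MK ^+ 2)) => //.
  apply: measurable_funX; apply: (measurableT_comp mK); apply: measurable_funM => //.
  apply: measurable_funB.
  - exact: (measurableT_comp (@measurable_snd _ _ R R) mXX).
  - exact: (measurableT_comp (@measurable_fst _ _ R R) mXX).
by rewrite E -ExB//; apply: Ex_abs_le_cst => //; exact: L1B.
Qed.

End fixed_bandwidth.

Let mean_approx k Mk eps : measurable_fun setT (k : Rm -> R) -> (forall x, 0 <= k x) ->
  (forall x, k x <= Mk) -> mu.-integrable setT (EFin \o k) -> 0 < eps ->
  exists2 h0 : R, 0 < h0 & forall h, 0 < h < h0 ->
    `|Ex P (fun w => kmean (X 0%N) k h (X 0%N w)) / h - lint (fun y => f y ^+ 2) * lint k| <= eps.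
Proof.
move=> mk k0 kM ik e0; have [h0 hh0 H] := kmean_approx Xf fM f_unif mk k0 kM ik e0.
exists h0 => // h hh; have h_gt0 : 0 < h by case/andP: hh.
have [lf <-] := Ex_density Xf fM.
have lk : L1 P (fun w => kmean (X 0%N) k h (X 0%N w)).
  have b x : `|k x| <= Mk by rewrite ger0_norm.
  apply: (@L1_bnd _ _ _ _ _ Mk) => [|w]; last by apply: Ex_abs_le_cst => //; exact: (@kmean_L1 _ _ _ _ _ _ Mk).
  apply: (@Ex_param_measurable _ _ _ P _ _ (fun w w' => k ((X 0%N w' - X 0%N w) / h)) Mk) => //.
  apply: (measurableT_comp mk); apply: measurable_funM => //; apply: measurable_funB.
  - exact: (measurableT_comp (@measurable_funP _ _ _ _ setT (X 0%N)) (@measurable_snd _ _ T T)).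
  - exact: (measurableT_comp (@measurable_funP _ _ _ _ setT (X 0%N)) (@measurable_fst _ _ T T)).
rewrite mulrC [Ex P (fun w => f _) * _]mulrC -!ExZ// -ExB; [|exact: L1Z|exact: L1Z].
apply: Ex_abs_le_cst; first by apply: L1B; exact: L1Z.
by move=> w; rewrite mulrC [_ * f _]mulrC; exact: H.
Qed.

Lemma Kmu_approx eps : 0 < eps -> exists2 h0 : R, 0 < h0 & forall h, 0 < h < h0 ->
  `|Kmu h / h - lint (fun y => f y ^+ 2)| <= eps.
Proof.
move=> e0; have [h0 hh0 H] := mean_approx mKm K0 KM iK e0.
by exists h0 => // h /H; rewrite lK mulr1.
Qed.

Lemma qH_approx eps : 0 < eps -> exists2 h0 : R, 0 < h0 & forall h, 0 < h < h0 ->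
  `|qH X (KH h) / h - lint (fun y => f y ^+ 2) * lint (fun x => K x ^+ 2)| <= eps.
Proof.
move=> e0; have e2 : 0 < eps / 2 by rewrite divr_gt0.
have [h0 hh0 H] := mean_approx mK2 (fun x => sqr_ge0 (K x)) K2M iK2 e2.
have D0 : 0 < 16 * (M ^+ 2 + 1) by rewrite mulr_gt0// ltr_wpDl ?sqr_ge0.
(* The last bound on [h] makes the projection error [8 * h * M ^ 2] at most [eps / 2]. *)
exists (Num.min h0 (Num.min 1 (eps / (16 * (M ^+ 2 + 1))))).
  by rewrite !lt_min hh0 ltr01 divr_gt0.
move=> h /andP[h_gt0]; rewrite !lt_min => /andP[hh /andP[hlt1 he]].
have hh' : 0 < h < h0 by rewrite h_gt0.
have := H h hh'; set q2 := Ex P _; set L := lint _ * lint _ => a.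
have b := qH_kmean h_gt0 (ltW hlt1).
have -> : qH X (KH h) / h - L = (qH X (KH h) - q2) / h + (q2 / h - L) by field; rewrite gt_eqF.
apply: (le_trans (ler_normD _ _)).
suff : `|(qH X (KH h) - q2) / h| <= eps / 2 by lra.
rewrite normrM normfV (gtr0_norm h_gt0) ler_pdivrMr//; apply: (le_trans b).
rewrite ltr_pdivlMr// in he.
have := ler_wpM2l (ltW h_gt0) (ltW he); have := sqr_ge0 h; rewrite exprMn expr2; lra.
Qed.

End kernel_projection.

(** * Decomposition of the quadratic form *)

Section decomposition.
Context {R : realType}.

Lemma off_diagonal_sum (F : nat -> nat -> R) n : (forall s t, F s t = F t s) ->
  \sum_(t < n) \sum_(s < n | s != t) F s t = 2 * \sum_(t < n) \sum_(s < t) F s t.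
Proof.
move=> symF; pose G s t := if s != t then F s t else 0.
have GF k : \sum_(t < k) \sum_(s < k | s != t) F s t = \sum_(t < k) \sum_(s < k) G s t.
  by apply: eq_bigr => t _; rewrite big_mkcond.
rewrite GF; elim: n => [|n IH]; first by rewrite !big_ord0 mulr0.
rewrite !big_ord_recr /= mulrDr -IH.
have Gn (s : 'I_n) : G s n = F s n /\ G n s = F s n.
  by rewrite /G (ltn_eqF (ltn_ord s)) eq_sym (ltn_eqF (ltn_ord s)) /= symF.
have -> : \sum_(t < n) \sum_(s < n.+1) G s t = \sum_(t < n) \sum_(s < n) G s t + \sum_(t < n) F t n.
  by rewrite -big_split /=; apply: eq_bigr => t _; rewrite big_ord_recr /= (Gn t).2.
have -> : \sum_(i < n) G i n = \sum_(t < n) F t n by apply: eq_bigr => t _; exact: (Gn t).1.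
by rewrite {2}/G eqxx /= addr0 -addrA; congr (_ + _); lra.
Qed.

(** An algebraic identity in the weights and points, for any [m] and [mu]; they become kernel means
    only later. Each index meets all the others, which explains the weights of the linear part, and
    the missing diagonal accounts for the subtracted sum of squares. *)
Lemma hoeffding_decomposition (k : R -> R -> R) (m : R -> R) (mu : R) (a x : nat -> R) n :
  (forall u v, k u v = k v u) ->
  \sum_(t < n) \sum_(s < n | s != t) a s * k (x s) (x t) * a t =
  \sum_(t < n) 2 * a t * (\sum_(s < t) a s * (k (x s) (x t) - m (x s) - m (x t) + mu)) +
  2 * (\sum_(s < n) a s * (\sum_(i < n) a i - a s) * (m (x s) - mu)) +
  mu * ((\sum_(i < n) a i) ^+ 2 - \sum_(i < n) a i ^+ 2).
Proof.
move=> symk; rewrite (@off_diagonal_sum (fun s t => a s * k (x s) (x t) * a t)); last first.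
  by move=> s t; rewrite symk; ring.
elim: n => [|n IH]; first by rewrite !big_ord0; ring.
rewrite !big_ord_recr /= mulrDr IH.
set A := \sum_(i < n) a i; set B := \sum_(i < n) a i ^+ 2.
have -> : \sum_(i < n) a i * k (x i) (x n) * a n = a n * \sum_(i < n) a i * k (x i) (x n).
  by rewrite mulr_sumr; apply: eq_bigr => i _; ring.
have -> : \sum_(s < n) a s * (k (x s) (x n) - m (x s) - m (x n) + mu) =
    \sum_(s < n) a s * k (x s) (x n) - \sum_(s < n) a s * (m (x s) - mu) - A * m (x n).
  by rewrite /A mulr_suml -!sumrB; apply: eq_bigr => i _; ring.
have -> : \sum_(i < n) a i * (A + a n - a i) * (m (x i) - mu) =
    \sum_(s < n) a s * (A - a s) * (m (x s) - mu) + a n * \sum_(s < n) a s * (m (x s) - mu).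
  by rewrite mulr_sumr -big_split /=; apply: eq_bigr => i _; ring.
ring.
Qed.

Lemma sum_centered_sqr (a : nat -> R) n :
  \sum_(s < n) (a s * (\sum_(i < n) a i - a s)) ^+ 2 <=
  2 * ((\sum_(i < n) a i) ^+ 2 + \sum_(i < n) a i ^+ 2) * \sum_(i < n) a i ^+ 2.
Proof.
set A := \sum_(i < n) a i; set B := \sum_(i < n) a i ^+ 2.
rewrite [leRHS]mulr_sumr; apply: ler_sum => s _; rewrite exprMn mulrC ler_wpM2r ?sqr_ge0//.
have : a s ^+ 2 <= B by rewrite /B (bigD1 s)//= lerDl sumr_ge0// => i _; exact: sqr_ge0.
have := sqr_ge0 (A + a s); lra.
Qed.

End decomposition.

Section kernel_quadratic_form.
Context {d : measure_display} {T : measurableType d} {R : realType}.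
Variable P : probability T R.

Lemma L2_L1 (g : T -> R) : measurable_fun setT g -> L1 P (fun w => g w ^+ 2) -> L1 P g.
Proof.
move=> mg l; apply: (@L1_dom _ _ _ _ _ (fun w => 1 + g w ^+ 2)) => //.
  move=> w; rewrite -(real_normK (num_real (g w))); have := sqr_ge0 (`|g w| - 1).
  have := sqr_ge0 `|g w|; lra.
by apply: L1D => //; exact: L1_cst.
Qed.

Local Notation mu := (@lebesgue_measure R).
Variables (X : nat -> {RV P >-> R}) (f : R -> R) (M : R).
Hypothesis indX : mutually_indep P (fun i => X i : T -> R).
Hypothesis idX : ident_distr P (fun i => X i : T -> R).
Hypothesis Xf : is_density P (X 0%N) f.
Hypothesis fM : forall x, `|f x| <= M.
Variables (K : R -> R) (MK : R).
Hypothesis mK : measurable_fun setT K.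
Hypothesis K0 : forall x, 0 <= K x.
Hypothesis K1 : (\int[mu]_x (K x)%:E = 1)%E.
Hypothesis KN : forall x, K (- x) = K x.
Hypothesis KM : forall x, K x <= MK.
Variable h : R.
Hypothesis h0 : 0 < h.
Hypothesis h1 : h <= 1.

Let M0 : 0 <= M. Proof. exact: le_trans (normr_ge0 _) (fM 0). Qed.
Let MK0 : 0 <= MK. Proof. exact: le_trans (K0 0) (KM 0). Qed.

Definition Kq := MK * M + 8 * M ^+ 2.

Lemma Kq_ge0 : 0 <= Kq. Proof. by rewrite addr_ge0// mulr_ge0// sqr_ge0. Qed.

Let H := KH X K h.
Let mH := KH_meas X mK K0 KM h.
Let bH := KH_bnd Xf fM mK K0 K1 KN KM h0 h1.
Let symH := KH_sym X KN h.
Let degH := KH_deg Xf fM mK K0 K1 KN KM h0.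
Let HQ := KH_sqr Xf fM mK K0 K1 KN KM h0 h1.

Section fixed_weights.
Variables (a : nat -> R) (n : nat).
Let A := \sum_(i < n) a i.
Let A2 := \sum_(i < n) a i ^+ 2.
Let A20 : 0 <= A2. Proof. by apply: sumr_ge0 => i _; exact: sqr_ge0. Qed.

(** Serves the regime where the degenerate part is negligible, so its second moment is enough. *)
Lemma Uk_abs c : L1 P (Uk X H a c n) /\
  Ex P (fun w => `|Uk X H a c n w|) <= `|c| * Num.sqrt (Kq * h) * A2.
Proof.
have [l e] := Uk_sqr indX idX mH symH bH degH a c n.
have mU := Uk_meas indX idX mH bH a c n.
have q0 : 0 <= Kq * h by rewrite mulr_ge0 ?Kq_ge0// ltW.
have := Ex_abs_sqrt mU l; rewrite e (sum_vk X H a c n) => b.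
split; first exact: L2_L1 mU l.
apply: (le_trans b).
have -> : `|c| * Num.sqrt (Kq * h) * A2 = Num.sqrt (c ^+ 2 * (Kq * h) * A2 ^+ 2).
  have c2 : 0 <= c ^+ 2 * (Kq * h) by apply: mulr_ge0 => //; exact: sqr_ge0.
  by rewrite (sqrtrM _ c2) (sqrtrM _ (sqr_ge0 c)) !sqrtr_sqr (ger0_norm A20).
apply: ler_wsqrtr; have /andP[qH0 qH1] := qH_bnd mH bH HQ.
rewrite -2!(mulrA (c ^+ 2)); apply: ler_wpM2l; first exact: sqr_ge0.
have a4 : 0 <= \sum_(s < n) a s ^+ 4 by apply: sumr_ge0 => i _; rewrite exprn_even_ge0.
have A22 := sqr_ge0 A2.
have : qH X H * ((A2 ^+ 2 - \sum_(s < n) a s ^+ 4) / 2) <= qH X H * A2 ^+ 2.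
  by apply: ler_wpM2l => //; lra.
move/le_trans; apply; exact: ler_wpM2r.
Qed.

Definition Lk w := 2 * \sum_(s < n) a s * (A - a s) * Kg X K h (X s w).

(** The second moment gives [h] times the square root of [(A^2 + A2) A2]. The free [delta] splits
    that root into a sum linear in [A^2] and [A2], whose mean over the errors is then immediate. *)
Lemma Lk_abs delta : 0 < delta -> L1 P Lk /\
  Ex P (fun w => `|Lk w|) <= 2 * (h * M) * (delta * (A ^+ 2 + A2) + A2 / delta).
Proof.
move=> d0; have mg := Kg_meas X mK K0 KM h.
have bg := Kg_bnd Xf fM mK K0 K1 KM h0.
have [l e] := weighted_sum_sqr indX idX (fun s => a s * (A - a s)) mg bg (Kg_mean Xf fM mK K0 K1 KM h0) n.
have mL : measurable_fun setT (fun w => \sum_(s < n) a s * (A - a s) * Kg X K h (X s w)).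
  apply: measurable_sum => s; apply: measurable_funM => //; exact: (measurableT_comp mg).
have l1 := L2_L1 mL l.
split; first exact: L1Z.
rewrite (@eq_Ex _ _ _ _ _ (fun w => 2 * `|\sum_(s < n) a s * (A - a s) * Kg X K h (X s w)|)); last first.
  by move=> w; rewrite normrM ger0_norm.
rewrite ExZ; last exact: L1_abs.
rewrite -!mulrA ler_pM2l//; apply: (le_trans (Ex_abs_sqrt mL l)); rewrite e.
have hM : 0 <= h * M by rewrite mulr_ge0// ltW.
set E := delta * _ + _.
have A22 : 0 <= A ^+ 2 + A2 by rewrite addr_ge0// sqr_ge0.
have E0 : 0 <= h * (M * E) by rewrite mulrA mulr_ge0// addr_ge0 ?mulr_ge0 ?invr_ge0// ltW.
rewrite -[leRHS]ger0_norm// -sqrtr_sqr; apply: ler_wsqrtr.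
have /andP[g0 g1] := Kg_sqr Xf fM mK K0 K1 KM h0.
have s1 := sum_centered_sqr a n.
apply: (@le_trans _ _ ((2 * (A ^+ 2 + A2) * A2) * (h * M) ^+ 2)).
  by apply: ler_pM => //; apply: sumr_ge0 => i _; exact: sqr_ge0.
have -> : (h * (M * E)) ^+ 2 = E ^+ 2 * (h * M) ^+ 2 by ring.
apply: ler_wpM2r; first exact: sqr_ge0.
have -> : E ^+ 2 = (delta * (A ^+ 2 + A2) - A2 / delta) ^+ 2 + 4 * ((A ^+ 2 + A2) * A2).
  by rewrite /E; field; rewrite gt_eqF.
have := sqr_ge0 (delta * (A ^+ 2 + A2) - A2 / delta); have := mulr_ge0 A22 A20; lra.
Qed.

End fixed_weights.

Variable e : nat -> {RV P >-> R}.
Hypothesis iXe : indep_families P (fun i => X i : T -> R) (fun i => e i : T -> R).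

Let jm_sum n (F : nat -> T -> T -> R) : (forall i, jmeas X e (F i)) ->
  jmeas X e (fun w w' => \sum_(i < n) F i w w').
Proof. by move=> mF; apply: measurable_sum => i; exact: mF. Qed.

Lemma jmeas_Uk c n : jmeas X e (fun w w' => Uk X H (fun i => e i w) c n w').
Proof.
apply: (@jm_sum n (fun i w w' => c * e i w * \sum_(s < i) e s w * H (X s w') (X i w'))) => i.
apply: measurable_funM; first by apply: measurable_funM => //; exact: jmeas_e.
apply: (@jm_sum i (fun s w w' => e s w * H (X s w') (X i w'))) => s.
apply: measurable_funM; first exact: jmeas_e.
exact: (measurableT_comp mH (measurable_fun_pair (@jmeas_X _ _ _ _ _ _ X e s) (@jmeas_X _ _ _ _ _ _ X e i))).
Qed.

Lemma jmeas_Lk n : jmeas X e (fun w w' => Lk (fun i => e i w) n w').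
Proof.
apply: measurable_funM => //.
apply: (@jm_sum n (fun s w w' => e s w * (\sum_(i < n) e i w - e s w) * Kg X K h (X s w'))) => s.
apply: measurable_funM.
  apply: measurable_funM; first exact: jmeas_e.
  apply: measurable_funB; last exact: jmeas_e.
  by apply: (@jm_sum n (fun i w w' => e i w)) => i; exact: jmeas_e.
exact: (measurableT_comp (Kg_meas X mK K0 KM h) (@jmeas_X _ _ _ _ _ _ X e s)).
Qed.

Let An n w := \sum_(i < n) e i w.
Let Bn n w := \sum_(i < n) e i w ^+ 2.

Lemma joint_Uk_abs c n : L1 P (Bn n) ->
  L1 P (fun w => Uk X H (fun i => e i w) c n w) /\
  Ex P (fun w => `|Uk X H (fun i => e i w) c n w|) <= `|c| * Num.sqrt (Kq * h) * Ex P (Bn n).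
Proof.
move=> lB; rewrite -ExZ//.
apply: (quenched_abs iXe (@jmeas_Uk c n)) => [w|w|]; last exact: L1Z.
- exact: (Uk_abs (fun i => e i w) n c).1.
- exact: (Uk_abs (fun i => e i w) n c).2.
Qed.

Lemma joint_Lk_abs n delta : 0 < delta -> L1 P (Bn n) -> L1 P (fun w => An n w ^+ 2) ->
  L1 P (fun w => Lk (fun i => e i w) n w) /\
  Ex P (fun w => `|Lk (fun i => e i w) n w|) <=
    2 * (h * M) * (delta * (Ex P (fun w => An n w ^+ 2) + Ex P (Bn n)) + Ex P (Bn n) / delta).
Proof.
move=> d0 lB lA.
pose b w := 2 * (h * M) * (delta * (An n w ^+ 2 + Bn n w) + delta^-1 * Bn n w).
have lb1 : L1 P (fun w => delta * (An n w ^+ 2 + Bn n w)) by apply: L1Z; exact: L1D.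
have lb2 : L1 P (fun w => delta^-1 * Bn n w) by exact: L1Z.
have lb : L1 P b by apply: L1Z; exact: L1D.
have -> : 2 * (h * M) * (delta * (Ex P (fun w => An n w ^+ 2) + Ex P (Bn n)) + Ex P (Bn n) / delta) = Ex P b.
  rewrite /b ExZ; last exact: L1D.
  rewrite ExD// !ExZ//; last exact: L1D.
  by rewrite ExD// [delta^-1 * _]mulrC.
apply: (quenched_abs iXe (@jmeas_Lk n)) => [w|w|] //.
- exact: (Lk_abs (fun i => e i w) n d0).1.
- by rewrite /b [delta^-1 * _]mulrC; exact: (Lk_abs (fun i => e i w) n d0).2.
Qed.

End kernel_quadratic_form.

(** * Central limit theorem for the degenerate part, given the errors *)

Section quenched_clt.
Context {d : measure_display} {T : measurableType d} {R : realType}.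
Variable P : probability T R.
Local Notation mu := (@lebesgue_measure R).

(** Bookkeeping kept apart from probability, with [N] the sample size: as [c^2] is of order
    [1 / (N^2 h)], the two error terms of [Uk_clt_bound] are of order [(1 / N + h)^(1/2)] and
    [1 / (N^2 h) + 1 / N]. *)
Lemma clt_error_terms (N h A1 Cq Cg CH b L A2 A4 c theta : R) :
  0 < N -> 0 < h -> 0 < A1 -> 0 <= Cq -> 0 <= Cg -> 0 <= L -> 0 < theta ->
  c ^+ 2 = 4 / (N ^+ 2 * h * A1) -> 0 <= A2 <= b * N -> 0 <= A4 <= L * N ->
  c ^+ 2 * A2 * Num.sqrt (2 * (Cq * h) ^+ 2 * A4 + 8 * (Cg * h ^+ 3) * A2 ^+ 2) <=
    4 * b / A1 * Num.sqrt (2 * Cq ^+ 2 * L / N + 8 * Cg * b ^+ 2 * h) /\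
  c ^+ 4 * A4 * (CH ^+ 2 * (Cq * h) * A4 + 3 * (Cq * h) ^+ 2 * A2 ^+ 2) / theta <=
    16 * L / A1 ^+ 2 * (CH ^+ 2 * Cq * L / (N ^+ 2 * h) + 3 * Cq ^+ 2 * b ^+ 2 / N) / theta.
Proof.
move=> N0 h0 A10 q0 cg0 L0 t0 cE /andP[A20 A2b] /andP[A40 A4b].
have N0' : N != 0 by rewrite gt_eqF.
have h0' : h != 0 by rewrite gt_eqF.
have A10' : A1 != 0 by rewrite gt_eqF.
have b0 : 0 <= b by have := le_trans A20 A2b; rewrite pmulr_lge0.
have A22 : A2 ^+ 2 <= (b * N) ^+ 2 by rewrite lerXn2r ?nnegrE// (le_trans A20).
have Cqh : 0 <= (Cq * h) ^+ 2 by exact: sqr_ge0.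
have Cgh : 0 <= Cg * h ^+ 3 by rewrite mulr_ge0// exprn_ge0// ltW.
split.
  set S := Num.sqrt (2 * Cq ^+ 2 * L / N + _).
  have S1 : Num.sqrt (2 * (Cq * h) ^+ 2 * A4 + 8 * (Cg * h ^+ 3) * A2 ^+ 2) <= N * h * S.
    have Nh : 0 <= N * h by rewrite mulr_ge0// ltW.
    have -> : N * h * S = Num.sqrt ((N * h) ^+ 2 * (2 * Cq ^+ 2 * L / N + 8 * Cg * b ^+ 2 * h)).
      by rewrite (sqrtrM _ (sqr_ge0 _)) sqrtr_sqr ger0_norm.
    apply: ler_wsqrtr.
    have -> : (N * h) ^+ 2 * (2 * Cq ^+ 2 * L / N + 8 * Cg * b ^+ 2 * h) =
       2 * (Cq * h) ^+ 2 * (L * N) + 8 * (Cg * h ^+ 3) * (b * N) ^+ 2 by field.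
    have e1 := ler_wpM2l Cqh A4b; have e2 := ler_wpM2l Cgh A22; lra.
  have S0 : 0 <= S by exact: sqrtr_ge0.
  have -> : 4 * b / A1 * S = 4 / (N ^+ 2 * h * A1) * (b * N) * (N * h * S).
    by field; rewrite N0' h0' A10'.
  rewrite cE; apply: ler_pM => //; last first.
  - apply: ler_wpM2l => //; rewrite divr_ge0// !mulr_ge0// ltW//.
  - by apply: mulr_ge0 => //; rewrite -cE; exact: sqr_ge0.
rewrite ler_pM2r ?invr_gt0//.
have -> : 16 * L / A1 ^+ 2 * (CH ^+ 2 * Cq * L / (N ^+ 2 * h) + 3 * Cq ^+ 2 * b ^+ 2 / N) =
   (4 / (N ^+ 2 * h * A1)) ^+ 2 * (L * N) * (CH ^+ 2 * (Cq * h) * (L * N) + 3 * (Cq * h) ^+ 2 * (b * N) ^+ 2).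
  by field; rewrite N0' h0' A10'.
have -> : c ^+ 4 = (4 / (N ^+ 2 * h * A1)) ^+ 2 by rewrite -cE -exprM.
set D := (4 / _) ^+ 2; have D0 : 0 <= D by exact: sqr_ge0.
have Ch : 0 <= CH ^+ 2 * (Cq * h) by apply: mulr_ge0; [exact: sqr_ge0|rewrite mulr_ge0// ltW].
apply: ler_pM.
- exact: mulr_ge0.
- by apply: addr_ge0; apply: mulr_ge0 => //; [apply: mulr_ge0 => //|exact: sqr_ge0].
- exact: ler_wpM2l.
- have e1 := ler_wpM2l Ch A4b; have e2 := ler_wpM2l Cqh A22; lra.
Qed.

(** A product of two factors near 1: the kernel variance against its limit, and the squared weights
    against [g], with the fourth powers as an error. *)
Lemma variance_ratio (qh q a2 a4 g kap kq l : R) : 0 < q -> 0 < g ->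
  `|qh - q| <= kq * q -> kq <= 1 -> `|a2 - g| <= kap -> kap <= g -> 0 <= a4 <= l ->
  `|qh / q * ((a2 ^+ 2 - a4) / g ^+ 2) - 1| <= 6 * kap / g + 2 * l / g ^+ 2 + kq.
Proof.
move=> q0 g0 hq kq1 ha kg /andP[a40 a4l].
have kap0 : 0 <= kap by exact: le_trans (normr_ge0 _) ha.
set r := qh / q; set s := _ / g ^+ 2.
have q0' : q != 0 by rewrite gt_eqF.
have g0' : g != 0 by rewrite gt_eqF.
have hr : `|r - 1| <= kq.
  have -> : r - 1 = (qh - q) / q by rewrite /r; field.
  by rewrite normrM normfV (gtr0_norm q0) ler_pdivrMr.
have r2 : `|r| <= 2.
  have := ler_normD (r - 1) 1; rewrite subrK normr1 => h; apply: (le_trans h); lra.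
have hs : `|s - 1| <= 3 * kap / g + l / g ^+ 2.
  have -> : s - 1 = ((a2 - g) * (a2 - g + 2 * g) - a4) / g ^+ 2 by rewrite /s; field.
  rewrite normrM normfV (gtr0_norm (exprn_gt0 _ g0)) ler_pdivrMr ?exprn_gt0//.
  have -> : (3 * kap / g + l / g ^+ 2) * g ^+ 2 = 3 * kap * g + l by field.
  apply: (le_trans (ler_normB _ _)); rewrite (ger0_norm a40) normrM; apply: lerD => //.
  have : `|a2 - g + 2 * g| <= 3 * g.
    by apply: (le_trans (ler_normD _ _)); rewrite [`|2 * g|]ger0_norm ?mulr_ge0 ?(ltW g0)//; lra.
  move=> h; have := ler_pM (normr_ge0 _) (normr_ge0 _) ha h; lra.
have -> : r * s - 1 = r * (s - 1) + (r - 1) by ring.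
apply: (le_trans (ler_normD _ _)); rewrite normrM; apply: lerD => //.
have := ler_pM (normr_ge0 _) (normr_ge0 _) r2 hs; lra.
Qed.

Variables (X : nat -> {RV P >-> R}) (f : R -> R) (M : R).
Hypothesis indX : mutually_indep P (fun i => X i : T -> R).
Hypothesis idX : ident_distr P (fun i => X i : T -> R).
Hypothesis Xf : is_density P (X 0%N) f.
Hypothesis fM : forall x, `|f x| <= M.
Hypothesis f_unif : forall eps : R, 0 < eps -> exists2 delta : R, 0 < delta &
  forall x y, `|x - y| < delta -> `|f x - f y| < eps.
Variables (K : R -> R) (MK : R).
Hypothesis mK : measurable_fun setT K.
Hypothesis K0 : forall x, 0 <= K x.
Hypothesis K1 : (\int[mu]_x (K x)%:E = 1)%E.
Hypothesis KN : forall x, K (- x) = K x.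
Hypothesis KM : forall x, K x <= MK.

Let M0 : 0 <= M. Proof. exact: le_trans (normr_ge0 _) (fM 0). Qed.
Let MK0 : 0 <= MK. Proof. exact: le_trans (K0 0) (KM 0). Qed.

Let q := lint (fun y => f y ^+ 2) * lint (fun x => K x ^+ 2).
Let q0 : 0 < q.
Proof. by rewrite mulr_gt0//; [exact: Ex_density_gt0 Xf fM|exact: lint_sqr_gt0 mK K0 K1 KM]. Qed.

Let Cq := Kq M MK.
Let Cg := 2 * MK * M ^+ 3 + 128 * M ^+ 4.
Let CH := MK + 2 * M.
Let Cq0 : 0 <= Cq. Proof. exact: (Kq_ge0 fM K0 KM). Qed.
Let Cg0 : 0 <= Cg. Proof. by rewrite addr_ge0// !mulr_ge0// exprn_ge0. Qed.

(** The weights are deterministic, with averages of squares and fourth powers like those of typical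
    errors. [eps] serves both as tolerance and as [theta], by which the last error term is divided;
    hence the [eps ^ 2] asked of it. *)
Lemma Uk_typical_bound (a : nat -> R) n (h c g L kap kq eps : R) B phi phi1 phi2 :
  smooth3 B phi phi1 phi2 -> 0 < h -> h <= 1 -> (0 < n)%N -> 0 < g -> 0 < eps <= 1 ->
  c ^+ 2 = 4 / (n%:R ^+ 2 * h * (2 * g ^+ 2 * q)) ->
  `|qH X (KH X K h) / h - q| <= kq * q -> kq <= 1 ->
  `|(\sum_(i < n) a i ^+ 2) / n%:R - g| <= kap -> kap <= g ->
  \sum_(i < n) a i ^+ 4 <= L * n%:R ->
  6 * kap / g + 2 * (L / n%:R) / g ^+ 2 + kq <= eps ->
  4 * (2 * g) / (2 * g ^+ 2 * q) *
    Num.sqrt (2 * Cq ^+ 2 * L / n%:R + 8 * Cg * (2 * g) ^+ 2 * h) <= eps ->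
  16 * L / (2 * g ^+ 2 * q) ^+ 2 *
    (CH ^+ 2 * Cq * L / (n%:R ^+ 2 * h) + 3 * Cq ^+ 2 * (2 * g) ^+ 2 / n%:R) <= eps ^+ 2 ->
  `|Ex P (fun w => phi (Uk X (KH X K h) a c n w)) - Gs 1 phi 0| <=
    (3 * B + 1) * (1 + gauss3) * (5 * eps).
Proof.
move=> sm h0 h1 n0 g0 /andP[e0 e1] cE hq kq1 ha kg hL hV h1t h3t.
have B0 : 0 <= B by exact: le_trans (normr_ge0 _) (sm_b1 sm 0).
have G0 := @gauss3_ge0 R.
have N0 : 0 < n%:R :> R by rewrite ltr0n.
set A2 := \sum_(i < n) a i ^+ 2 in ha *; set A4 := \sum_(i < n) a i ^+ 4 in hL *.
have A20 : 0 <= A2 by apply: sumr_ge0 => i _; exact: sqr_ge0.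
have A40 : 0 <= A4 by apply: sumr_ge0 => i _; rewrite exprn_even_ge0.
have L0 : 0 <= L by have := le_trans A40 hL; rewrite pmulr_lge0.
have A2b : A2 <= 2 * g * n%:R.
  by rewrite -ler_pdivrMr//; move: ha; rewrite ler_norml => /andP[_ x]; lra.
have A1 : 0 < 2 * g ^+ 2 * q by apply: mulr_gt0 => //; apply: mulr_gt0 => //; exact: exprn_gt0.
have [|| t1 t3] := @clt_error_terms n%:R h (2 * g ^+ 2 * q) Cq Cg CH (2 * g) L A2 A4 c eps
  N0 h0 A1 Cq0 Cg0 L0 e0 cE; [by rewrite A20|by rewrite A40|].
have /= main := Uk_clt_bound indX idX (KH_meas X mK K0 KM h) (KH_sym X KN h)
  (KH_bnd Xf fM mK K0 K1 KN KM h0 h1) (KH_deg Xf fM mK K0 K1 KN KM h0)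
  (KH_sqr Xf fM mK K0 K1 KN KM h0 h1) (Gk_KH_sqr Xf fM mK K0 K1 KN KM h0 h1) a c n e0 sm.
have V0 : 0 <= \sum_(i < n) vk X (KH X K h) a c i.
  apply: sumr_ge0 => i _; exact: (vk_ge0 (KH_meas X mK K0 KM h)
    (KH_bnd Xf fM mK K0 K1 KN KM h0 h1) (KH_sqr Xf fM mK K0 K1 KN KM h0 h1)).
have near1 := Gs_near1 sm V0.
set V := \sum_(i < n) vk _ _ _ _ _ in main V0 near1.
have VE : V = (qH X (KH X K h) / h) / q * (((A2 / n%:R) ^+ 2 - A4 / n%:R ^+ 2) / g ^+ 2).
  rewrite /V (sum_vk X (KH X K h) a c n) cE -/A2 -/A4; field.
  by rewrite !gt_eqF.
have V1 : `|V - 1| <= eps.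
  have a4l : 0 <= A4 / n%:R ^+ 2 <= L / n%:R.
    rewrite divr_ge0 ?sqr_ge0//= ler_pdivrMr ?exprn_gt0//.
    by rewrite (_ : L / n%:R * n%:R ^+ 2 = L * n%:R)//; field; rewrite gt_eqF.
  by rewrite VE; apply: le_trans hV; exact: variance_ratio.
have V2 : V <= 2 by move: V1; rewrite ler_norml => /andP[_ x]; lra.
set t1L := c ^+ 2 * _ * _ in t1 main; set t3L := c ^+ 4 * _ * _ / _ in t3 main.
have t1e : t1L <= eps by exact: le_trans t1 h1t.
have t3e : t3L <= eps.
  by apply: (le_trans t3); rewrite ler_pdivrMr// -expr2.
have G1 : 0 <= 1 + gauss3 :> R by rewrite addr_ge0.
have m2 : `|Ex P (fun w => phi (Uk X (KH X K h) a c n w)) - Gs V phi 0| <= B * (1 + gauss3) * (4 * eps).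
  apply: (le_trans main); rewrite -mulrA ler_wpM2l//.
  have ev : eps * V + t3L <= 3 * eps by have := ler_wpM2l (ltW e0) V2; lra.
  have := ler_wpM2l G1 ev; have := mulr_ge0 G0 (ltW e0); lra.
have m3 : `|Gs V phi 0 - Gs 1 phi 0| <= (3 * B + 1) * eps.
  by apply: (le_trans near1); rewrite ler_wpM2l// addr_ge0// mulr_ge0.
have := ler_normD (Ex P (fun w => phi (Uk X (KH X K h) a c n w)) - Gs V phi 0) (Gs V phi 0 - Gs 1 phi 0).
rewrite addrA subrK => tri; apply: (le_trans tri); apply: (le_trans (lerD m2 m3)).
have p1 := mulr_ge0 B0 (ltW e0); have p2 := mulr_ge0 G0 (ltW e0); have p3 := mulr_ge0 p1 G0.
have := mulr_ge0 p2 B0; lra.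
Qed.

End quenched_clt.

(** * The two regimes *)

Section regimes.
Context {d : measure_display} {T : measurableType d} {R : realType}.
Variable P : probability T R.
Local Notation mu := (@lebesgue_measure R).

Lemma wcdf_slutsky_L1 (S S' : nat -> T -> R) G (b : nat -> R) :
  (forall n, measurable_fun setT (S n)) -> (forall n, measurable_fun setT (S' n)) ->
  wcdf P S G ->
  (\forall n \near \oo, L1 P (fun w => S n w - S' n w) /\
     Ex P (fun w => `|S n w - S' n w|) <= b n) ->
  b @ \oo --> (0 : R) -> wcdf P S' G.
Proof.
move=> mS mS' wS hb b0; apply: (wcdf_slutsky mS mS' wS) => delta eps d0 e0.
have de : 0 < delta * eps by exact: mulr_gt0.
near=> n; have [l bn] : L1 P (fun w => S n w - S' n w) /\
     Ex P (fun w => `|S n w - S' n w|) <= b n by near: n.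
have bd : b n <= delta * eps by near: n; exact: (cvgr_le _ b0 _ de).
apply: (le_trans (Pr_markov (L1_abs l) _ d0)) => //.
by rewrite ler_pdivrMr// mulrC (le_trans bn).
Unshelve. all: end_near. Qed.

Variables (X : nat -> {RV P >-> R}) (f : R -> R) (M : R).
Hypothesis indX : mutually_indep P (fun i => X i : T -> R).
Hypothesis idX : ident_distr P (fun i => X i : T -> R).
Hypothesis Xf : is_density P (X 0%N) f.
Hypothesis fM : forall x, `|f x| <= M.
Hypothesis f_unif : forall eps : R, 0 < eps -> exists2 delta : R, 0 < delta &
  forall x y, `|x - y| < delta -> `|f x - f y| < eps.
Variables (K : R -> R) (MK : R).
Hypothesis mK : measurable_fun setT K.
Hypothesis K0 : forall x, 0 <= K x.
Hypothesis K1 : (\int[mu]_x (K x)%:E = 1)%E.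
Hypothesis KN : forall x, K (- x) = K x.
Hypothesis KM : forall x, K x <= MK.
Variable e : nat -> {RV P >-> R}.
Hypothesis iXe : indep_families P (fun i => X i : T -> R) (fun i => e i : T -> R).
Variables (g C4 : R).
Hypothesis g_gt0 : 0 < g.
Hypothesis e_L2 : forall i, L1 P (fun w => e i w ^+ 2).
Hypothesis e_var : forall i, Ex P (fun w => e i w ^+ 2) = g.
Hypothesis e_L4 : forall i, L1 P (fun w => e i w ^+ 4).
Hypothesis e_mom4 : forall i, Ex P (fun w => e i w ^+ 4) <= C4.
Hypothesis lln : forall eps : R, 0 < eps ->
  \forall n \near \oo, Ex P (fun w => `|(\sum_(i < n) e i w ^+ 2) / n%:R - g|) <= eps.
Variable h : nat -> R.
Hypothesis h_gt0 : forall n, 0 < h n.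
Hypothesis h_cvg0 : h @ \oo --> (0 : R).

Let M0 : 0 <= M. Proof. exact: le_trans (normr_ge0 _) (fM 0). Qed.
Let MK0 : 0 <= MK. Proof. exact: le_trans (K0 0) (KM 0). Qed.
Let FF := lint (fun y => f y ^+ 2).
Let KK := lint (fun x => K x ^+ 2).
Let FF0 : 0 < FF. Proof. exact: Ex_density_gt0 Xf fM. Qed.
Let KK0 : 0 < KK. Proof. exact: lint_sqr_gt0 mK K0 K1 KM. Qed.

Let invn : (n%:R^-1 : R) @[n --> \oo] --> (0 : R).
Proof.
apply/gtr0_cvgV0; last exact: cvgr_idn.
by near=> n; rewrite ltr0n; near: n; exact: nbhs_infty_gt.
Unshelve. all: end_near. Qed.

Let cvg0_le (u : nat -> R) z : u @ \oo --> (0 : R) -> 0 < z -> \forall n \near \oo, u n <= z.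
Proof. by move=> u0 z0; exact: (cvgr_le _ u0 _ z0). Qed.

Let cvg_sqrt0 (u : nat -> R) : u @ \oo --> (0 : R) -> Num.sqrt (u n) @[n --> \oo] --> (0 : R).
Proof.
move=> u0; have := cvg_comp _ _ u0 (@sqrt_continuous R 0).
by rewrite sqrtr0; exact.
Qed.

(** On typical errors, where [sum e^2 / n] is within [kap] of [g] and [sum e^4] is at most [L n],
    the bound for fixed weights applies. The others have small probability by Markov's inequality,
    which enters as a pointwise majorant linear in [B2] and [B4]. *)
Theorem degenerate_clt (c : nat -> R) B phi phi1 phi2 :
  (forall n, (0 < n)%N -> c n ^+ 2 = 4 / (n%:R ^+ 2 * h n * (2 * g ^+ 2 * (FF * KK)))) ->
  (n%:R * h n) @[n --> \oo] --> +oo ->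
  smooth3 B phi phi1 phi2 ->
  Ex P (fun w => phi (Uk X (KH X K (h n)) (fun i => e i w) (c n) n w)) @[n --> \oo] --> Gs 1 phi 0.
Proof.
move=> cE nh sm; apply/cvgrPdist_le => eps e0.
have B0 : 0 <= B by exact: le_trans (normr_ge0 _) (sm_b1 sm 0).
have G0 := @gauss3_ge0 R.
have D0 : 0 < (3 * B + 1) * (1 + gauss3) :> R.
  by apply: mulr_gt0; lra.
set D := (3 * B + 1) * _ in D0.
have D10' : 0 < 10 * D by lra.
(* The bound for fixed weights is [D * (5 * ep)], here at most [eps / 2]; it also asks for
   [ep <= 1]. *)
pose ep := Num.min 1 (eps / (10 * D)).
have ep0 : 0 < ep by rewrite lt_min ltr01/=; exact: divr_gt0.
have ep1 : ep <= 1 by rewrite ge_min lexx.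
have ep3 : ep = ep / 3 + ep / 3 + ep / 3 by field.
have epD : D * (5 * ep) <= eps / 2.
  have : ep <= eps / (10 * D) by rewrite ge_min lexx orbT.
  by rewrite ler_pdivlMr// => ?; lra.
have C40 : 0 <= C4 by apply: le_trans (e_mom4 0%N); apply: Ex_ge0 => w; rewrite exprn_even_ge0.
(* Large enough for [C4 / L <= eps / 4], Markov's bound for an atypical sum of fourth powers; it
   does not change with [n]. *)
pose L := 4 * C4 / eps + 1.
have L0 : 0 < L by rewrite ltr_wpDl// divr_ge0 ?mulr_ge0// ltW.
have CL : C4 / L <= eps / 4.
  rewrite ler_pdivrMr// /L (_ : eps / 4 * _ = C4 + eps / 4); last by field; rewrite gt_eqF.
  by rewrite lerDl divr_ge0// ltW.
pose kap := Num.min g (g * ep / 18).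
have kap0 : 0 < kap by rewrite lt_min g_gt0 divr_gt0// mulr_gt0.
have kapg : kap <= g by rewrite ge_min lexx.
have kape : 6 * kap / g <= ep / 3.
  have : kap <= g * ep / 18 by rewrite ge_min lexx orbT.
  by move=> x; rewrite ler_pdivrMr//; lra.
have Q0 : 0 < FF * KK by exact: mulr_gt0.
have kq0 : 0 < ep / 3 * (FF * KK) by rewrite mulr_gt0// divr_gt0.
have [h0 h00 hq] := qH_approx Xf fM f_unif mK K0 K1 KN KM kq0.
have A0 : 0 < 2 * g ^+ 2 * (FF * KK) by apply: mulr_gt0 => //; apply: mulr_gt0 => //; exact: exprn_gt0.
set A := 2 * g ^+ 2 * (FF * KK) in A0.
have D10 : 0 < 4 * (2 * g) / A by rewrite divr_gt0// !mulr_gt0.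
set D1 := 4 * (2 * g) / A in D10.
have epD1 : 0 < (ep / D1) ^+ 2 by rewrite exprn_gt0// divr_gt0.
set Cq := Kq M MK; set Cg := 2 * MK * M ^+ 3 + 128 * M ^+ 4; set CH := MK + 2 * M.
have u1 : (2 * Cq ^+ 2 * L / n%:R + 8 * Cg * (2 * g) ^+ 2 * h n) @[n --> \oo] --> (0 : R).
  rewrite -[X in _ --> X]addr0 -[X in _ --> X + _](mulr0 (2 * Cq ^+ 2 * L)) -[X in _ --> _ + X](mulr0 (8 * Cg * (2 * g) ^+ 2)).
  by apply: cvgD; apply: cvgM => //; exact: cvg_cst.
have invnh : ((n%:R * h n)^-1 : R) @[n --> \oo] --> (0 : R).
  apply/gtr0_cvgV0 => //; near=> n; rewrite mulr_gt0// ltr0n; near: n; exact: nbhs_infty_gt.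
have u3 : (16 * L / A ^+ 2 * (CH ^+ 2 * Cq * L * (n%:R^-1 * (n%:R * h n)^-1) + 3 * Cq ^+ 2 * (2 * g) ^+ 2 / n%:R))
    @[n --> \oo] --> (0 : R).
  rewrite -[X in _ --> X](mulr0 (16 * L / A ^+ 2)); apply: cvgM; first exact: cvg_cst.
  rewrite -[X in _ --> X]addr0; apply: cvgD.
    rewrite -[X in _ --> X](mulr0 (CH ^+ 2 * Cq * L)); apply: cvgM; first exact: cvg_cst.
    by rewrite -[X in _ --> X](mulr0 0); apply: cvgM.
  by rewrite -[X in _ --> X](mulr0 (3 * Cq ^+ 2 * (2 * g) ^+ 2)); apply: cvgM => //; exact: cvg_cst.
have u2 : (2 * (L / n%:R) / g ^+ 2) @[n --> \oo] --> (0 : R).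
  rewrite -[X in _ --> X](mul0r (g ^+ 2)^-1); apply: cvgM; last exact: cvg_cst.
  rewrite -[X in _ --> X](mulr0 2); apply: cvgM; first exact: cvg_cst.
  by rewrite -[X in _ --> X](mulr0 L); apply: cvgM => //; exact: cvg_cst.
(* Divided by [kap], this tolerance in the law of large numbers contributes [eps / 4]. *)
have ke : 0 < kap * (eps / 4) by rewrite mulr_gt0// divr_gt0.
near=> n.
have n0 : (0 < n)%N by near: n; exact: nbhs_infty_gt.
have N0 : 0 < n%:R :> R by rewrite ltr0n.
have h1 : h n <= 1 by near: n; exact: (cvg0_le h_cvg0 ltr01).
have hh : h n < h0 by near: n; exact: (cvgr_lt _ h_cvg0 _ h00).
have t1 : 2 * Cq ^+ 2 * L / n%:R + 8 * Cg * (2 * g) ^+ 2 * h n <= (ep / D1) ^+ 2.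
  by near: n; exact: (cvg0_le u1).
have t3 : 16 * L / A ^+ 2 * (CH ^+ 2 * Cq * L * (n%:R^-1 * (n%:R * h n)^-1) + 3 * Cq ^+ 2 * (2 * g) ^+ 2 / n%:R) <= ep ^+ 2.
  by near: n; apply: (cvg0_le u3); exact: exprn_gt0.
have t2 : 2 * (L / n%:R) / g ^+ 2 <= ep / 3 by near: n; apply: (cvg0_le u2); exact: divr_gt0.
have tl : Ex P (fun w => `|(\sum_(i < n) e i w ^+ 2) / n%:R - g|) <= kap * (eps / 4).
  by near: n; exact: lln.
pose F w w' := phi (Uk X (KH X K (h n)) (fun i => e i w) (c n) n w').
have mF : jmeas X e F.
  exact: (measurableT_comp (sm_m sm) (@jmeas_Uk _ _ _ P X K MK mK K0 KM (h n) e (c n) n)).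
have F01 w w' : 0 <= F w w' <= 1 by exact: sm_01 sm _.
have bF w w' : `|F w w'| <= 1 by have /andP[a b] := F01 w w'; rewrite ger0_norm.
have [lq eq] := quenched_bounded iXe mF bF.
have lFw w : L1 P (F w).
  by apply: (@L1_bnd _ _ _ _ _ 1) => //; exact: jmeas_section mF.
have G01 : 0 <= Gs 1 phi 0 <= 1 by exact: (sm_01 (smooth3_Gs 1 sm) 0).
set G := Gs 1 phi 0 in G01 *.
pose B2 w := `|(\sum_(i < n) e i w ^+ 2) / n%:R - g|.
pose B4 w := \sum_(i < n) e i w ^+ 4.
have lB2 : L1 P B2.
  apply: L1_abs; apply: L1B; last exact: L1_cst.
  apply: (@eq_L1 _ _ _ _ (fun w => n%:R^-1 * \sum_(i < n) e i w ^+ 2)); first by move=> w; rewrite mulrC.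
  by apply: L1Z; apply: L1_sum => i _.
have lB4 : L1 P B4 by apply: L1_sum => i _.
have lb : L1 P (fun w => kap^-1 * B2 w + ((n%:R * L)^-1 * B4 w + eps / 2)).
  by apply: L1D; [exact: L1Z|apply: L1D; [exact: L1Z|exact: L1_cst]].
have pt w : `|Ex P (F w) - G| <= kap^-1 * B2 w + ((n%:R * L)^-1 * B4 w + eps / 2).
  have x2 : 0 <= B2 w by exact: normr_ge0.
  have x4 : 0 <= B4 w by apply: sumr_ge0 => i _; rewrite exprn_even_ge0.
  have y2 : 0 <= kap^-1 * B2 w by rewrite mulr_ge0// invr_ge0 ltW.
  have y4 : 0 <= (n%:R * L)^-1 * B4 w by rewrite mulr_ge0// invr_ge0 mulr_ge0// ltW.
  (* outside the typical set one of the first two terms is at least 1 *)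
  have le1 : `|Ex P (F w) - G| <= 1.
    have a : 0 <= Ex P (F w) by apply: Ex_ge0 => w'; case/andP: (F01 w w').
    have b : Ex P (F w) <= 1 by apply: Ex_le_cst => // w'; case/andP: (F01 w w').
    by case/andP: G01 => a' b'; rewrite ler_norml; apply/andP; split; lra.
  case: (leP (B2 w) kap) => [ok2|bad2]; last first.
    apply: (le_trans le1); have : 1 <= kap^-1 * B2 w by rewrite mulrC ler_pdivlMr// mul1r ltW.
    lra.
  case: (leP (B4 w) (L * n%:R)) => [ok4|bad4]; last first.
    apply: (le_trans le1); have : 1 <= (n%:R * L)^-1 * B4 w.
      by rewrite mulrC ler_pdivlMr ?mulr_gt0// mul1r mulrC ltW.
    lra.
  apply: (@le_trans _ _ (eps / 2)); last lra.
  apply: le_trans epD.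
  apply: (@Uk_typical_bound _ _ _ P X f M indX idX Xf fM K MK mK K0 K1 KN KM (fun i => e i w) n (h n) (c n) g L kap (ep / 3) ep B phi phi1 phi2 sm) => //.
  - by rewrite ep0.
  - exact: cE.
  - by apply: hq; rewrite h_gt0.
  - by rewrite ler_pdivrMr// (le_trans ep1)// mul1r ler1n.
  - by rewrite [leRHS]ep3; apply: lerD => //; exact: lerD.
  - have : Num.sqrt (2 * Cq ^+ 2 * L / n%:R + 8 * Cg * (2 * g) ^+ 2 * h n) <= ep / D1.
      have x0 : 0 <= ep / D1 by apply: divr_ge0; exact: ltW.
      by rewrite -[leRHS](ger0_norm x0) -sqrtr_sqr; exact: ler_wsqrtr.
    by rewrite ler_pdivlMr// mulrC.
  - have -> : n%:R ^+ 2 * h n = n%:R * (n%:R * h n) by rewrite expr2 mulrA.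
    by rewrite (invfM n%:R (n%:R * h n)).
rewrite distrC -/F eq -[G](Ex_cst P) -ExB//; last exact: L1_cst.
have lqG : L1 P (fun w => Ex P (F w) - G) by apply: L1B => //; exact: L1_cst.
apply: (le_trans (Ex_abs_le lqG lb pt)).
rewrite ExD; [|exact: L1Z|by apply: L1D; [exact: L1Z|exact: L1_cst]].
rewrite ExD; [|exact: L1Z|exact: L1_cst].
rewrite Ex_cst !ExZ//.
have z2 : kap^-1 * Ex P B2 <= eps / 4 by rewrite mulrC ler_pdivrMr// mulrC.
have z4 : (n%:R * L)^-1 * Ex P B4 <= eps / 4.
  apply: le_trans CL; rewrite Ex_sum//.
  have s4 : \sum_(i < n) Ex P (fun w => e i w ^+ 4) <= n%:R * C4.
    rewrite mulr_natl -[X in _ *+ X]card_ord -sumr_const.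
    by apply: ler_sum => i _; exact: e_mom4.
  rewrite mulrC ler_pdivrMr ?mulr_gt0//; apply: (le_trans s4).
  by rewrite (_ : C4 / L * (n%:R * L) = n%:R * C4)//; field; rewrite gt_eqF.
lra.
Unshelve. all: end_near. Qed.

Let An n w := \sum_(i < n) e i w.
Let Bn n w := \sum_(i < n) e i w ^+ 2.
Variables (Y : nat -> R) (cA : R).
Hypothesis Y_gt0 : forall n, (0 < n)%N -> 0 < Y n.
Hypothesis Y_cvgy : Y @ \oo --> +oo.
Hypothesis An_L2 : forall n, L1 P (fun w => An n w ^+ 2).
Hypothesis An_growth : (Ex P (fun w => An n w ^+ 2) / (n%:R * Y n)) @[n --> \oo] --> cA.
Hypothesis cA_gt0 : 0 < cA.

Definition kform n w :=
  \sum_(t < n) \sum_(s < n | s != t) e s w * K ((X s w - X t w) / h n) * e t w.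

Lemma kform_decomposition n w : kform n w =
  Uk X (KH X K (h n)) (fun i => e i w) 2 n w + Lk X K (h n) (fun i => e i w) n w +
  Kmu X K (h n) * (An n w ^+ 2 - Bn n w).
Proof.
apply: (@hoeffding_decomposition _ (fun u v => K ((u - v) / h n)) (Km X K (h n)) (Kmu X K (h n))
  (fun i => e i w) (fun i => X i w) n).
by move=> u v; rewrite -KN -mulNr opprB.
Qed.

Lemma kform_meas n : measurable_fun setT (kform n).
Proof.
apply: measurable_sum => t; rewrite (_ : (fun w => _) = (fun w =>
    \sum_(s < n) (if s != t then e s w * K ((X s w - X t w) / h n) * e t w else 0))); last first.
  by apply/funext => w; rewrite big_mkcond.
apply: measurable_sum => s; case: (s != t); last exact: measurable_cst.
apply: measurable_funM => //; apply: measurable_funM => //; apply: (measurableT_comp mK).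
by apply: measurable_funM => //; exact: measurable_funB.
Qed.

Let Uk_div c s n w : Uk X (KH X K (h n)) (fun i => e i w) (c / s) n w =
  Uk X (KH X K (h n)) (fun i => e i w) c n w / s.
Proof. by rewrite /Uk mulr_suml; apply: eq_bigr => i _; rewrite /Dk -!mulrA; congr (_ * _); ring. Qed.

Let Bn_L1 n : L1 P (Bn n). Proof. by apply: L1_sum => i _. Qed.

Let Bn_mean n : Ex P (Bn n) = n%:R * g.
Proof. by rewrite Ex_sum// (eq_bigr (fun=> g)) ?sumr_const ?card_ord ?mulr_natl// => i _; exact: e_var. Qed.

Let h_le1 : \forall n \near \oo, h n <= 1.
Proof. exact: (cvg0_le h_cvg0 ltr01). Qed.

Let A1 := 2 * g ^+ 2 * KK * FF.
Let A10 : 0 < A1.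
Proof. by apply: mulr_gt0 => //; apply: mulr_gt0 => //; apply: mulr_gt0 => //; exact: exprn_gt0. Qed.

(** [Y n] abstracts [n^(1 - alpha)]. By [joint_Lk_abs] with [delta = 1], everything but the
    degenerate part is at most [h M (3 E (sum e)^2 + 5 n g)] in mean; after division by [n h^(1/2)]
    this is of order [(Y^2 h)^(1/2) + h^(1/2)]. *)
Theorem kform_normal :
  (Y n ^+ 2 * h n) @[n --> \oo] --> (0 : R) -> (n%:R * h n) @[n --> \oo] --> +oo ->
  wcdf P (fun n w => kform n w / Num.sqrt (n%:R ^+ 2 * h n * A1)) cdfg.
Proof.
move=> Yh nh; pose sg n := Num.sqrt (n%:R ^+ 2 * h n * A1).
pose U n w := Uk X (KH X K (h n)) (fun i => e i w) (2 / sg n) n w.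
have mU n : measurable_fun setT (U n).
  exact: (jmeas_diag (@jmeas_Uk _ _ _ P X K MK mK K0 KM (h n) e (2 / sg n) n)).
have mS n : measurable_fun setT (fun w => kform n w / sg n).
  by apply: measurable_funM => //; exact: kform_meas.
have wU : wcdf P U cdfg.
  apply: wcdf_normal => // B phi phi1 phi2 sm.
  apply: (degenerate_clt _ nh sm) => n n0.
  rewrite exprMn exprVn sqr_sqrtr; last first.
    by apply: mulr_ge0; [apply: mulr_ge0; [exact: sqr_ge0|exact: ltW]|exact: ltW].
  rewrite -/FF -/KK (_ : n%:R ^+ 2 * h n * A1 = n%:R ^+ 2 * h n * (2 * g ^+ 2 * (FF * KK))); last by rewrite /A1; ring.
  by congr (_ * _); ring.
pose b n := M / Num.sqrt A1 *
  (3 * (Num.sqrt (Y n ^+ 2 * h n) * (Ex P (fun w => An n w ^+ 2) / (n%:R * Y n))) + 5 * g * Num.sqrt (h n)).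
apply: (wcdf_slutsky_L1 (b := b) mU mS wU); last first.
  rewrite -[X in _ --> X](mulr0 (M / Num.sqrt A1)); apply: cvgM; first exact: cvg_cst.
  rewrite -[X in _ --> X]addr0; apply: cvgD.
    rewrite -[X in _ --> X](mulr0 3); apply: cvgM; first exact: cvg_cst.
    by rewrite -[X in _ --> X](mul0r cA); apply: cvgM => //; exact: cvg_sqrt0.
  rewrite -[X in _ --> X](mulr0 (5 * g)); apply: cvgM; first exact: cvg_cst.
  exact: cvg_sqrt0.
near=> n.
have n0 : (0 < n)%N by near: n; exact: nbhs_infty_gt.
have h1 : h n <= 1 by near: n; exact: h_le1.
have N0 : 0 < n%:R :> R by rewrite ltr0n.
have Yn := Y_gt0 n0.
have [lL eL] := joint_Lk_abs indX idX Xf fM mK K0 K1 KM (h_gt0 n) iXe ltr01 (Bn_L1 n) (An_L2 n).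
rewrite -/(An n) -/(Bn n) in eL.
pose D w := Lk X K (h n) (fun i => e i w) n w + Kmu X K (h n) * (An n w ^+ 2 - Bn n w).
have sgE : sg n = n%:R * Num.sqrt (h n) * Num.sqrt A1.
  rewrite /sg sqrtrM ?mulr_ge0 ?sqr_ge0 ?(ltW (h_gt0 n))// sqrtrM ?sqr_ge0//.
  by rewrite sqrtr_sqr gtr0_norm.
have sh0 : 0 < Num.sqrt (h n) by rewrite sqrtr_gt0.
have sA0 : 0 < Num.sqrt A1 by rewrite sqrtr_gt0.
have sg0 : 0 < sg n by rewrite sgE !mulr_gt0.
have lAB : L1 P (fun w => Kmu X K (h n) * (An n w ^+ 2 - Bn n w)) by apply: L1Z; exact: L1B.
have lD : L1 P D by exact: L1D.
have E w : U n w - kform n w / sg n = - (sg n)^-1 * D w.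
  by rewrite /U kform_decomposition Uk_div /D; ring.
have si0 : 0 < (sg n)^-1 by rewrite invr_gt0.
split; first by apply: (eq_L1 _ (L1Z (- (sg n)^-1) lD)) => w; rewrite E.
rewrite (@eq_Ex _ _ _ _ _ (fun w => (sg n)^-1 * `|D w|)); last first.
  by move=> w; rewrite E normrM normrN (gtr0_norm si0).
rewrite ExZ; last exact: L1_abs.
rewrite mulrC ler_pdivrMr//.
have /andP[m0 m1] := Kmu_bnd Xf fM mK K0 K1 KM (h_gt0 n).
have lr : L1 P (fun w => `|Lk X K (h n) (fun i => e i w) n w| + h n * M * (An n w ^+ 2 + Bn n w)).
  by apply: L1D; [exact: L1_abs|apply: L1Z; exact: L1D].
have hM : 0 <= h n * M by rewrite mulr_ge0// ltW.
have x0 w : 0 <= Bn n w by apply: sumr_ge0 => i _; exact: sqr_ge0.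
apply: (@le_trans _ _ (h n * M * (3 * Ex P (fun w => An n w ^+ 2) + 5 * (n%:R * g)))).
  apply: (le_trans (Ex_le (L1_abs lD) lr _)).
    move=> w; apply: (le_trans (ler_normD _ _)); rewrite lerD2l normrM (ger0_norm m0).
    apply: ler_pM => //; apply: (le_trans (ler_normB _ _)).
    by rewrite ger0_norm ?sqr_ge0// ger0_norm.
  rewrite ExD; [|exact: L1_abs|by apply: L1Z; exact: L1D].
  rewrite ExZ; last exact: L1D.
  rewrite ExD// -/(Bn n) Bn_mean; rewrite Bn_mean divr1 in eL.
  by move: eL; lra.
rewrite le_eqVlt; apply/orP; left; apply/eqP; rewrite sgE /b.
have -> : Num.sqrt (Y n ^+ 2 * h n) = Y n * Num.sqrt (h n).
  by rewrite sqrtrM ?sqr_ge0// sqrtr_sqr gtr0_norm.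
rewrite -{1}(sqr_sqrtr (ltW (h_gt0 n))); field.
by rewrite !gt_eqF.
Unshelve. all: end_near. Qed.

Let A2 := cA * FF.
Let A20 : 0 < A2. Proof. exact: mulr_gt0. Qed.

Let Kmu_cvg : (Kmu X K (h n) / h n) @[n --> \oo] --> FF.
Proof.
apply/cvgrPdist_le => eps e0.
have [h0 h00 H] := Kmu_approx Xf fM f_unif mK K0 K1 KM e0.
near=> n; rewrite distrC; apply: H; rewrite h_gt0 /=; near: n; exact: (cvgr_lt _ h_cvg0 _ h00).
Unshelve. all: end_near. Qed.

(** The square of the standardised sum of errors is the reference variable. In mean, the degenerate
    part contributes order [(Y^2 h)^(-1/2)], the linear one [Y^(-1/2)] and the diagonal [1 / Y]. The
    last term of [b] is the relative error of the scale, as [Kmu ~ h FF] and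
    [E (sum e)^2 ~ cA n Y]. *)
Theorem kform_chi2 : (Y n ^+ 2 * h n) @[n --> \oo] --> +oo ->
  wcdf P (fun n w => An n w / Num.sqrt (Ex P (fun w => An n w ^+ 2))) cdfg ->
  wcdf P (fun n w => kform n w / (n%:R * Y n * h n * A2)) cdfg2.
Proof.
move=> Yh wA; pose c n := Ex P (fun w => An n w ^+ 2); pose sg n := n%:R * Y n * h n * A2.
pose Z n w := (An n w / Num.sqrt (c n)) ^+ 2.
have mAn n : measurable_fun setT (An n) by exact: measurable_sum.
have mAs n : measurable_fun setT (fun w => An n w / Num.sqrt (c n)) by exact: measurable_funM.
have mZ n : measurable_fun setT (Z n) by exact: measurable_funX.
have mS n : measurable_fun setT (fun w => kform n w / sg n).
  by apply: measurable_funM => //; exact: kform_meas.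
have wZ : wcdf P Z cdfg2 := wcdf_sqr mAs wA.
(* this choice balances the two terms of [joint_Lk_abs] *)
pose del n := Num.sqrt (Y n)^-1.
pose r n := c n / (n%:R * Y n).
pose b n := 2 * Num.sqrt (Kq M MK) * g / A2 * Num.sqrt (Y n ^+ 2 * h n)^-1 +
  2 * M / A2 * (del n * (r n + g * (del n * del n)) + g * del n) + M * g / A2 * (del n * del n) +
  `|Kmu X K (h n) / h n * r n / A2 - 1|.
have Ypos : \forall n \near \oo, 0 < Y n.
  by near=> n; apply: Y_gt0; near: n; exact: nbhs_infty_gt.
have del0 : del @ \oo --> (0 : R) by apply: cvg_sqrt0; exact/gtr0_cvgV0.
have dd0 : (del n * del n) @[n --> \oo] --> (0 : R).
  by rewrite -[X in _ --> X](mulr0 0); exact: cvgM.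
have Yhi : ((Y n ^+ 2 * h n)^-1) @[n --> \oo] --> (0 : R).
  apply/gtr0_cvgV0 => //; apply: filterS Ypos => n y0; by rewrite mulr_gt0// exprn_gt0.
have rc : r @ \oo --> cA by exact: An_growth.
apply: (wcdf_slutsky_L1 (b := b) mZ mS wZ); last first.
  rewrite -[X in _ --> X]addr0; apply: cvgD.
    rewrite -[X in _ --> X]addr0; apply: cvgD.
      rewrite -[X in _ --> X]addr0; apply: cvgD.
        rewrite -[X in _ --> X](mulr0 (2 * Num.sqrt (Kq M MK) * g / A2)); apply: cvgM; first exact: cvg_cst.
        exact: cvg_sqrt0.
      rewrite -[X in _ --> X](mulr0 (2 * M / A2)); apply: cvgM; first exact: cvg_cst.
      rewrite -[X in _ --> X]addr0; apply: cvgD.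
        rewrite -[X in _ --> X](mul0r (cA + g * 0)); apply: cvgM => //.
        by apply: cvgD => //; apply: cvgM => //; exact: cvg_cst.
      by rewrite -[X in _ --> X](mulr0 g); apply: cvgM => //; exact: cvg_cst.
    by rewrite -[X in _ --> X](mulr0 (M * g / A2)); apply: cvgM => //; exact: cvg_cst.
  have l : (Kmu X K (h n) / h n * r n / A2) @[n --> \oo] --> (1 : R).
    rewrite (_ : 1 = FF * cA / A2); last by rewrite /A2 [FF * _]mulrC divff// gt_eqF.
    by apply: cvgM; [exact: cvgM|exact: cvg_cst].
  have l1 : (Kmu X K (h n) / h n * r n / A2 - 1) @[n --> \oo] --> (1 - 1 : R).
    by apply: cvgB => //; exact: cvg_cst.
  by have := cvg_norm l1; rewrite subrr normr0; exact.
near=> n.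
have n0 : (0 < n)%N by near: n; exact: nbhs_infty_gt.
have h1 : h n <= 1 by near: n; exact: h_le1.
have N0 : 0 < n%:R :> R by rewrite ltr0n.
have Yn := Y_gt0 n0.
have hn := h_gt0 n.
have r0 : 0 < r n.
  near: n; exact: (cvgr_gt _ rc _ cA_gt0).
have c0 : 0 < c n by move: r0; rewrite /r pmulr_lgt0// invr_gt0 mulr_gt0.
have sy0 : 0 < Num.sqrt (Y n) by rewrite sqrtr_gt0.
have sh0 : 0 < Num.sqrt (h n) by rewrite sqrtr_gt0.
have delE : del n = (Num.sqrt (Y n))^-1 by rewrite /del sqrtrV ?ltW.
have d0 : 0 < del n by rewrite delE invr_gt0.
have [lL eL] := joint_Lk_abs indX idX Xf fM mK K0 K1 KM hn iXe d0 (Bn_L1 n) (An_L2 n).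
have [lU eU] := joint_Uk_abs indX idX Xf fM mK K0 K1 KN KM hn h1 iXe 2 (Bn_L1 n).
rewrite -/(An n) -/(Bn n) -/(c n) Bn_mean in eL; rewrite -/(Bn n) Bn_mean ger0_norm// in eU.
have /andP[m0 m1] := Kmu_bnd Xf fM mK K0 K1 KM hn.
have sg0 : 0 < sg n by rewrite /sg !mulr_gt0.
have si0 : 0 < (sg n)^-1 by rewrite invr_gt0.
have hM : 0 <= h n * M by rewrite mulr_ge0// ltW.
have x0 w : 0 <= Bn n w by apply: sumr_ge0 => i _; exact: sqr_ge0.
pose D w := Uk X (KH X K (h n)) (fun i => e i w) 2 n w + Lk X K (h n) (fun i => e i w) n w - Kmu X K (h n) * Bn n w.
pose kk := Kmu X K (h n) / h n * r n / A2 - 1.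
have ZE w : Z n w = (c n)^-1 * An n w ^+ 2.
  by rewrite /Z exprMn exprVn sqr_sqrtr ?ltW// mulrC.
have E w : Z n w - kform n w / sg n = - (sg n)^-1 * D w - kk / c n * An n w ^+ 2.
  rewrite ZE kform_decomposition /D /kk /r /sg; field.
  by rewrite !gt_eqF.
have lB := L1Z (Kmu X K (h n)) (Bn_L1 n).
have lD : L1 P D by apply: L1B => //; exact: L1D.
have lA' : L1 P (fun w => kk / c n * An n w ^+ 2) by exact: L1Z.
have lE : L1 P (fun w => - (sg n)^-1 * D w - kk / c n * An n w ^+ 2) by apply: L1B => //; exact: L1Z.
split; first by apply: (eq_L1 _ lE) => w; rewrite E.
rewrite (@eq_Ex _ _ _ _ _ (fun w => `|- (sg n)^-1 * D w - kk / c n * An n w ^+ 2|)); last first.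
  by move=> w; rewrite E.
have lr0 : L1 P (fun w => `|Uk X (KH X K (h n)) (fun i => e i w) 2 n w| + `|Lk X K (h n) (fun i => e i w) n w| + h n * M * Bn n w).
  by apply: L1D; [apply: L1D; exact: L1_abs|exact: L1Z].
have lr : L1 P (fun w => (sg n)^-1 * (`|Uk X (KH X K (h n)) (fun i => e i w) 2 n w| + `|Lk X K (h n) (fun i => e i w) n w| + h n * M * Bn n w)
   + `|kk| / c n * An n w ^+ 2).
  by apply: L1D; exact: L1Z.
apply: (le_trans (Ex_le (L1_abs lE) lr _)).
  move=> w; apply: (le_trans (ler_normB _ _)); apply: lerD; last first.
    by rewrite normrM normrM normfV (gtr0_norm c0) [X in _ * X]ger0_norm ?sqr_ge0.
  rewrite normrM normrN (gtr0_norm si0) ler_pM2l//.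
  apply: (le_trans (ler_normB _ _)); apply: lerD; first exact: ler_normD.
  by rewrite normrM (ger0_norm m0) (ger0_norm (x0 w)); exact: ler_wpM2r.
rewrite ExD; [|exact: L1Z|exact: L1Z].
rewrite !ExZ// ExD; [|by apply: L1D; exact: L1_abs|exact: L1Z].
rewrite ExD; [|exact: L1_abs|exact: L1_abs].
rewrite ExZ// Bn_mean -/(c n) divfK ?gt_eqF// lerD2r mulrC ler_pdivrMr//.
apply: (le_trans (lerD (lerD eU eL) (lexx _))).
have Yh0 : 0 <= Y n ^+ 2 * h n by apply: mulr_ge0; [exact: sqr_ge0|exact: ltW].
rewrite sqrtrM ?(Kq_ge0 fM K0 KM)// (sqrtrV Yh0).
have -> : Num.sqrt (Y n ^+ 2 * h n) = Y n * Num.sqrt (h n).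
  by rewrite sqrtrM ?sqr_ge0// sqrtr_sqr gtr0_norm.
rewrite le_eqVlt; apply/orP; left; apply/eqP; rewrite delE /sg /r.
have hE : h n = Num.sqrt (h n) ^+ 2 by rewrite sqr_sqrtr// ltW.
have yE : Y n = Num.sqrt (Y n) ^+ 2 by rewrite sqr_sqrtr// ltW.
move: (Num.sqrt (h n)) (Num.sqrt (Y n)) sh0 sy0 hE yE => sh sy sh0 sy0 -> ->; field.
by rewrite !gt_eqF.
Unshelve. all: end_near. Qed.

End regimes.

(** * Shift of the indices, and the theorem *)

Section reindexing.
Context {d : measure_display} {T : measurableType d} {R : realType}.
Variable P : probability T R.

(** The sets are indexed by [I]; a left inverse [psi] attaches them to the indices in [J]. *)
Let bigcap_map (I J : eqType) (phi : I -> J) (psi : J -> I) (X : J -> T -> R) (A : I -> set R) s :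
  cancel phi psi ->
  \bigcap_(j in [set` [seq phi i | i <- s]]) (X j @^-1` A (psi j)) =
  \bigcap_(i in [set` s]) (X (phi i) @^-1` A i).
Proof.
move=> phiK; apply/seteqP; split => w h i /= si.
  by have := h (phi i) (map_f phi si); rewrite /= phiK.
by move: si => /mapP[k sk ->]; rewrite phiK; exact: h.
Qed.

Lemma mutually_indep_reindex (I J : eqType) (phi : I -> J) (psi : J -> I) (X : J -> T -> R) :
  cancel phi psi -> mutually_indep P X -> mutually_indep P (fun i => X (phi i)).
Proof.
move=> phiK iX s A us mA; rewrite -(@bigcap_map _ _ phi psi X A s phiK) iX//.
- by rewrite big_map; apply: eq_bigr => i _; rewrite phiK.
- by rewrite map_inj_uniq//; exact: can_inj phiK.
Qed.

Lemma indep_families_reindex (I J I' J' : eqType) (phi : I -> J) (psi : J -> I)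
    (phi' : I' -> J') (psi' : J' -> I') (X : J -> T -> R) (Y : J' -> T -> R) :
  cancel phi psi -> cancel phi' psi' -> indep_families P X Y ->
  indep_families P (fun i => X (phi i)) (fun i => Y (phi' i)).
Proof.
move=> phiK phiK' iX s s' A B mA mB.
by rewrite -(@bigcap_map _ _ phi psi X A s phiK) -(@bigcap_map _ _ phi' psi' Y B s' phiK') iX.
Qed.

End reindexing.

(** The statistic runs over the indices 1 to [n], while quadratic forms are otherwise counted from
    0. *)
Lemma qstatE (T : Type) (R : realType) (e : int -> T -> R) (X : nat -> T -> R) K h n w :
  qstat e X K h n w = \sum_(t < n) \sum_(s < n | s != t)
    e s.+1%:Z w * K ((X s.+1 w - X t.+1 w) / h) * e t.+1%:Z w.
Proof.
rewrite /qstat big_add1 /= big_mkord; apply: eq_bigr => t _.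
by rewrite big_add1 /= big_mkord; apply: eq_bigl => s; rewrite eqSS.
Qed.

Theorem theorem2p3 (R : realType) (d : measure_display) (T : measurableType d)
  (P : probability T R)
  (xi : int -> {RV P >-> R}) (psi : int -> R) (e : int -> {RV P >-> R})
  (alpha eta : R)
  (X : nat -> {RV P >-> R}) (f : R -> R)
  (w : nat -> R) (alpha_t eta_t : nat -> {RV P >-> R})
  (K : R -> R) (h : nat -> R) :
  (* innovations xi_j: i.i.d., mean 0, variance 1, finite sixth moment *)
  mutually_indep P xi -> ident_distr P xi ->
  P.-integrable setT (EFin \o (fun v => xi 0 v ^+ 6)) ->
  ('E_P[xi 0%R] = 0)%E ->
  ('E_P[fun v => (xi 0%R v ^+ 2)%R] = 1)%E ->
  (* square summable coefficients: gamma(0) = sum_j psi_j^2 < oo *)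
  (exists l : R, ssum (fun j => psi j ^+ 2) N @[N --> \oo] --> l) ->
  (* e_t = sum_j psi_j xi_{t-j} (almost sure limit of the series) *)
  (forall t : int, {ae P, forall v,
      ssum (fun j => psi j * xi (t - j) v) N @[N --> \oo] --> e t v}) ->
  (* long memory: gamma(k) ~ eta k^(-alpha), 0 < alpha < 1, 0 < eta < oo *)
  0 < alpha < 1 -> 0 < eta ->
  (gam psi k%:Z / (eta * (k%:R `^ (- alpha)))) @[k --> \oo] --> (1:R) ->
  (* X_t i.i.d., independent of {e_s}, with bounded uniformly continuous density f *)
  mutually_indep P X -> ident_distr P X -> indep_families P X e ->
  (forall t, is_density P (X t) f) ->
  (exists M : R, forall x, `|f x| <= M) ->
  (forall eps : R, 0 < eps -> exists2 delta : R, 0 < delta &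
      forall x y, `|x - y| < delta -> `|f x - f y| < eps) ->
  (* estimators with ||lambda~ - lambda|| = O_P(w_n^-1), w_n / log n -> oo *)
  (forall n, 0 < w n) ->
  (w n / ln n%:R) @[n --> \oo] --> +oo ->
  (forall eps : R, 0 < eps -> exists M : R, exists N : nat, forall n, (N <= n)%N ->
      (P [set v | (M < w n * Num.sqrt ((alpha_t n v - alpha) ^+ 2 +
                                       (eta_t n v - eta) ^+ 2))%R] <= eps%:E)%E) ->
  (* K: bounded symmetric probability density, with the tail condition *)
  measurable_fun setT K -> (forall x, 0 <= K x) ->
  (\int[lebesgue_measure]_(x in [set: R]) (K x)%:E = 1)%E ->
  (forall x, K (- x) = K x) ->
  (exists M : R, forall x, K x <= M) ->
  (1 / 2 < alpha -> exists2 beta : R, 0 < beta < alpha - 1 / 2 &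
      exists C : R, exists M : R, forall x, M <= `|x| ->
        `|K x| <= C / (1 + `|x| `^ (1 - beta))) ->
  (* bandwidth *)
  (forall n, 0 < h n) ->
  let S := fun n => qstat (fun s => e s : T -> R) (fun t => X t : T -> R) K (h n) n in
  let A1sq := 2 * gam psi 0 ^+ 2 * lint (fun x => K x ^+ 2) * lint (fun y => f y ^+ 2) in
  let sigma1 := fun n : nat => Num.sqrt (n%:R ^+ 2 * h n * A1sq) in
  let A2 := (2 * eta) / ((1 - alpha) * (2 - alpha)) * lint (fun y => f y ^+ 2) in
  let sigma2 := fun n : nat => n%:R `^ (2 - alpha) * h n * A2 in
  (* (i) *)
  ((n%:R `^ (2 * (1 - alpha)) * h n) @[n --> \oo] --> (0:R) ->
   (n%:R * h n) @[n --> \oo] --> +oo ->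
   cvg_in_distr P (fun n v => S n v / sigma1 n) std_normal)
  /\
  (* (ii) *)
  (h n @[n --> \oo] --> (0:R) ->
   (n%:R `^ (2 * (1 - alpha)) * h n) @[n --> \oo] --> +oo ->
   cvg_in_distr P (fun n v => S n v / sigma2 n) chi2_1).
Proof.
move=> ixi idxi l6 Exi Exi2 [g cg] ae_e al eta0 gam_asym iX idX iXe Xf [M fM] f_unif _ _ _.
move=> mK K0 K1 KN [MK KM] _ h0 S A1sq sigma1 A2 sigma2.
have /andP[al0 al1] := al.
have m0 : Ex P (xi 0) = 0 by move: Exi; rewrite unlock /Ex /Rintegral => ->.
have v1 : Ex P (fun v => xi 0 v ^+ 2) = 1 by move: Exi2; rewrite unlock /Ex /Rintegral => ->.
have eL2 := e_L2 ixi idxi l6 m0 v1 cg ae_e.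
have evar := e_sqr ixi idxi l6 m0 v1 cg ae_e.
have e4 := e_pow4 ixi idxi l6 m0 v1 cg ae_e.
have elln := e_lln ixi idxi l6 m0 v1 cg ae_e.
have AL2 := An_L2 ixi idxi l6 m0 v1 cg ae_e.
have gE := gam0 cg.
(* Were the variance zero, all covariances would vanish by Cauchy-Schwarz, against their equivalence
   to [eta k^(-alpha)]. *)
have g_gt0 : 0 < g.
  rewrite lt_neqAle (g0_ge0 cg) andbT; apply/eqP => g0.
  have gk k : gam psi k%:Z = 0.
    have := e_cov ixi idxi l6 m0 v1 cg ae_e 0 k%:Z; rewrite subr0 => <-.
    apply/eqP; rewrite -normr_le0.
    have l : L1 P (fun v => e 0 v * e k%:Z v) by apply: L2_mul.
    apply: (le_trans (Ex_abs l)).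
    have := cauchy_schwarz ltr01 (@measurable_funP _ _ _ _ setT (e 0)) (@measurable_funP _ _ _ _ setT (e k%:Z)) (eL2 0) (eL2 k%:Z).
    by rewrite !evar -g0 mulr0 mul0r addr0 mul0r.
  have : \forall k \near \oo, 0 < gam psi k%:Z / (eta * (k%:R `^ (- alpha))) by exact: (cvgr_gt _ gam_asym _ ltr01).
  by move=> [k _ /(_ k (leqnn k))] /=; rewrite gk mul0r ltxx.
pose Y n : R := n%:R `^ (1 - alpha).
have nY n : n%:R `^ (2 - alpha) = n%:R * Y n.
  rewrite (_ : 2 - alpha = 1 + (1 - alpha)); last by ring.
  by rewrite powRD ?powRr1//; apply/implyP => /eqP; lra.
have Y2 n : n%:R `^ (2 * (1 - alpha)) = Y n ^+ 2.
  by rewrite mulrC powRrM -powR_mulrn// powR_ge0.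
have Y0 n : (0 < n)%N -> 0 < Y n by move=> n0; apply: powR_gt0; rewrite ltr0n.
have Yoo : Y @ \oo --> +oo by apply: powR_nat_cvgy; lra.
(* [An_sqr_rec] ties the variance of the partial sums to the autocovariances; [cA] is the factor of
   [A2] in front of the integral of [f^2]. *)
have growth := double_sum_growth al eta0 gam_asym (An_sqr_rec ixi idxi l6 m0 v1 cg ae_e).
set cA := 2 * eta / _ in growth.
have cA0 : 0 < cA by rewrite divr_gt0 ?mulr_gt0//; lra.
have growth' : (Ex P (fun v => An e n v ^+ 2) / (n%:R * Y n)) @[n --> \oo] --> cA.
  by apply: cvg_trans growth; apply: near_eq_cvg; apply: nearW => n; rewrite nY.
have An_clt : wcdf P (fun n v => An e n v / Num.sqrt (Ex P (fun v => An e n v ^+ 2))) cdfg.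
  apply: wcdf_normal => [n|B phi phi1 phi2 sm].
    by apply: measurable_funM => //; exact: An_meas.
  apply/cvgrPdist_le => eps e0.
  pose r n := Ex P (fun v => An e n v ^+ 2) / (n%:R * Y n).
  (* The bound on a squared weight over the variance is [n g / (n Y r) = g / (Y r)]; it tends to 0
     because [alpha < 1]. *)
  have u0 : (B * (xi3 xi + gauss3) * Num.sqrt (g * ((Y n)^-1 * (r n)^-1))) @[n --> \oo] --> (0 : R).
    rewrite -[X in _ --> X](mulr0 (B * (xi3 xi + gauss3))); apply: cvgM; first exact: cvg_cst.
    have u1 : (g * ((Y n)^-1 * (r n)^-1)) @[n --> \oo] --> (0 : R).
      rewrite -[X in _ --> X](mulr0 g); apply: cvgM; first exact: cvg_cst.
      rewrite -[X in _ --> X](mul0r cA^-1); apply: cvgM; last by apply: cvgV => //; rewrite gt_eqF.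
      apply/gtr0_cvgV0 => //; near=> n; apply: Y0; near: n; exact: nbhs_infty_gt.
    by have := cvg_comp _ _ u1 (@sqrt_continuous R 0); rewrite sqrtr0; exact.
  near=> n.
  have n0 : (0 < n)%N by near: n; exact: nbhs_infty_gt.
  have N0 : 0 < n%:R :> R by rewrite ltr0n.
  have Yn := Y0 n n0.
  have r0 : 0 < r n by near: n; exact: (cvgr_gt _ growth' _ cA0).
  have c0 : 0 < Ex P (fun v => An e n v ^+ 2) by move: r0; rewrite /r pmulr_lgt0// invr_gt0 mulr_gt0.
  have s0 : 0 < Num.sqrt (Ex P (fun v => An e n v ^+ 2)) by rewrite sqrtr_gt0.
  have un : B * (xi3 xi + gauss3) * Num.sqrt (g * ((Y n)^-1 * (r n)^-1)) <= eps.
    by near: n; exact: (cvgr_le _ u0 _ e0).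
  rewrite distrC; apply: le_trans un.
  have := An_clt_bound ixi idxi l6 m0 v1 cg ae_e s0 (sqr_sqrtr (ltW c0)) sm.
  rewrite mulrA -sqrtrV ?(ltW c0)// -sqrtrM; last by rewrite mulr_ge0// ltW.
  rewrite (_ : n%:R * g / _ = g * ((Y n)^-1 * (r n)^-1))//.
  by rewrite /r; field; rewrite !gt_eqF.
(* Indices now start at 0, so the density is taken at [X 1]. *)
pose X' i := X i.+1; pose e' (i : nat) := e i.+1%:Z.
have iX' : mutually_indep P (fun i => X' i : T -> R).
  exact: (@mutually_indep_reindex _ _ _ P _ _ succn predn (fun i => X i : T -> R)).
have idX' : ident_distr P (fun i => X' i : T -> R) by move=> i j A mA; exact: idX.
have iXe' : indep_families P (fun i => X' i : T -> R) (fun i => e' i : T -> R).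
  exact: (@indep_families_reindex _ _ _ P _ _ _ _ succn predn (fun i : nat => i.+1%:Z)
    (fun j => `|j|%N.-1) (fun i => X i : T -> R) (fun j => e j : T -> R)).
have SE n : S n = kform X' K e' h n by apply/funext => v; exact: qstatE.
have mS n : measurable_fun setT (S n) by rewrite SE; exact: kform_meas.
split.
- rewrite (_ : (fun n => _) = (fun n => Y n ^+ 2 * h n)); last by apply/funext => n; rewrite Y2.
  move=> Yh nh.
  have Yge1 : \forall n \near \oo, 1 <= Y n by move/cvgryPge : Yoo; exact.
  (* Here [h] tends to 0 because [Y n >= 1] eventually, so that [h <= Y^2 h]. *)
  have hc : h @ \oo --> (0 : R).
    apply: (@squeeze_cvgr _ _ _ _ (cst 0) (fun n => Y n ^+ 2 * h n)) => //; last exact: cvg_cst.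
    near=> n; rewrite (ltW (h0 n)) /= ler_peMl ?(ltW (h0 n))//.
    have Y1 : 1 <= Y n by near: n; exact: Yge1.
    by rewrite expr2 mulr_ege1.
  apply: (@wcdf_cvg_in_distr _ _ _ _ _ _ cdfg).
  + by move=> n; exact: measurable_funM.
  + move=> x; have mx : measurable [set z : measurableTypeR R | z <= x] by exact: measurable_le_set.
    by rewrite /cdfg PrE.
  + have := kform_normal iX' idX' (Xf 1%N) fM f_unif mK K0 K1 KN KM iXe' g_gt0
      (fun i => eL2 _) (fun i => evar _) (fun i => (e4 _).1) (fun i => (e4 _).2) elln h0 hc Y0 AL2 growth' Yh nh.
    by rewrite /sigma1 /A1sq gE; under eq_fun do rewrite -SE.
- move=> hc; rewrite (_ : (fun n => _) = (fun n => Y n ^+ 2 * h n)); last by apply/funext => n; rewrite Y2.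
  move=> Yh.
  apply: (@wcdf_cvg_in_distr _ _ _ _ _ _ cdfg2).
  + by move=> n; exact: measurable_funM.
  + move=> x; have mx : measurable [set z : measurableTypeR R | z ^+ 2 <= x].
      by apply: measurable_le_set; exact: measurable_funX.
    rewrite /cdfg2 PrE// /chi2_1; congr (normal_prob _ _ _).
    by apply/seteqP; split => z /=; rewrite inE.
  + have -> : (fun n v => S n v / sigma2 n) = (fun n v => kform X' K e' h n v /
        (n%:R * Y n * h n * (cA * lint (fun y => f y ^+ 2)))).
      by apply/funext => n; rewrite /sigma2 nY SE.
    exact: (kform_chi2 iX' idX' (Xf 1%N) fM f_unif mK K0 K1 KN KM iXe'
      (fun i => eL2 _) (fun i => evar _) h0 hc Y0 Yoo AL2 growth' cA0 Yh An_clt).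
Unshelve. all: end_near. Qed.
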